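(* Let $n$ be a positive integer and consider the differential system $\dot x = Ax+f(x)$, $x\in\mathbb R^n$, where $A$ is a real $n\times n$ matrix and $f$ is an $\mathbb R^n$-valued $C^\infty$ function defined in a neighborhood of the origin whose Taylor expansion at the origin has no constant and no linear terms. Let $\lambda_1,\ldots,\lambda_n\in\mathbb C$ be the eigenvalues of $A$ (counted with multiplicity). Assume that $\lambda_1=0$, and that $\lambda_2,\ldots,\lambda_n$ either all have positive real parts or all have negative real parts. Then the system has a $C^\infty$ non-flat first integral in a neighborhood of the origin if and only if there exists a curve passing through the origin which consists entirely of singular points of the system.
   Context: A singular point of $\dot x=Ax+f(x)$ is a point $p$ with $Ap+f(p)=0$. A $C^\infty$ first integral in a neighborhood of the origin is a $C^\infty$ real function $H$, defined in some neighborhood of $0\in\mathbb R^n$ and normalized by $H(0)=0$, such that $\langle\nabla H(x),\,Ax+f(x)\rangle\equiv 0$ there, where $\nabla H$ is the gradient of $H$ and $\langle\cdot,\cdot\rangle$ is the inner product. It is non-flat if its Taylor expansion at the origin does not identically vanish. A curve passing through the origin means the image of a continuous injective map $\gamma:(-\varepsilon,\varepsilon)\to\mathbb R^n$, for some $\varepsilon>0$, with $\gamma(0)=0$ (so the origin is an interior point of the curve). *)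

(* Defs.v *)
From mathcomp Require Import all_boot all_order all_algebra.
From mathcomp Require Import all_classical all_reals all_analysis.
From mathcomp Require Import complex.

Set Implicit Arguments.
Unset Strict Implicit.
Unset Printing Implicit Defensive.

Import Order.TTheory GRing.Theory Num.Theory.
Import numFieldNormedType.Exports.

Local Open Scope classical_set_scope.
Local Open Scope ring_scope.

(* Functions "defined on an open set V" are total functions of which only the
   values on V matter; points of R^n are column vectors. *)

Section Calculus.
Context {R : realType} {n : nat} {W : normedModType R}.
Implicit Types (f : 'cV[R]_n -> W) (s : seq 'I_n) (alpha : 'I_n -> nat).

Definition partial (i : 'I_n) f : 'cV[R]_n -> W := 'D_(delta_mx i ord0) f.

Definition iter_partial s f : 'cV[R]_n -> W := foldr partial f s.

(* C^infinity on V: every iterated partial derivative, taken in any order,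
   exists and is continuous at each point of V; meant for open V. *)
Definition smooth_on (V : set 'cV[R]_n) f : Prop :=
  forall s x, V x ->
    {for x, continuous (iter_partial s f)} /\
    forall i, derivable (iter_partial s f) x (delta_mx i ord0).

Definition multi_partial alpha f : 'cV[R]_n -> W :=
  iter_partial (flatten [seq nseq (alpha i) i | i <- enum 'I_n]) f.

(* The coefficient of (x - a)^alpha in the Taylor expansion of f at a. *)
Definition taylor_coef f (a : 'cV[R]_n) alpha : W :=
  ((\prod_i (alpha i)`!)%N%:R)^-1 *: multi_partial alpha f a.

End Calculus.

Section System.
Context {R : realType} {n : nat}.
Implicit Types (A : 'M[R]_n) (f : 'cV[R]_n -> 'cV[R]_n) (H : 'cV[R]_n -> R).

Definition no_constant_nor_linear_terms f : Prop :=
  forall alpha : 'I_n -> nat, (\sum_i alpha i <= 1)%N -> taylor_coef f 0 alpha = 0.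

Definition vector_field A f (x : 'cV[R]_n) : 'cV[R]_n := A *m x + f x.

Definition gradient H (x : 'cV[R]_n) : 'cV[R]_n := \col_i partial i H x.

Definition inner (u v : 'cV[R]_n) : R := \sum_i u i ord0 * v i ord0.

Definition non_flat H : Prop :=
  exists alpha : 'I_n -> nat, taylor_coef H 0 alpha != 0.

(* H is defined on the open neighborhood U of the origin. *)
Definition smooth_first_integral A f (U : set 'cV[R]_n) H : Prop :=
  [/\ smooth_on U H, H 0 = 0 &
      forall x, U x -> inner (gradient H x) (vector_field A f x) = 0].

(* V is the domain of definition of f. *)
Definition singular_point A f (V : set 'cV[R]_n) (p : 'cV[R]_n) : Prop :=
  V p /\ vector_field A f p = 0.

Definition curve_through_origin (C : set 'cV[R]_n) : Prop :=
  exists (eps : R) (gamma : R -> 'cV[R]_n),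
    [/\ 0 < eps,
        {within `]- eps, eps[, continuous gamma},
        {in `]- eps, eps[ &, injective gamma},
        gamma 0 = 0 &
        C = gamma @` `]- eps, eps[].

(* The eigenvalues of A are the roots of the characteristic polynomial of its
   complexification, so that each is listed with its algebraic multiplicity. *)
Definition eigenvalues_of A (lambda : 'I_n -> R[i]) : Prop :=
  char_poly (map_mx (real_complex R) A) = \prod_i ('X - (lambda i)%:P).

End System.

(* Main.v *)
(* Up to replacing (A, f) by (-A, -f), the nonzero part of A is contracting; let
   A v = 0, w A = 0, w v = 1, and call w x the slow coordinate of x.

   Necessity.  The leading homogeneous part of a first integral H is constant
   along the linear flow, which tends to the line of v, so it is a nonzero
   multiple of (w x)^m.  A contraction argument gives, for each small s, a point
   Y s = s v + O(s^2) at which the vector field is a multiple g v of v.  There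
   g times the derivative of H along v vanishes, while that derivative is
   equivalent to a nonzero multiple of s^(m-1); hence g = 0 and Y is a curve of
   singular points.

   Sufficiency.  A curve of singular points is a smooth graph over the slow
   coordinate and can be straightened.  Every orbit issued near 0 then converges
   exponentially to an equilibrium, whose slow coordinate is the first integral.
   The limit map is smooth because the tangent system (x, u)' = (X x, DX(x) u)
   is of the same kind and its limit map is the derivative of the original one,
   so that an induction on the order of differentiability applies. *)
Require Import Defs.
From mathcomp Require Import all_boot all_order all_algebra.
From mathcomp Require Import all_classical all_reals all_analysis.
From mathcomp Require Import spectral complex ring lra.

From HB Require Import structures.

Set Implicit Arguments.
Unset Strict Implicit.
Unset Printing Implicit Defensive.

Import Order.TTheory GRing.Theory Num.Theory.
Import numFieldNormedType.Exports.

Local Open Scope classical_set_scope.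
Local Open Scope ring_scope.

(** * Calculus on column vectors *)

Section VectorNorms.
Context {R : realType}.

(** The obstacle is that the linearized flow is neutral along the curve of equilibria: two orbits
    need not approach each other, so no plain contraction argument compares them. What compensates
    is that, at an equilibrium, the Jacobian kills the direction of the curve; at a point z it
    therefore acts on that direction with size O(|J z|), and J z decays exponentially along orbits.
    The slow drift is thus integrable in time, which yields bounded differences of orbits, their
    convergence, and the derivatives of the limit map. The matrix J carries an adapted inner product
    for the fast directions: its rows come from the real and imaginary parts of a rescaled complex
    triangularization, so J is in general not square and no real normal form is involved. The notion
    [attracting] refers to a compact convex set and a projector, rather than to a spectrum and a
    small neighborhood of 0, because the tangent system must inherit it; there the equilibria form a
    space of twice the dimension and the variational component need not be small. *)

Lemma mx_coord_le m n (M : 'M[R]_(m, n)) i j : `|M i j| <= `|M|.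
Proof.
by rewrite [leRHS]/Num.Def.normr/= mx_normrE; exact: (le_bigmax _ _ (i, j)).
Qed.

Lemma mx_norm_le m n (M : 'M[R]_(m, n)) c :
  0 <= c -> (forall i j, `|M i j| <= c) -> `|M| <= c.
Proof.
move=> c0 h; rewrite [leLHS]/Num.Def.normr/= mx_normrE.
by apply: bigmax_le => // -[i j] _; exact: h.
Qed.

Lemma cV_norm_le n (x : 'cV[R]_n) c :
  0 <= c -> (forall i, `|x i ord0| <= c) -> `|x| <= c.
Proof. by move=> c0 h; apply: mx_norm_le => // i j; rewrite ord1. Qed.

Lemma ler_sum_const n (F : 'I_n -> R) c :
  (forall i, F i <= c) -> \sum_i F i <= n%:R * c.
Proof.
move=> h; apply: (le_trans (ler_sum _ (fun i _ => h i))).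
by rewrite sumr_const card_ord mulr_natl.
Qed.

Lemma ler_norm_sum_const n (F : 'I_n -> R) c :
  (forall i, `|F i| <= c) -> `|\sum_i F i| <= n%:R * c.
Proof.
by move=> h; apply: (le_trans (ler_norm_sum _ _ _)); exact: ler_sum_const.
Qed.

Lemma mulmx_norm_le m n (M : 'M[R]_(m, n)) (x : 'cV[R]_n) :
  `|M *m x| <= n%:R * `|M| * `|x|.
Proof.
apply: cV_norm_le => [|i]; first by rewrite !mulr_ge0.
rewrite mxE -mulrA; apply: ler_norm_sum_const => j.
by rewrite normrM ler_pM // mx_coord_le.
Qed.

(** The summand 1 keeps the constant positive for a zero matrix and in dimension 0, so that it can
    be divided by. *)
Lemma mulmx_bound m n (M : 'M[R]_(m, n)) :
  exists2 C : R, 0 < C & forall x : 'cV[R]_n, `|M *m x| <= C * `|x|.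
Proof.
exists (n%:R * `|M| + 1); first by rewrite ltr_wpDl // mulr_ge0.
move=> x; apply: (le_trans (mulmx_norm_le _ _)).
by rewrite ler_wpM2r // lerDl.
Qed.

Lemma innerC n (x y : 'cV[R]_n) : inner x y = inner y x.
Proof. by apply: eq_bigr => i _; rewrite mulrC. Qed.

Lemma innerDl n (x y z : 'cV[R]_n) : inner (x + y) z = inner x z + inner y z.
Proof. by rewrite -big_split; apply: eq_bigr => i _; rewrite mxE mulrDl. Qed.

Lemma innerZl n a (x z : 'cV[R]_n) : inner (a *: x) z = a * inner x z.
Proof. by rewrite mulr_sumr; apply: eq_bigr => i _; rewrite mxE mulrA. Qed.

Lemma innerDr n (x y z : 'cV[R]_n) : inner z (x + y) = inner z x + inner z y.
Proof. by rewrite !(innerC z) innerDl. Qed.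

Lemma innerZr n a (x z : 'cV[R]_n) : inner z (a *: x) = a * inner z x.
Proof. by rewrite !(innerC z) innerZl. Qed.

Lemma innerNr n (x z : 'cV[R]_n) : inner z (- x) = - inner z x.
Proof. by rewrite -scaleN1r innerZr mulN1r. Qed.

Lemma innerBr n (x y z : 'cV[R]_n) : inner z (x - y) = inner z x - inner z y.
Proof. by rewrite innerDr innerNr. Qed.

Lemma inner0r n (z : 'cV[R]_n) : inner z 0 = 0.
Proof. by rewrite -(scale0r 0) innerZr mul0r. Qed.

Lemma inner_ge0 n (x : 'cV[R]_n) : 0 <= inner x x.
Proof. by apply: sumr_ge0 => i _; rewrite -expr2 sqr_ge0. Qed.

Lemma inner_le n (x y : 'cV[R]_n) : `|inner x y| <= n%:R * (`|x| * `|y|).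
Proof.
apply: ler_norm_sum_const => i.
by rewrite normrM ler_pM // mx_coord_le.
Qed.

(** The norm of a matrix is the maximum of its entries in absolute value. Energy estimates run on
    [inner x x], which is differentiable; going back to the norm costs the factor n of the next
    lemma. *)
Lemma sqr_norm_le_inner n (x : 'cV[R]_n) : `|x| ^+ 2 <= inner x x.
Proof.
rewrite -[leRHS]sqr_sqrtr ?inner_ge0 // ler_pXn2r ?nnegrE ?sqrtr_ge0 //.
apply: cV_norm_le => [|i]; first exact: sqrtr_ge0.
rewrite -sqrtr_sqr ler_sqrt ?inner_ge0 // /inner (bigD1 i) //= -expr2 lerDl.
by apply: sumr_ge0 => j _; rewrite -expr2 sqr_ge0.
Qed.

Lemma inner_le_sqr_norm n (x : 'cV[R]_n) : inner x x <= n%:R * `|x| ^+ 2.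
Proof. by rewrite expr2; apply: le_trans (ler_norm _) (inner_le _ _). Qed.

Lemma inner_col_mx m n (a b : 'cV[R]_m) (c d : 'cV[R]_n) :
  inner (col_mx a c) (col_mx b d) = inner a b + inner c d.
Proof.
rewrite /inner big_split_ord /=; congr (_ + _); apply: eq_bigr => i _.
  by rewrite !col_mxEu.
by rewrite !col_mxEd.
Qed.

Lemma norm_col_mx_le m n (a : 'cV[R]_m) (b : 'cV[R]_n) c :
  `|a| <= c -> `|b| <= c -> `|col_mx a b| <= c.
Proof.
move=> ha hb; apply: cV_norm_le => [|i]; first exact: le_trans ha.
rewrite -(splitK i); case: (fintype.split i) => j /=.
  by rewrite col_mxEu (le_trans (mx_coord_le _ _ _)).
by rewrite col_mxEd (le_trans (mx_coord_le _ _ _)).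
Qed.

Lemma norm_usubmx_le m n (x : 'cV[R]_(m + n)) : `|usubmx x| <= `|x|.
Proof. by apply: cV_norm_le => // i; rewrite mxE mx_coord_le. Qed.

Lemma norm_dsubmx_le m n (x : 'cV[R]_(m + n)) : `|dsubmx x| <= `|x|.
Proof. by apply: cV_norm_le => // i; rewrite mxE mx_coord_le. Qed.

End VectorNorms.

(** * Derivatives along a real parameter, mean value inequalities, Gronwall's lemma *)

Section RealDerivatives.
Context {R : realType}.

Lemma is_derive_cVP n (z : R -> 'cV[R]_n) (t : R) dz :
  is_derive t (1 : R) z dz <->
  forall i, is_derive t (1 : R) (fun s => z s i ord0) (dz i ord0).
Proof.
split=> [[dvb dvl] i|h].
  have h := (derivable_mxP _ _ _).1 dvb i ord0.
  by split => //; rewrite -dvl derive_mx // mxE.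
have dvb : derivable z t 1.
  by apply/derivable_mxP => i j; rewrite ord1; case: (h i).
split => //; rewrite derive_mx //; apply/matrixP => i j; rewrite mxE ord1.
by case: (h i).
Qed.

Lemma is_derive_inner n (x y : R -> 'cV[R]_n) t dx dy :
  is_derive t (1 : R) x dx -> is_derive t (1 : R) y dy ->
  is_derive t (1 : R) (fun s => inner (x s) (y s))
    (inner dx (y t) + inner (x t) dy).
Proof.
move=> /is_derive_cVP hx /is_derive_cVP hy.
have -> : (fun s => inner (x s) (y s)) =
    \sum_i ((fun s => x s i ord0) * (fun s => y s i ord0)).
  by apply/funext => s; rewrite fct_sumE.
apply: is_derive_eq; rewrite -big_split /=; apply: eq_bigr => i _.
by rewrite addrC mulrC [RHS]addrC [dx _ _ * _]mulrC addrC [_ *: _]mulrC.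
Qed.

Lemma is_derive_mulmx m n (M : 'M[R]_(m, n)) (z : R -> 'cV[R]_n) t dz :
  is_derive t (1 : R) z dz -> is_derive t (1 : R) (fun s => M *m z s) (M *m dz).
Proof.
move=> /is_derive_cVP hz; apply/is_derive_cVP => i.
have -> : (fun s => (M *m z s) i ord0) =
    \sum_j (M i j *: (fun s => z s j ord0)).
  by apply/funext => s; rewrite fct_sumE mxE.
by apply: is_derive_eq; rewrite mxE.
Qed.

Lemma is_derive_cont (V : normedModType R) (f : R -> V) t df :
  is_derive t (1 : R) f df -> {for t, continuous f}.
Proof.
by move=> [h _]; apply: differentiable_continuous; apply/derivable1_diffP.
Qed.

Lemma deriv_le0_nincr (f df : R -> R) (a b : R) :
  a <= b -> (forall t, t \in `[a, b] -> is_derive t (1 : R) f (df t)) ->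
  (forall t, t \in `[a, b] -> df t <= 0) -> f b <= f a.
Proof.
move=> ab hd hle.
have sub t : t \in `]a, b[ -> t \in `[a, b] by apply: subset_itv_oo_cc.
have hc : {within `[a, b], continuous f}.
  by apply: derivable_within_continuous => s /hd [].
have [c cab e] := MVT_segment ab (fun t h => hd t (sub t h)) hc.
by rewrite -subr_le0 e mulr_le0_ge0 ?subr_ge0 // hle.
Qed.

Lemma deriv_le_incr (f df g dg : R -> R) (a b : R) :
  a <= b -> (forall t, t \in `[a, b] -> is_derive t (1 : R) f (df t)) ->
  (forall t, t \in `[a, b] -> is_derive t (1 : R) g (dg t)) ->
  (forall t, t \in `[a, b] -> df t <= dg t) -> f b - f a <= g b - g a.
Proof.
move=> ab hf hg hle.
have := @deriv_le0_nincr (f - g) (fun t => df t - dg t) a b ab.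
have hd t : t \in `[a, b] -> is_derive t (1 : R) (f - g) (df t - dg t).
  by move=> h; have := hf _ h; have := hg _ h => ? ?; apply: is_derive_eq.
move=> /(_ hd) H.
have /H : forall t, t \in `[a, b] -> df t - dg t <= 0.
  by move=> t /hle; rewrite subr_le0.
by rewrite /= -[(f - g) b]/(f b - g b) -[(f - g) a]/(f a - g a); lra.
Qed.

Lemma deriv_norm_le (f df g dg : R -> R) (a b : R) :
  a <= b -> (forall t, t \in `[a, b] -> is_derive t (1 : R) f (df t)) ->
  (forall t, t \in `[a, b] -> is_derive t (1 : R) g (dg t)) ->
  (forall t, t \in `[a, b] -> `|df t| <= dg t) -> `|f b - f a| <= g b - g a.
Proof.
move=> ab hf hg hle; rewrite ler_norml; apply/andP; split.
  have := @deriv_le_incr (- f) (fun t => - df t) g dg a b ab.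
  have hd t : t \in `[a, b] -> is_derive t (1 : R) (- f) (- df t).
    by move=> h; have := hf _ h => ?; apply: is_derive_eq.
  move=> /(_ hd hg) H.
  have /H : forall t, t \in `[a, b] -> - df t <= dg t.
    by move=> t /hle; rewrite ler_norml => /andP[]; lra.
  by rewrite -[(- f) b]/(- f b) -[(- f) a]/(- f a); lra.
apply: (deriv_le_incr ab hf hg) => t /hle.
by apply: le_trans; exact: ler_norm.
Qed.

(** For the maximum norm, the vector-valued mean value inequality reduces to the scalar one in each
    coordinate. *)
Lemma deriv_norm_le_cV n (f df : R -> 'cV[R]_n) (g dg : R -> R) (a b : R) :
  a <= b -> (forall t, t \in `[a, b] -> is_derive t (1 : R) f (df t)) ->
  (forall t, t \in `[a, b] -> is_derive t (1 : R) g (dg t)) ->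
  (forall t, t \in `[a, b] -> `|df t| <= dg t) -> `|f b - f a| <= g b - g a.
Proof.
move=> ab hf hg hle.
have gab : 0 <= g b - g a.
  have := @deriv_le_incr (fun=> 0) (fun=> 0) g dg a b ab.
  rewrite subrr; apply => //.
  by move=> t /hle; apply: le_trans.
apply: cV_norm_le => // i; rewrite !mxE.
apply: (@deriv_norm_le (fun t => f t i ord0) (fun t => df t i ord0) g dg) => //.
  by move=> t /hf /is_derive_cVP.
by move=> t /hle; apply: le_trans; exact: mx_coord_le.
Qed.

Lemma is_derive_expR_comp (C : R -> R) t dC :
  is_derive t (1 : R) C dC ->
  is_derive t (1 : R) (fun s => expR (C s)) (dC * expR (C t)).
Proof.
by move=> h; have := @is_derive1_comp R expR C t _ _ (is_derive_expR (C t)) h;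
  rewrite mulrC.
Qed.

(** The product of [u] and exp(-C) is nonincreasing. The rate [dC] may vary with time and have any
    sign: a negative constant gives decay, an integrable rate gives bounded growth. *)
Lemma gronwall (u du C dC : R -> R) (T : R) :
  0 <= T ->
  (forall t, t \in `[0, T] -> is_derive t (1 : R) u (du t)) ->
  (forall t, t \in `[0, T] -> is_derive t (1 : R) C (dC t)) ->
  (forall t, t \in `[0, T] -> du t <= dC t * u t) ->
  u T <= u 0 * expR (C T - C 0).
Proof.
move=> T0 hu hC hle.
have hd t : t \in `[0, T] -> is_derive t (1 : R)
    (u * (fun s => expR ((- C) s)))
    (expR (- C t) * (du t - dC t * u t)).
  move=> h; have hu' := hu _ h; have hC' := hC _ h.
  have hC2 : is_derive t (1 : R) (- C) (- dC t) by apply: is_derive_eq.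
  have hE := is_derive_expR_comp hC2.
  apply: is_derive_eq => /=; rewrite -![_ *: _]/(_ * _) -[(- C) t]/(- C t).
  by ring.
have := deriv_le0_nincr T0 hd.
have H t : t \in `[0, T] -> expR (- C t) * (du t - dC t * u t) <= 0.
  by move=> h; rewrite mulr_ge0_le0 ?expR_ge0 // subr_le0 hle.
move=> /(_ H); rewrite -![(_ * _) _]/(_ * _) -![(- C) _]/(- C _).
rewrite -[X in X <= _ -> _]/(u T * expR (- C T)) -[X in _ <= X -> _]/(u 0 * expR (- C 0)).
by move=> h; rewrite addrC expRD mulrA -ler_pdivrMr ?expR_gt0 // -expRN.
Qed.

End RealDerivatives.

(** Gives column vectors the complete normed module structure over which the next limits are
    stated. *)
HB.instance Definition _ (R : realType) m n := Complete.on 'M[R]_(m, n).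

(** * Limits of sequences with a controlled tail *)

Section Completeness.
Context {R : realType}.

Lemma cauchy_tail_lim (V : completeNormedModType R) (u : nat -> V) (e : nat -> R) :
  e @ \oo --> 0 -> (forall k m, (k <= m)%N -> `|u m - u k| <= e k) ->
  exists l, forall k, `|l - u k| <= e k.
Proof.
move=> e0 h.
have cu : cvgn u.
  apply/cauchy_cvgP/cauchyP => r r0.
  have : \forall k \near \oo, `|0 - e k| < r.
    by move/cvgrPdist_lt : e0; exact.
  move=> [N _ hN]; exists (u N); exists N => // m /= Nm.
  rewrite -ball_normE /= distrC.
  apply: le_lt_trans (h _ _ Nm) _; apply: le_lt_trans (ler_norm _) _.
  by rewrite -normrN -sub0r; apply: hN => /=.
exists (limn u) => k.
have hc : (fun m => `|u m - u k|) @ \oo --> `|limn u - u k|.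
  by apply: cvg_norm; apply: cvgB => //; exact: cvg_cst.
apply: (cvgr_to_le hc); exists k => // m; exact: h.
Qed.

Lemma cvg_half_expn (C : R) : (fun k => C / 2 ^+ k) @ \oo --> (0 : R).
Proof.
rewrite -[0](mulr0 C); apply: cvgM; first exact: cvg_cst.
have -> : (fun k => (2 ^+ k)^-1) = (fun k => (2^-1 : R) ^+ k).
  by apply/funext => k; rewrite exprVn.
apply: cvg_expr; rewrite ger0_norm ?invr_ge0 // invf_lt1 ?ltr0n //.
by rewrite ltr1n.
Qed.

Lemma geometric_tail_lim (V : completeNormedModType R) (u : nat -> V) (C : R) :
  (forall k, `|u k.+1 - u k| <= C / 2 ^+ k) ->
  exists l, forall k, `|l - u k| <= 2 * C / 2 ^+ k.
Proof.
move=> h; apply: cauchy_tail_lim => [|k m km]; first exact: cvg_half_expn.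
have C0 : 0 <= C by have := le_trans (normr_ge0 _) (h 0%N); rewrite expr0 divr1.
(* The subtracted remainder is what lets the bound pass through the induction on m - k. *)
suff : `|u m - u k| <= 2 * C / 2 ^+ k - 2 * C / 2 ^+ m.
  move/le_trans; apply; rewrite gerBl.
  by rewrite mulr_ge0 ?invr_ge0 ?exprn_ge0 ?mulr_ge0.
rewrite -(subnKC km); elim: (m - k)%N => [|j IH].
  by rewrite addn0 !subrr normr0.
rewrite addnS -(subrKA (u (k + j)%N)).
apply: le_trans (ler_normD _ _) _.
apply: le_trans (lerD (h _) IH) _.
have p0 : (2 ^+ (k + j) : R) != 0 by rewrite expf_neq0.
rewrite (_ : 2 * C / 2 ^+ (k + j).+1 = C / 2 ^+ (k + j)); last first.
  by rewrite exprS; field.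
lra.
Qed.

End Completeness.

(** * Primitives of continuous curves *)

Section Primitives.
Context {R : realType}.

Lemma continuous_primitive (g : R -> R) : continuous g ->
  exists F : R -> R, F 0 = 0 /\
    forall t : R, 0 <= t -> is_derive t (1 : R) F (g t).
Proof.
move=> cg.
pose mu := @lebesgue_measure R.
(* Integrating from -1 makes 0 an interior point, whence a two-sided derivative at 0 as well; the
   value at 0 is subtracted afterwards. *)
pose G := fun x => (\int[mu]_(t in [set` `[(-1)%R, x]]) (g t))%R.
exists (fun x => G x - G 0); split; first by rewrite subrr.
move=> t t0.
have ti : mu.-integrable `[-1, t + 1] (EFin \o g).
  apply: continuous_compact_integrable; first exact: segment_compact.
  exact: continuous_subspaceT.
have t1 : t < t + 1 by rewrite ltrDl.
have t2 : -1 < t by rewrite (lt_le_trans _ t0) // ltrN10.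
have [h1 h2] := continuous_FTC1_closed t1 ti t2 (cg t).
have hG : is_derive t (1 : R) G (g t).
  by apply: DeriveDef; [exact: h1|rewrite -derive1E; exact: h2].
have -> : (fun x => G x - G 0) = G - cst (G 0) by [].
apply: (is_derive_eq (is_deriveB hG (is_derive_cst (G 0) t 1))).
by rewrite subr0.
Qed.

Lemma continuous_cV_coord n (g : R -> 'cV[R]_n) i : continuous g ->
  continuous (fun t => g t i ord0).
Proof.
move=> cg t; exact: (continuous_comp (cg t) (@coord_continuous _ _ _ i ord0 _)).
Qed.

Lemma continuous_primitive_cV n (g : R -> 'cV[R]_n) : continuous g ->
  exists F : R -> 'cV[R]_n, F 0 = 0 /\
    forall t : R, 0 <= t -> is_derive t (1 : R) F (g t).
Proof.
move=> cg.
have /choice [F hF] := fun i => continuous_primitive (@continuous_cV_coord n g i cg).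
exists (fun t => \col_i F i t); split.
  by apply/matrixP => i j; rewrite !mxE; case: (hF i).
move=> t t0; apply/is_derive_cVP => i.
rewrite (_ : (fun s => _) = F i); last by apply/funext => s; rewrite mxE.
by case: (hF i) => _; apply.
Qed.

End Primitives.

(** * Global existence on the half-line for globally Lipschitz equations *)

Section Picard.
Context {R : realType} {n : nat}.
Variables (F : R -> 'cV[R]_n -> 'cV[R]_n) (L B : R) (z0 : 'cV[R]_n).
Hypothesis F_cont : forall y, continuous y -> continuous (fun t => F t (y t)).
Hypothesis L_ge1 : 1 <= L.
Hypothesis F_lip : forall (t : R) x y, 0 <= t -> `|F t x - F t y| <= L * `|x - y|.
Hypothesis F_bnd : forall t : R, 0 <= t -> `|F t z0| <= B.

(** The continuity of [y] is placed under the existential so that choice yields a total operator,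
    arbitrary on discontinuous curves. *)
Let pic_exists (y : R -> 'cV[R]_n) : exists G : R -> 'cV[R]_n,
  continuous y -> G 0 = z0 /\
    forall t : R, 0 <= t -> is_derive t (1 : R) G (F t (y t)).
Proof.
have [cy|ncy] := pselect (continuous y); last by exists y.
have [G [G0 dG]] := continuous_primitive_cV (F_cont cy).
exists (cst z0 + G) => _; split.
  by rewrite -[LHS]/(z0 + G 0) G0 addr0.
move=> t /dG h; apply: (is_derive_eq (is_deriveD (is_derive_cst z0 t 1) h)).
by rewrite add0r.
Qed.

Let pic y := sval (cid (pic_exists y)).

Let picP y : continuous y -> pic y 0 = z0 /\
    forall t : R, 0 <= t -> is_derive t (1 : R) (pic y) (F t (y t)).
Proof. exact: (svalP (cid (pic_exists y))). Qed.

(** A curve is controlled only for nonnegative times; freezing it before 0 gives a curve continuous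
    on the whole line, as [F_cont] requires. *)
Let clip (y : R -> 'cV[R]_n) t := y (Num.max t 0).

Let clip_cont y : (forall t : R, 0 <= t -> {for t, continuous y}) ->
  continuous (clip y).
Proof.
move=> cy t.
suff : {for t, continuous (y \o (fun s => Num.max s 0))} by [].
apply: continuous_comp; last by apply: cy; rewrite le_max lexx orbT.
by apply: continuous_max; [exact: cvg_id|exact: cvg_cst].
Qed.

Let iterates := fix iterates k := if k is k'.+1 then clip (pic (iterates k'))
  else (fun=> z0).

Let clip_pic_cont y : continuous y -> continuous (clip (pic y)).
Proof.
move=> cy; apply: clip_cont => t t0.
by have [_ h] := picP cy; exact: is_derive_cont (h t t0).
Qed.

Let iterates_cont k : continuous (iterates k).
Proof. by elim: k => [|k IH] /=; [exact: cst_continuous|exact: clip_pic_cont]. Qed.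

Let clipE y t : 0 <= t -> clip y t = y t.
Proof. by move=> t0; rewrite /clip max_l. Qed.

(** Bielecki's weight: with the exponent 2 L t, the integral of L c w over [0, t] is at most c / 2
    times w(t). *)
Let w t := expR (2 * L * t).

Let L_gt0 : 0 < L. Proof. exact: lt_le_trans L_ge1. Qed.

Let dw t : is_derive t (1 : R) w (2 * L * w t).
Proof.
have h : is_derive t (1 : R) ((2 * L) \*: id) (2 * L).
  by apply: is_derive_eq; rewrite /GRing.scale /= mulr1.
exact: is_derive_expR_comp h.
Qed.

Let dcw c t : is_derive t (1 : R) (fun s => c * w s) (c * (2 * L * w t)).
Proof.
by have h := dw t; apply: (@is_derive_eq _ _ _ (c \*: w)).
Qed.

(* A pointwise bound by [c * w] on the difference of two inputs is halved by
   the Picard operator, whence convergence on the whole half-line at once. *)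
Let pic_contract y1 y2 c : continuous y1 -> continuous y2 -> 0 <= c ->
  (forall t : R, 0 <= t -> `|y1 t - y2 t| <= c * w t) ->
  forall t : R, 0 <= t -> `|pic y1 t - pic y2 t| <= c / 2 * w t.
Proof.
move=> cy1 cy2 c0 h t t0.
have [e1 d1] := picP cy1; have [e2 d2] := picP cy2.
have := @deriv_norm_le_cV R n (pic y1 - pic y2)
  (fun s => F s (y1 s) - F s (y2 s)) (fun s => c / 2 * w s)
  (fun s => c / 2 * (2 * L * w s)) 0 t t0.
have H1 s : s \in `[0, t] -> is_derive s (1 : R) (pic y1 - pic y2)
    (F s (y1 s) - F s (y2 s)).
  rewrite in_itv /= => /andP[s0 _].
  by have := d1 _ s0; have := d2 _ s0 => ? ?; apply: is_derive_eq.
move=> /(_ H1 (fun s _ => dcw _ s)) H.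
have {}H := H _.
apply: le_trans (_ : c / 2 * w t - c / 2 * w 0 <= _); last first.
  by rewrite gerBl mulr_ge0 ?expR_ge0 // divr_ge0.
have := H _.
rewrite -[(pic y1 - pic y2) t]/(pic y1 t - pic y2 t).
rewrite -[(pic y1 - pic y2) 0]/(pic y1 0 - pic y2 0) e1 e2 subrr subr0.
apply=> s; rewrite in_itv /= => /andP[s0 _].
apply: le_trans (F_lip _ _ s0) _.
rewrite (_ : c / 2 * _ = L * (c * w s)); last by field.
by rewrite ler_pM2l // h.
Qed.

Lemma picard_global : exists z : R -> 'cV[R]_n, z 0 = z0 /\
  forall t : R, 0 <= t -> is_derive t (1 : R) z (F t (z t)).
Proof.
have B0 : 0 <= B by exact: le_trans (normr_ge0 _) (F_bnd (lexx 0)).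
have w0 t : 0 < w t by exact: expR_gt0.
have step k t : 0 <= t -> `|iterates k.+1 t - iterates k t| <= B / 2 ^+ k * w t.
  elim: k t => [|k IH] t t0.
    rewrite expr0 divr1 /= clipE //.
    have [e1 d1] := picP (@cst_continuous R 'cV[R]_n z0).
    have := @deriv_norm_le_cV R n (pic (fun=> z0)) (fun s => F s z0)
       (fun s => B * w s) (fun s => B * (2 * L * w s)) 0 t t0.
    rewrite e1 => H; apply: le_trans (_ : B * w t - B * w 0 <= _); last first.
      by rewrite gerBl mulr_ge0 // ltW.
    apply: H => [s|s _|s]; rewrite ?in_itv /=.
    - by move=> /andP[s0 _]; exact: d1.
    - exact: dcw.
    - move=> /andP[s0 _]; apply: le_trans (F_bnd s0) _.
      rewrite ler_peMr // -[leLHS](mulr1 1); apply: ler_pM => //.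
        by have := L_ge1; lra.
      by rewrite -expR0 ler_expR mulr_ge0 // mulr_ge0 // ltW.
  rewrite [X in `|X - _|](_ : _ = clip (pic (iterates k.+1)) t) //.
  rewrite [X in `|_ - X|](_ : _ = clip (pic (iterates k)) t) // !clipE //.
  rewrite (_ : B / 2 ^+ k.+1 = B / 2 ^+ k / 2); last first.
    by rewrite exprS; field; rewrite expf_neq0.
  apply: pic_contract => //; try exact: iterates_cont.
  by rewrite divr_ge0 // exprn_ge0.
have /choice [y hy] : forall t, exists l, forall k, 0 <= t ->
    `|l - iterates k t| <= 2 * B / 2 ^+ k * w t.
  move=> t; have [t0|_] := leP 0 t; last by exists 0.
  have [|l hl] := @geometric_tail_lim R _ (iterates^~ t) (B * w t).
    by move=> k; rewrite mulrAC; exact: step.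
  exists l => k _; apply: le_trans (hl k) _.
  by rewrite mulrA mulrAC.
(* After clipping, the iterates converge uniformly for times up to t + 1, so the limit is continuous
   at t. *)
have cy : continuous (clip y).
  move=> t; apply/cvgrPdist_le => e e0.
  pose W := w (Num.max t 0 + 1).
  have [k hk] : exists k, 2 * B * W / 2 ^+ k <= e / 3.
    have /cvgrPdist_le /(_ (e / 3)) := @cvg_half_expn R (2 * B * W).
    rewrite divr_gt0 // => /(_ isT) [N _ /(_ N (leqnn N))] /=.
    rewrite sub0r normrN => h; exists N; exact: le_trans (ler_norm _) h.
  have close s : s <= t + 1 -> `|clip y s - clip (iterates k) s| <= e / 3.
    move=> st; apply: le_trans hk.
    apply: le_trans (hy _ _ _) _; first by rewrite le_max lexx orbT.
    rewrite mulrAC ler_pM2r ?invr_gt0 ?exprn_gt0 // ler_wpM2l ?mulr_ge0 //.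
    rewrite ler_expR ler_pM2l ?mulr_gt0 // ge_max.
    apply/andP; split; first by rewrite (le_trans st) // lerD2r le_max lexx.
    by rewrite addr_ge0 // le_max lexx orbT.
  have ck : continuous (clip (iterates k)).
    by apply: clip_cont => s _; exact: iterates_cont.
  have /cvgrPdist_le /(_ (e / 3)) := ck t; rewrite divr_gt0 // => /(_ isT) h.
  near=> s.
  rewrite (_ : clip y t - clip y s = (clip y t - clip (iterates k) t) +
     (clip (iterates k) t - clip (iterates k) s) +
     (clip (iterates k) s - clip y s)); last first.
    by rewrite subrKA subrKA.
  rewrite (_ : e = e / 3 + e / 3 + e / 3); last by field.
  apply: le_trans (ler_normD _ _) _; apply: lerD.
    apply: le_trans (ler_normD _ _) _; apply: lerD.
      by apply: close; rewrite lerDl.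
    by near: s.
  rewrite distrC; apply: close; near: s.
  by exists 1 => //= s; rewrite /ball_ /= ltr_distlC => /andP[_ /ltW].
exists (pic (clip y)); have [e1 d1] := picP cy; split => // t t0.
suff <- : clip y t = pic (clip y) t by exact: d1.
rewrite clipE //; apply/eqP; rewrite -subr_eq0 -normr_le0.
(* The limit and its image under the Picard operator are both O(2^-k)-close to the iterate of rank k
   + 1, for every k; hence they agree. *)
have hk k : `|y t - pic (clip y) t| <= (3 * B * w t) / 2 ^+ k.
  rewrite -(subrKA (iterates k.+1 t)); apply: le_trans (ler_normD _ _) _.
  apply: le_trans (_ : 2 * B / 2 ^+ k.+1 * w t + 2 * B / 2 ^+ k / 2 * w t <= _).
    apply: lerD; first exact: hy.
    rewrite /= clipE //; apply: pic_contract; [exact: iterates_cont|exact: cy| | |exact: t0].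
      by rewrite divr_ge0 ?exprn_ge0 // mulr_ge0.
    by move=> s s0; rewrite clipE // distrC; exact: hy.
  have q0 : 0 <= B * w t / 2 ^+ k.
    by rewrite mulr_ge0 ?invr_ge0 ?exprn_ge0 ?mulr_ge0 // ltW.
  have p0 : (2 ^+ k : R) != 0 by rewrite expf_neq0.
  rewrite (_ : _ + _ = 2 * (B * w t / 2 ^+ k)); last by rewrite exprS; field.
  by rewrite -!mulrA ler_wpM2r // ?mulrA // ler_nat.
by apply: (cvgr_to_ge (@cvg_half_expn R (3 * B * w t))); exact: nearW.
Unshelve. all: by end_near. Qed.

End Picard.

(** * Directional derivatives of maps between normed spaces *)

Section DirectionalDerivatives.
Context {R : realType}.

Lemma is_derive_cvgP (V W : normedModType R) (f : V -> W) (a v : V) (l : W) :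
  is_derive a v f l <-> h^-1 *: (f (h *: v + a) - f a) @[h --> 0^'] --> l.
Proof.
split=> [[dv <-]|h]; first exact: dv.
by split; [apply/cvg_ex; exists l|apply: cvg_lim].
Qed.

Lemma is_derive_cVP' (V : normedModType R) n (z : V -> 'cV[R]_n) (a v : V) (dz : 'cV[R]_n) :
  (forall i, is_derive a v (fun s => z s i ord0) (dz i ord0)) ->
  is_derive a v z dz.
Proof.
move=> h; have dvb : derivable z a v.
  by apply/derivable_mxP => i j; rewrite ord1; case: (h i).
split => //; rewrite derive_mx //; apply/matrixP => i j; rewrite mxE ord1.
by case: (h i).
Qed.

Lemma cvg_cV (T : Type) (F : set_system T) {FF : Filter F} n
    (g : T -> 'cV[R]_n) (l : 'cV[R]_n) :
  (forall i, (fun y => g y i ord0) @ F --> l i ord0) -> g @ F --> l.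
Proof.
move=> h; apply/cvgrPdist_le => e e0; near=> y.
apply: cV_norm_le => [|i]; first exact: ltW.
rewrite !mxE; move: i; near: y; apply: filter_forall => i.
by move/cvgrPdist_le : (h i); exact.
Unshelve. all: by end_near. Qed.

Lemma continuous_at_cV (T : topologicalType) n (g : T -> 'cV[R]_n) x :
  (forall i, {for x, continuous (fun y => g y i ord0)}) -> {for x, continuous g}.
Proof. by move=> h; apply: (@cvg_cV _ (nbhs x)) => i; exact: h. Qed.

Lemma cvg_sum_ord (T : Type) (F : set_system T) {FF : Filter F} n
    (f : 'I_n -> T -> R) (l : 'I_n -> R) :
  (forall i, f i @ F --> l i) -> (fun x => \sum_i f i x) @ F --> \sum_i l i.
Proof. by move=> h; apply: cvg_big => // x; exact: add_continuous. Qed.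

Lemma is_derive_line (V W : normedModType R) (f : V -> W) (a v : V) (t : R) l :
  is_derive (a + t *: v) v f l ->
  is_derive t (1 : R) (fun s => f (a + s *: v)) l.
Proof.
move=> /is_derive_cvgP h; apply/is_derive_cvgP.
rewrite (_ : (fun h0 => _) = (fun h0 => h0^-1 *: (f (h0 *: v + (a + t *: v)) -
   f (a + t *: v)))) //.
apply/funext => s; congr (_ *: (f _ - _)).
have -> : s *: (1 : R) + t = s + t by rewrite /GRing.scale /= mulr1.
by rewrite scalerDl addrCA.
Qed.

End DirectionalDerivatives.

(** * Functions of class C^k on a set *)

Section Ck.
Context {R : realType}.

(** Recursive counterpart of [smooth_on], with a finite order: closure under products, inverses and
    composition is proved by induction on [k], each derivative being expressed through functions of
    lower order. *)
Fixpoint Ck n (k : nat) (W : set 'cV[R]_n) (f : 'cV[R]_n -> R) : Prop :=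
  (forall x, W x -> {for x, continuous f}) /\
  if k is k'.+1 then
    forall i, (forall x, W x -> derivable f x (delta_mx i ord0)) /\
              Ck k' W (partial i f)
  else True.

Definition Cinf n (W : set 'cV[R]_n) (f : 'cV[R]_n -> R) := forall k, Ck k W f.

Lemma Ck_cont n k (W : set 'cV[R]_n) f x : Ck k W f -> W x ->
  {for x, continuous f}.
Proof. by case: k => [|k] [h _]; exact: h. Qed.

Lemma Ck_derive n k (W : set 'cV[R]_n) f i x : Ck k.+1 W f -> W x ->
  is_derive x (delta_mx i ord0) f (partial i f x).
Proof. by move=> [_ h] Wx; have [h1 _] := h i; split => //; exact: h1. Qed.

Lemma Ck_partial n k (W : set 'cV[R]_n) f i : Ck k.+1 W f -> Ck k W (partial i f).
Proof. by move=> [_ h]; case: (h i). Qed.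

Lemma CkS n k (W : set 'cV[R]_n) f : Ck k.+1 W f -> Ck k W f.
Proof.
elim: k f => [|k IH] f [h1 h2]; first by split.
by split => // i; have [h3 h4] := h2 i; split => //; exact: IH.
Qed.

Lemma Ck1 n k (W : set 'cV[R]_n) f : Ck k.+1 W f -> Ck 1 W f.
Proof. by elim: k => [//|k IH] h; apply: IH; exact: CkS. Qed.

Lemma CkSP n k (W : set 'cV[R]_n) f (df : 'I_n -> 'cV[R]_n -> R) :
  (forall x, W x -> {for x, continuous f}) ->
  (forall i x, W x -> is_derive x (delta_mx i ord0) f (df i x)) ->
  (forall i, Ck k W (partial i f)) -> Ck k.+1 W f.
Proof. by move=> h1 h2 h3; split => // i; split => // x /(h2 i) []. Qed.

Lemma Cinf_partial n (W : set 'cV[R]_n) f i : Cinf W f -> Cinf W (partial i f).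
Proof. by move=> h k; apply: Ck_partial. Qed.

Lemma sub_Ck n k (W W' : set 'cV[R]_n) f : W' `<=` W -> Ck k W f -> Ck k W' f.
Proof.
move=> sW; elim: k f => [|k IH] f [h1 h2]; first by split => // x /sW; exact: h1.
split => [x /sW|i]; first exact: h1.
by have [h3 h4] := h2 i; split => [x /sW|]; [exact: h3|exact: IH].
Qed.

Lemma open_near_eq n (W : set 'cV[R]_n) (f g : 'cV[R]_n -> R) x :
  open W -> (forall x, W x -> f x = g x) -> W x -> {near x, f =1 g}.
Proof. by move=> oW fg Wx; apply: filterS (open_nbhs_nbhs (conj oW Wx)). Qed.

Lemma partial_eq n (W : set 'cV[R]_n) (f g : 'cV[R]_n -> R) i x :
  open W -> (forall x, W x -> f x = g x) -> W x -> partial i f x = partial i g x.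
Proof. by move=> oW fg Wx; apply: near_eq_derive; exact: open_near_eq Wx. Qed.

Lemma eq_continuous_at n (W : set 'cV[R]_n) (f g : 'cV[R]_n -> R) x : open W ->
  (forall x, W x -> f x = g x) -> W x -> {for x, continuous f} ->
  {for x, continuous g}.
Proof.
move=> oW fg Wx cf; have fgx := open_near_eq oW fg Wx.
rewrite /prop_for /continuous_at -(fg x Wx); apply: cvg_trans cf.
exact: (near_eq_cvg fgx).
Qed.

Lemma eq_Ck n k (W : set 'cV[R]_n) f g : open W ->
  (forall x, W x -> f x = g x) -> Ck k W f -> Ck k W g.
Proof.
move=> oW; elim: k f g => [|k IH] f g fg [h1 h2].
  by split => // x Wx; exact: (eq_continuous_at oW fg Wx (h1 _ Wx)).
split => [x Wx|i]; first exact: (eq_continuous_at oW fg Wx (h1 _ Wx)).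
have [h3 h4] := h2 i; split.
  move=> x Wx; apply: near_eq_derivable (h3 _ Wx).
  exact: open_near_eq Wx.
by apply: IH h4 => x Wx; exact: partial_eq Wx.
Qed.

Lemma ball_cV_sub n (W : set 'cV[R]_n) x : open W -> W x ->
  exists2 d : R, 0 < d & forall h, `|h| <= d -> W (x + h).
Proof.
move=> oW Wx; have /nbhs_ballP[d /= d0 hd] := open_nbhs_nbhs (conj oW Wx).
exists (d / 2); first exact: divr_gt0.
move=> h hh; apply: hd; rewrite -ball_normE /= opprD addNKr normrN.
by apply: le_lt_trans hh _; rewrite ltr_pdivrMr // ltr_pMr // ltr1n.
Qed.

(* Moving the coordinates of [h] one after the other reduces the Frechet
   estimate to the mean value theorem along coordinate lines. *)
Lemma C1_frechet n (W : set 'cV[R]_n) f x : open W -> Ck 1 W f -> W x ->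
  forall e : R, 0 < e -> exists2 d : R, 0 < d &
    forall h : 'cV[R]_n, `|h| <= d ->
      `|f (x + h) - f x - \sum_i h i ord0 * partial i f x| <= e * `|h|.
Proof.
move=> oW f1 Wx e e0.
have [d1 d10 hd1] := ball_cV_sub oW Wx.
pose e' := e / (n%:R + 1).
have e'0 : 0 < e' by rewrite divr_gt0 // ltr_wpDl.
have : \forall y \near x, forall i, `|partial i f x - partial i f y| <= e'.
  near=> y => i; move: i; near: y; apply: filter_forall => i.
  have /cvgrPdist_le := Ck_cont (Ck_partial i f1) Wx.
  by move=> /(_ _ e'0).
move=> /nbhs_ballP[d2 /= d20 hd2].
exists (Num.min d1 (d2 / 2)); first by rewrite lt_min d10 divr_gt0.
move=> h; rewrite le_min => /andP[hh1 hh2].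
have {hh2} : `|h| < d2.
  by apply: le_lt_trans hh2 _; rewrite ltr_pdivrMr // ltr_pMr // ltr1n.
move=> hh2.
pose tr k : 'cV[R]_n := \col_i (if (i < k)%N then h i ord0 else 0).
have trn : tr n = h by apply/matrixP => i j; rewrite ord1 mxE ltn_ord.
have tr0 : tr 0%N = 0 by apply/matrixP => i j; rewrite !mxE.
have tele : f (x + h) - f x = \sum_(i < n) (f (x + tr i.+1) - f (x + tr i)).
  rewrite -(big_mkord xpredT (fun i => f (x + tr i.+1) - f (x + tr i))).
  by rewrite telescope_sumr // trn tr0 addr0.
rewrite tele -sumrB.
have -> : e * `|h| = (n%:R + 1) * (e' * `|h|).
  by rewrite /e'; field; apply: lt0r_neq0; rewrite ltr_wpDl.
apply: le_trans (_ : n%:R * (e' * `|h|) <= _); last first.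
  by rewrite ler_wpM2r ?mulr_ge0 ?lerDl // ltW.
apply: ler_norm_sum_const => i.
pose p s := x + (tr i + s *: delta_mx i ord0).
have trS : tr i.+1 = tr i + h i ord0 *: delta_mx i ord0.
  apply/matrixP => j k; rewrite ord1 !mxE eqxx andbT ltnS leq_eqVlt.
  have [->|ji] := eqVneq j i; first by rewrite eqxx ltnn mulr1 add0r.
  by rewrite -(inj_eq val_inj) /= in ji; rewrite (negbTE ji) /= mulr0 addr0.
have psmall s : `|s| <= `|h i ord0| -> `|tr i + s *: delta_mx i ord0| <= `|h|.
  move=> hs; apply: cV_norm_le => // j; rewrite !mxE eqxx andbT.
  have [->|ji] := eqVneq j i.
    by rewrite ltnn add0r mulr1 (le_trans hs) // mx_coord_le.
  rewrite mulr0 addr0; case: ifP => _; first exact: mx_coord_le.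
  by rewrite normr0.
have Wp s : `|s| <= `|h i ord0| -> W (p s).
  by move=> hs; apply: hd1; exact: le_trans (psmall _ hs) hh1.
have dp s : `|s| <= `|h i ord0| ->
    is_derive s (1 : R) (fun s => f (p s)) (partial i f (p s)).
  move=> hs; have := Ck_derive i f1 (Wp s hs).
  rewrite /p addrA => /is_derive_line.
  suff -> : (fun s0 : R => f (x + tr i + s0 *: delta_mx i ord0)) =
    (fun s0 => f (x + (tr i + s0 *: delta_mx i ord0))) by [].
  by apply/funext => s0; rewrite addrA.
have bp s : `|s| <= `|h i ord0| ->
    `|partial i f (p s) - partial i f x| <= e'.
  move=> hs; rewrite distrC; apply: hd2.
  rewrite -ball_normE /= opprD addNKr normrN.
  exact: le_lt_trans (psmall _ hs) hh2.
have -> : f (x + tr i.+1) = f (p (h i ord0)) by rewrite /p trS.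
have -> : f (x + tr i) = f (p 0) by rewrite /p scale0r addr0.
pose g s := f (p s) - s * partial i f x.
have dg s : `|s| <= `|h i ord0| ->
    is_derive s (1 : R) g (partial i f (p s) - partial i f x).
  move=> hs; have h1 := dp s hs.
  have h2 : is_derive s (1 : R) (fun s : R => s * partial i f x) (partial i f x).
    have -> : (fun s : R => s * partial i f x) = partial i f x \*: id.
      by apply/funext => u; rewrite mulrC.
    by apply: is_derive_eq; rewrite /GRing.scale /= mulr1.
  exact: is_deriveB.
have dlin c (s : R) : is_derive s (1 : R) (fun s => c * s) c.
  have -> : (fun s : R => c * s) = c \*: id by [].
  by apply: is_derive_eq; rewrite /GRing.scale /= mulr1.
rewrite (_ : _ - _ - _ = g (h i ord0) - g 0); last by rewrite /g; ring.
have hi : `|h i ord0| <= `|h| by exact: mx_coord_le.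
apply: le_trans (_ : e' * `|h i ord0| <= _); last by rewrite ler_pM2l.
have [hi0|hi0] := leP 0 (h i ord0).
  have := @deriv_norm_le R g (fun s => partial i f (p s) - partial i f x)
    (fun s => e' * s) (fun=> e') 0 (h i ord0) hi0.
  rewrite mulr0 subr0 (ger0_norm hi0); apply => s; rewrite ?in_itv /=.
  - by case/andP => s0 sh; apply: dg; rewrite !ger0_norm.
  - by case/andP => s0 sh; apply: bp; rewrite !ger0_norm.
have := @deriv_norm_le R g (fun s => partial i f (p s) - partial i f x)
    (fun s => e' * s) (fun=> e') (h i ord0) 0 (ltW hi0).
rewrite mulr0 sub0r (ltr0_norm hi0) -mulrN distrC; apply => s; rewrite ?in_itv /=.
- by case/andP => sh s0; apply: dg; rewrite !ler0_norm ?lerN2 // ltW.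
- by case/andP => sh s0; apply: bp; rewrite !ler0_norm ?lerN2 // ltW.
Unshelve. all: by end_near. Qed.

(** Only a directional derivative of [z] is assumed. Its difference quotient q(h) converges, hence
    is bounded near 0, and the Frechet estimate at [z a] is applied to the increment h q(h). *)
Lemma is_derive_C1_comp (V : normedModType R) n (W : set 'cV[R]_n) f
    (z : V -> 'cV[R]_n) (a v : V) (dz : 'cV[R]_n) :
  open W -> Ck 1 W f -> W (z a) -> is_derive a v z dz ->
  is_derive a v (fun s => f (z s)) (\sum_i dz i ord0 * partial i f (z a)).
Proof.
move=> oW f1 Wz /is_derive_cvgP hz; apply/is_derive_cvgP.
set q := (fun h : R => h^-1 *: _) in hz.
have cq i : (fun h => q h i ord0) @ 0^' --> dz i ord0.
  exact: (cvg_comp _ _ hz (@coord_continuous R _ _ i ord0 dz)).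
have cG : (fun h => \sum_i q h i ord0 * partial i f (z a)) @ 0^' -->
    \sum_i dz i ord0 * partial i f (z a).
  by apply: cvg_sum_ord => i; apply: cvgM; [exact: cq|exact: cvg_cst].
apply/cvgrPdist_le => e e0.
have e20 : 0 < e / 2 by rewrite divr_gt0.
pose M := `|dz| + 1.
have M0 : 0 < M by rewrite ltr_wpDl.
have [d d0 hd] := C1_frechet oW f1 Wz (divr_gt0 e20 M0).
have qM : \forall h \near 0^', `|q h| <= M.
  move/cvgrPdist_le : hz => /(_ 1 ltr01); apply: filterS => h hh.
  rewrite -(subrK dz (q h)) /M addrC; apply: le_trans (ler_normD _ _) _.
  by rewrite lerD2l distrC.
near=> h.
have h0 : h != 0 by near: h; exact: nbhs_dnbhs_neq.
have qh : z (h *: v + a) = z a + h *: q h.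
  by rewrite /q scalerA mulfV // scale1r subrKC.
have hq : `|h *: q h| <= d.
  rewrite normrZ; apply: le_trans (_ : `|h| * M <= _).
    by apply: ler_wpM2l => //; near: h.
  rewrite -ler_pdivlMr //; near: h; apply: dnbhs0_le.
  exact: divr_gt0.
have := hd _ hq; rewrite -qh.
rewrite (_ : \sum_i _ = h * \sum_i q h i ord0 * partial i f (z a)); last first.
  by rewrite mulr_sumr; apply: eq_bigr => i _; rewrite mxE mulrA.
set S := \sum_i q h i ord0 * _.
rewrite normrZ mulrCA.
rewrite (_ : f (z (h *: v + a)) - f (z a) - h * S =
  h * (h^-1 *: (f (z (h *: v + a)) - f (z a)) - S)); last first.
  by rewrite mulrBr /GRing.scale /= mulrA mulfV // mul1r.
rewrite normrM ler_pM2l ?normr_gt0 // => hle.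
rewrite -(subrKA S); apply: le_trans (ler_normD _ _) _.
rewrite (splitr e); apply: lerD.
  by rewrite /S; near: h; move/cvgrPdist_le : cG => /(_ _ e20).
rewrite distrC; apply: le_trans hle _.
rewrite -[leRHS]mulr1 -[leLHS]mulrA ler_pM2l // mulrC ler_pdivrMr // mul1r.
by near: h.
Unshelve. all: by end_near. Qed.

Lemma is_derive_C1 n (W : set 'cV[R]_n) f (x v : 'cV[R]_n) :
  open W -> Ck 1 W f -> W x ->
  is_derive x v f (\sum_i v i ord0 * partial i f x).
Proof.
move=> oW f1 Wx.
by have := is_derive_C1_comp oW f1 (z := id) Wx (is_derive_id x v).
Qed.

Lemma Ck_cst n k (W : set 'cV[R]_n) (c : R) : Ck k W (fun=> c).
Proof.
elim: k c => [|k IH] c; first by split => // x _; exact: cst_continuous.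
apply: (@CkSP _ _ _ _ (fun _ _ => 0) _ (fun i x _ => is_derive_cst c _ _))
  => [x _|i].
- exact: cst_continuous.
- have -> : partial i (fun=> c) = (fun=> 0) :> ('cV[R]_n -> R).
    by apply/funext => x; rewrite /partial derive_cst.
  exact: IH.
Qed.

Lemma Ck_add n k (W : set 'cV[R]_n) f g : open W -> Ck k W f -> Ck k W g ->
  Ck k W (fun x => f x + g x).
Proof.
move=> oW; elim: k f g => [|k IH] f g hf hg.
  split=> // x Wx; apply: continuousD; [exact: Ck_cont hf Wx|exact: Ck_cont hg Wx].
have dd i x : W x -> is_derive x (delta_mx i ord0) (fun x => f x + g x)
    (partial i f x + partial i g x).
  move=> Wx; have h1 := Ck_derive i hf Wx; have h2 := Ck_derive i hg Wx.
  exact: is_deriveD.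
apply: (CkSP _ dd) => [x Wx|i].
  by apply: continuousD; [exact: Ck_cont hf Wx|exact: Ck_cont hg Wx].
apply: (eq_Ck oW _ (IH _ _ (Ck_partial i hf) (Ck_partial i hg))) => x Wx.
by have [_ <-] := dd i x Wx.
Qed.

Lemma Ck_mul n k (W : set 'cV[R]_n) f g : open W -> Ck k W f -> Ck k W g ->
  Ck k W (fun x => f x * g x).
Proof.
move=> oW; elim: k f g => [|k IH] f g hf hg.
  split=> // x Wx; apply: continuousM; [exact: Ck_cont hf Wx|exact: Ck_cont hg Wx].
have dd i x : W x -> is_derive x (delta_mx i ord0) (fun x => f x * g x)
    (f x * partial i g x + g x * partial i f x).
  move=> Wx; have h1 := Ck_derive i hf Wx; have h2 := Ck_derive i hg Wx.
  exact: is_deriveM.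
apply: (CkSP _ dd) => [x Wx|i].
  by apply: continuousM; [exact: Ck_cont hf Wx|exact: Ck_cont hg Wx].
have h1 := IH _ _ (CkS hf) (Ck_partial i hg).
have h2 := IH _ _ (CkS hg) (Ck_partial i hf).
apply: (eq_Ck oW _ (Ck_add oW h1 h2)) => x Wx.
by have [_ <-] := dd i x Wx.
Qed.

Lemma Ck_opp n k (W : set 'cV[R]_n) f : open W -> Ck k W f ->
  Ck k W (fun x => - f x).
Proof.
move=> oW hf; apply: (eq_Ck oW _ (Ck_mul oW (Ck_cst k W (-1)) hf)) => x _.
by rewrite mulN1r.
Qed.

Lemma Ck_sub n k (W : set 'cV[R]_n) f g : open W -> Ck k W f -> Ck k W g ->
  Ck k W (fun x => f x - g x).
Proof. by move=> oW hf hg; apply: Ck_add => //; exact: Ck_opp. Qed.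

Lemma Ck_sum n k (W : set 'cV[R]_n) (I : Type) (s : seq I)
    (f : I -> 'cV[R]_n -> R) : open W ->
  (forall i, Ck k W (f i)) -> Ck k W (fun x => \sum_(i <- s) f i x).
Proof.
move=> oW hf; elim: s => [|a s IH].
  by apply: (eq_Ck oW _ (Ck_cst k W 0)) => x _; rewrite big_nil.
apply: (eq_Ck oW _ (Ck_add oW (hf a) IH)) => x _.
by rewrite big_cons.
Qed.

Lemma Ck_prod n k (W : set 'cV[R]_n) (I : Type) (s : seq I)
    (f : I -> 'cV[R]_n -> R) : open W ->
  (forall i, Ck k W (f i)) -> Ck k W (fun x => \prod_(i <- s) f i x).
Proof.
move=> oW hf; elim: s => [|a s IH].
  by apply: (eq_Ck oW _ (Ck_cst k W 1)) => x _; rewrite big_nil.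
apply: (eq_Ck oW _ (Ck_mul oW (hf a) IH)) => x _.
by rewrite big_cons.
Qed.

Lemma Ck_inv n k (W : set 'cV[R]_n) f : open W -> Ck k W f ->
  (forall x, W x -> f x != 0) -> Ck k W (fun x => (f x)^-1).
Proof.
move=> oW hf f0; elim: k hf => [|k IH] hf.
  by split=> // x Wx; apply: continuousV; [exact: f0|exact: Ck_cont hf Wx].
have dd i x : W x -> is_derive x (delta_mx i ord0) (fun x => (f x)^-1)
    (- ((f x)^-1 * (f x)^-1 * partial i f x)).
  move=> Wx; have [d1 <-] := Ck_derive i hf Wx.
  split; first by apply: derivableV => //; exact: f0.
  rewrite deriveV ?f0 // -mulNr -expr2 exprVn //.
apply: (CkSP _ dd) => [x Wx|i].
  by apply: continuousV; [exact: f0|exact: Ck_cont hf Wx].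
have h1 := IH (CkS hf).
apply: (eq_Ck oW _ (Ck_opp oW (Ck_mul oW (Ck_mul oW h1 h1) (Ck_partial i hf)))).
by move=> x Wx; have [_ <-] := dd i x Wx.
Qed.

Lemma Ck_coord n k (W : set 'cV[R]_n) j : Ck k W (fun x : 'cV[R]_n => x j ord0).
Proof.
have dd i (x : 'cV[R]_n) : is_derive x (delta_mx i ord0 : 'cV[R]_n)
    (fun x : 'cV[R]_n => x j ord0) ((delta_mx i ord0 : 'cV[R]_n) j ord0).
  apply/is_derive_cvgP; apply: cvg_near_cst; near=> h.
  have h0 : h != 0 by near: h; exact: nbhs_dnbhs_neq.
  by rewrite mxE [(_ *: delta_mx _ _) _ _]mxE addrK /GRing.scale /= mulKf.
have cc (x : 'cV[R]_n) : {for x, continuous (fun x : 'cV[R]_n => x j ord0)}.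
  exact: coord_continuous.
case: k => [|k]; first by split.
apply: (CkSP _ (fun i x _ => dd i x)) => [x _|i]; first exact: cc.
have -> : partial i (fun x : 'cV[R]_n => x j ord0) =
    fun=> (delta_mx i ord0 : 'cV[R]_n) j ord0.
  by apply/funext => x; have [_ <-] := dd i x.
exact: Ck_cst.
Unshelve. all: by end_near. Qed.

Lemma Ck_comp m n k (U : set 'cV[R]_m) (W : set 'cV[R]_n) f
    (g : 'cV[R]_m -> 'cV[R]_n) : open U -> open W ->
  (forall x, U x -> W (g x)) -> Ck k W f ->
  (forall j, Ck k U (fun x => g x j ord0)) -> Ck k U (fun x => f (g x)).
Proof.
move=> oU oW gW; elim: k f => [|k IH] f hf hg.
  split=> // x Ux; apply: (@continuous_comp _ _ _ g f).
    by apply: continuous_at_cV => i; exact: Ck_cont (hg i) Ux.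
  by apply: Ck_cont hf _; exact: gW.
have cg x : U x -> {for x, continuous g}.
  by move=> Ux; apply: continuous_at_cV => i; exact: Ck_cont (hg i) Ux.
have dd i x : U x -> is_derive x (delta_mx i ord0) (fun x => f (g x))
    (\sum_j partial i (fun x => g x j ord0) x * partial j f (g x)).
  move=> Ux; pose dg : 'cV[R]_n := \col_j partial i (fun x => g x j ord0) x.
  have hdg : is_derive x (delta_mx i ord0) g dg.
    by apply: is_derive_cVP' => j; rewrite mxE; exact: Ck_derive (hg j) Ux.
  have := is_derive_C1_comp oW (Ck1 hf) (gW _ Ux) hdg.
  by under eq_bigr do rewrite mxE.
apply: (CkSP _ dd) => [x Ux|i].
  apply: (@continuous_comp _ _ _ g f); first exact: cg.
  by apply: Ck_cont hf _; exact: gW.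
have h1 : forall j, Ck k U (fun x => partial i (fun x => g x j ord0) x *
    partial j f (g x)).
  move=> j; apply: Ck_mul => //; first exact: Ck_partial.
  by apply: IH; [exact: Ck_partial|move=> l; exact: CkS].
apply: (eq_Ck oU _ (Ck_sum (index_enum _) oU h1)) => x Ux.
by have [_ e] := dd i x Ux; exact: (esym e).
Qed.

Lemma Ck_mulmx m n k (W : set 'cV[R]_n) (M : 'M[R]_(m, n))
    (g : 'cV[R]_n -> 'cV[R]_n) i : open W ->
  (forall j, Ck k W (fun x => g x j ord0)) ->
  Ck k W (fun x => (M *m g x) i ord0).
Proof.
move=> oW hg.
have h j : Ck k W (fun x => M i j * g x j ord0).
  by apply: Ck_mul => //; exact: Ck_cst.
by apply: (eq_Ck oW _ (Ck_sum (index_enum _) oW h)) => x _; rewrite mxE.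
Qed.

Lemma Cinf_iter_partial n (W : set 'cV[R]_n) f s : Cinf W f ->
  Cinf W (iter_partial s f).
Proof. by move=> h; elim: s => [|i s IH] //=; exact: Cinf_partial. Qed.

Lemma smooth_onP n (W : set 'cV[R]_n) f : smooth_on W f <-> Cinf W f.
Proof.
split=> [h k|h s x Wx].
  have {}h s : Ck k W (iter_partial s f).
    elim: k s => [|k IH] s; first by split => // x /(h s) [].
    split => [x /(h s) [] //|i]; split; last exact: (IH (i :: s)).
    by move=> x /(h s) [].
  exact: (h [::]).
have hs := Cinf_iter_partial s h; split; first exact: Ck_cont (hs 0%N) Wx.
by move=> i; have [] := Ck_derive i (hs 1%N) Wx.
Qed.

(** Differentiation commutes with taking a coordinate. The claim is proved for all words [s] at
    once, since each further derivative lengthens the word. *)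
Lemma smooth_on_coord n m (W : set 'cV[R]_n) (f : 'cV[R]_n -> 'cV[R]_m) j :
  open W -> smooth_on W f -> Cinf W (fun x => f x j ord0).
Proof.
move=> oW h k.
suff {k} H : forall k s, Ck k W (fun x => iter_partial s f x j ord0).
  exact: (H k [::]).
have cc s x : W x -> {for x, continuous (fun x => iter_partial s f x j ord0)}.
  move=> Wx; apply: (@continuous_comp _ _ _ (iter_partial s f)
    (fun M : 'cV[R]_m => M j ord0)); last exact: coord_continuous.
  by have [] := h s x Wx.
have dd s i x : W x -> is_derive x (delta_mx i ord0)
    (fun x => iter_partial s f x j ord0) (iter_partial (i :: s) f x j ord0).
  move=> Wx; have [_ /(_ i) d1] := h s x Wx.
  split; first exact: ((derivable_mxP _ _ _).1 d1 j ord0).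
  by rewrite /= /partial derive_mx // mxE.
elim=> [|k IH] s; first by split => // x; exact: cc.
apply: (CkSP (cc s) (dd s)) => i.
by apply: (eq_Ck oW _ (IH (i :: s))) => x Wx; have [_ <-] := dd s i x Wx.
Qed.

End Ck.

(** * Bounds on compact sets and the basic energy estimate *)

Section Estimates.
Context {R : realType}.

Definition convex_set n (K : set 'cV[R]_n) := forall (x y : 'cV[R]_n) (t : R),
  K x -> K y -> 0 <= t -> t <= 1 -> K (x + t *: (y - x)).

Definition jac n m (X : 'cV[R]_n -> 'cV[R]_m) (z : 'cV[R]_n) : 'M[R]_(m, n) :=
  \matrix_(i, j) partial j (fun x => X x i ord0) z.

Definition Ckv n m k (W : set 'cV[R]_n) (X : 'cV[R]_n -> 'cV[R]_m) :=
  forall i, Ck k W (fun x => X x i ord0).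

Lemma is_derive_C1v_comp (V : normedModType R) n m (W : set 'cV[R]_n)
    (X : 'cV[R]_n -> 'cV[R]_m) (z : V -> 'cV[R]_n) (a v : V) (dz : 'cV[R]_n) :
  open W -> Ckv 1 W X -> W (z a) -> is_derive a v z dz ->
  is_derive a v (fun s => X (z s)) (jac X (z a) *m dz).
Proof.
move=> oW X1 Wz hz; apply: is_derive_cVP' => i.
have := is_derive_C1_comp oW (X1 i) Wz hz.
rewrite mxE; under [X in _ -> is_derive _ _ _ X]eq_bigr do rewrite mxE mulrC.
by [].
Qed.

Lemma is_derive_segment (V : normedModType R) (x d : V) (s : R) :
  is_derive s (1 : R) (fun s => x + s *: d) d.
Proof.
have h : is_derive s (1 : R) (cst x + (fun s : R => s *: d)) (0 + d).
  apply: is_deriveD; apply/is_derive_cvgP; apply: cvg_near_cst; near=> h.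
  have h0 : h != 0 by near: h; exact: nbhs_dnbhs_neq.
  have -> : h *: (1 : R) + s = h + s by rewrite /GRing.scale /= mulr1.
  by rewrite scalerDl addrK scalerA mulVf // scale1r.
by rewrite add0r in h.
Unshelve. all: by end_near. Qed.

Lemma C1_comp_segment n m (W : set 'cV[R]_n) (X : 'cV[R]_n -> 'cV[R]_m)
    (x d : 'cV[R]_n) (s : R) :
  open W -> Ckv 1 W X -> W (x + s *: d) ->
  is_derive s (1 : R) (fun s => X (x + s *: d)) (jac X (x + s *: d) *m d).
Proof.
move=> oW X1 Wx.
exact: (is_derive_C1v_comp (z := fun s : R => x + s *: d) (a := s) oW X1 Wx
  (is_derive_segment x d s)).
Qed.

Lemma continuous_compact_bound n k (W K : set 'cV[R]_n) f :
  Ck k W f -> compact K -> K `<=` W ->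
  exists2 B : R, 0 < B & forall x, K x -> `|f x| <= B.
Proof.
move=> hf cK KW.
have cf : {within K, continuous f}.
  by apply: continuous_in_subspaceT => x /set_mem /KW; exact: Ck_cont hf.
have /compact_bounded[M [_ mrt]] := continuous_compact cf cK.
exists (Num.max 0 M + 1); first by rewrite ltr_wpDl // le_max lexx.
move=> x Kx; apply: mrt; last by exists x.
by rewrite ltr_pwDr // le_max lexx orbT.
Qed.

(** The sum of the individual bounds, plus 1 for the sake of an empty family, dominates each of
    them. *)
Lemma finite_bound n (P : 'I_n -> R -> Prop) :
  (forall i a b, a <= b -> P i a -> P i b) ->
  (forall i, exists2 B : R, 0 < B & P i B) ->
  exists2 B : R, 0 < B & forall i, P i B.
Proof.
move=> mon h.
have /choice [B hB] : forall i, exists B, 0 < B /\ P i B.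
  by move=> i; have [b b0 pb] := h i; exists b.
exists (1 + \sum_i B i).
  by rewrite ltr_wpDr // sumr_ge0 // => i _; have [/ltW] := hB i.
move=> i; have [bi pi] := hB i; apply: mon pi.
rewrite (bigD1 i) //= addrCA lerDl addr_ge0 // sumr_ge0 // => j _.
by have [/ltW] := hB j.
Qed.

Lemma Ckv_compact_bound n m k (W K : set 'cV[R]_n) (X : 'cV[R]_n -> 'cV[R]_m) :
  Ckv k W X -> compact K -> K `<=` W ->
  exists2 B : R, 0 < B & forall x, K x -> `|X x| <= B.
Proof.
move=> hX cK KW.
have [] := @finite_bound m (fun i B => forall x, K x -> `|X x i ord0| <= B).
- by move=> i a b ab h x /h /le_trans; apply.
- by move=> i; exact: continuous_compact_bound (hX i) cK KW.
move=> B B0 hB; exists B => // x Kx; apply: cV_norm_le; first exact: ltW.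
by move=> i; exact: hB.
Qed.

Lemma jac_compact_bound n m k (W K : set 'cV[R]_n) (X : 'cV[R]_n -> 'cV[R]_m) :
  Ckv k.+1 W X -> compact K -> K `<=` W ->
  exists2 B : R, 0 < B & forall x (v : 'cV[R]_n), K x -> `|jac X x *m v| <= B * `|v|.
Proof.
move=> hX cK KW.
have [] := @finite_bound m (fun i B => forall j x, K x -> `|jac X x i j| <= B).
- by move=> i a b ab h j x /h /le_trans; apply.
- move=> i; have [] := @finite_bound n (fun j B => forall x, K x ->
    `|jac X x i j| <= B).
  + by move=> j a b ab h x /h /le_trans; apply.
  + move=> j; have [B B0 hB] := continuous_compact_bound
       (Ck_partial j (hX i)) cK KW.
    by exists B => // x Kx; rewrite mxE; exact: hB.
  by move=> B B0 hB; exists B.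
move=> B B0 hB; exists (n%:R * B + 1); first by rewrite ltr_wpDl // mulr_ge0 // ltW.
move=> x v Kx; apply: le_trans (mulmx_norm_le _ _) _.
apply: ler_wpM2r => //; apply: le_trans (_ : n%:R * B <= _); last by rewrite lerDl.
by apply: ler_wpM2l => //; apply: mx_norm_le => [|i j]; [exact: ltW|exact: hB].
Qed.

Lemma C1_lipschitz n m k (W K : set 'cV[R]_n) (X : 'cV[R]_n -> 'cV[R]_m) :
  open W -> Ckv k.+1 W X -> compact K -> K `<=` W -> convex_set K ->
  exists2 L : R, 0 < L & forall x y, K x -> K y -> `|X x - X y| <= L * `|x - y|.
Proof.
move=> oW hX cK KW cvK; have [B B0 hB] := jac_compact_bound hX cK KW.
exists B => // x y Kx Ky.
have X1 : Ckv 1 W X by move=> i; exact: Ck1 (hX i).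
have Ks s : s \in `[0, 1]%R -> K (y + s *: (x - y)).
  by rewrite in_itv /= => /andP[s0 s1]; exact: cvK.
have dlin c (s : R) : is_derive s (1 : R) (fun s => c * s) c.
  have -> : (fun s : R => c * s) = c \*: id by [].
  by apply: is_derive_eq; rewrite /GRing.scale /= mulr1.
have := @deriv_norm_le_cV R m (fun s => X (y + s *: (x - y)))
   (fun s => jac X (y + s *: (x - y)) *m (x - y)) (fun s => B * `|x - y| * s)
   (fun=> B * `|x - y|) 0 1 ler01.
rewrite scale1r subrKC scale0r addr0 mulr1 mulr0 subr0; apply.
- by move=> s /Ks /KW Ws; exact: (C1_comp_segment oW X1 Ws).
- by move=> s /Ks; exact: hB.
Qed.

(** Square roots of constants are avoided by the crude inequality c <= (c + 1)^2. *)
Lemma le_of_sqr_le (x y c : R) : 0 <= x -> 0 <= y -> 0 <= c ->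
  x ^+ 2 <= c * y ^+ 2 -> x <= (c + 1) * y.
Proof.
move=> x0 y0 c0 h; rewrite -(@ler_pXn2r _ 2) ?nnegrE ?mulr_ge0 ?addr_ge0 //.
apply: le_trans h _; rewrite exprMn ler_wpM2r ?sqr_ge0 //; nra.
Qed.

Lemma is_derive_expR_lin (c t : R) :
  is_derive t (1 : R) (fun s => expR (c * s)) (c * expR (c * t)).
Proof.
have h : is_derive t (1 : R) (fun s => c * s) c.
  have -> : (fun s : R => c * s) = c \*: id by [].
  by apply: is_derive_eq; rewrite /GRing.scale /= mulr1.
exact: is_derive_expR_comp h.
Qed.

(** Gronwall's lemma for the energy [inner u u], whose derivative is twice [inner u du]; the factor
    n + 1 comes from the comparison with the maximum norm. *)
Lemma inner_decay n (u du : R -> 'cV[R]_n) (c : R) :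
  (forall t : R, 0 <= t -> is_derive t (1 : R) u (du t)) ->
  (forall t, 0 <= t -> inner (u t) (du t) <= - c * inner (u t) (u t)) ->
  forall t, 0 <= t -> `|u t| <= (n%:R + 1) * `|u 0| * expR (- c * t).
Proof.
move=> hu hle t t0.
have := @gronwall R (fun s => inner (u s) (u s))
  (fun s => inner (du s) (u s) + inner (u s) (du s))
  (fun s => - (2 * c) * s) (fun=> - (2 * c)) t t0.
have H1 s : s \in `[0, t] -> is_derive s (1 : R) (fun s => inner (u s) (u s))
    (inner (du s) (u s) + inner (u s) (du s)).
  by rewrite in_itv /= => /andP[s0 _]; apply: is_derive_inner; exact: hu.
have H2 s : s \in `[0, t] -> is_derive s (1 : R) (fun s => - (2 * c) * s) (- (2 * c)).
  move=> _; have -> : (fun s : R => - (2 * c) * s) = - (2 * c) \*: id by [].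
  by apply: is_derive_eq; rewrite /GRing.scale /= mulr1.
have H3 s : s \in `[0, t] -> inner (du s) (u s) + inner (u s) (du s) <=
    - (2 * c) * inner (u s) (u s).
  rewrite in_itv /= => /andP[s0 _]; have := hle s s0; rewrite (innerC (du s)).
  lra.
move=> /(_ H1 H2 H3); rewrite mulr0 subr0 => h.
have -> : (n%:R + 1) * `|u 0| * expR (- c * t) =
    (n%:R + 1) * (`|u 0| * expR (- c * t)) by ring.
apply: le_of_sqr_le; rewrite ?mulr_ge0 ?expR_ge0 //.
apply: le_trans (sqr_norm_le_inner _) _; apply: le_trans h _.
rewrite exprMn mulrA -expRM_natl; apply: ler_pM; rewrite ?expR_ge0 ?inner_ge0 //.
  exact: inner_le_sqr_norm.
by rewrite ler_expR le_eqVlt; apply/orP; left; apply/eqP; ring.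
Qed.

(** The pointwise inequality behind [core_estimate]: p and r stand for |d| and |J d|, a and b for
    their Euclidean squares, g and h for exp(-delta t / 4) and its inverse, iD and iJ for the
    products of d with D and of J d with J D. The dangerous cross term 2 p r is at most g^2 a + h^2
    b; its first part has an integrable coefficient and its second part is absorbed by the
    dissipation, because k delta = m L + 1. The term delta / 2 * b comes from the derivative of the
    weight h^2. *)
Lemma core_arith (m L E k Cj delta p r e g h a b iD iJ : R) :
  0 <= m -> 0 <= L -> 0 <= E -> 0 <= k -> 0 <= Cj -> 0 <= delta ->
  0 <= p -> 0 <= r -> 0 <= e -> 0 <= g -> g <= 1 -> 0 <= h -> h * g = 1 ->
  p ^+ 2 <= a -> r ^+ 2 <= b -> r <= Cj * p -> e <= E * g ^+ 4 ->
  k * delta = m * L + 1 ->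
  iD <= m * (p * (L * (r + p * e))) -> iJ <= - delta * b + L * r * p * e ->
  2 * iD + k * (h ^+ 2 * (delta / 2 * b + 2 * iJ)) <=
  (m * L + 2 * m * L * E + 2 * k * L * Cj * E) * g ^+ 2 *
    (a + k * (h ^+ 2 * b)).
Proof.
move=> m0 L0 E0 k0 Cj0 d0 p0 r0 e0 g0 g1 h0 hg pa rb rp eE kd hD hJ.
have h20 : 0 <= h ^+ 2 by exact: sqr_ge0.
have g20 : 0 <= g ^+ 2 by exact: sqr_ge0.
have a0 : 0 <= a by exact: le_trans (sqr_ge0 _) pa.
have b0 : 0 <= b by exact: le_trans (sqr_ge0 _) rb.
have hb0 : 0 <= h ^+ 2 * b by exact: mulr_ge0.
have S1 : 2 * (p * r) <= g ^+ 2 * a + h ^+ 2 * b.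
  have e1 : 2 * (p * r) = 2 * ((g * p) * (h * r)).
    by rewrite -[LHS]mulr1 -hg; ring.
  have e2 : 0 <= (g * p - h * r) ^+ 2 by exact: sqr_ge0.
  have e3 : g ^+ 2 * p ^+ 2 <= g ^+ 2 * a by exact: ler_wpM2l.
  have e4 : h ^+ 2 * r ^+ 2 <= h ^+ 2 * b by exact: ler_wpM2l.
  nra.
have g21 : g ^+ 2 <= 1 by rewrite expr_le1.
have eg : e <= E * g ^+ 2.
  apply: le_trans eE _; apply: ler_wpM2l => //.
  by rewrite -[leRHS]mulr1 (_ : g ^+ 4 = g ^+ 2 * g ^+ 2) ?ler_wpM2l //; ring.
have S2 : p ^+ 2 * e <= E * (g ^+ 2 * a).
  apply: le_trans (_ : a * (E * g ^+ 2) <= _); last by rewrite mulrC mulrA.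
  by apply: ler_pM => //; exact: sqr_ge0.
have S3 : h ^+ 2 * (r * p * e) <= Cj * E * (g ^+ 2 * a).
  have e1 : r * p * e <= Cj * p * p * (E * g ^+ 4).
    by apply: ler_pM; rewrite ?mulr_ge0 // ler_wpM2r.
  apply: le_trans (ler_wpM2l h20 e1) _.
  have -> : h ^+ 2 * (Cj * p * p * (E * g ^+ 4)) =
      Cj * E * (g ^+ 2 * p ^+ 2) * (h * g) ^+ 2 by ring.
  rewrite hg expr1n mulr1; apply: ler_wpM2l; first exact: mulr_ge0.
  exact: ler_wpM2l.
have T1 : 2 * iD <= m * L * (g ^+ 2 * a + h ^+ 2 * b) +
    2 * m * L * (E * (g ^+ 2 * a)).
  have mL0 : 0 <= m * L by exact: mulr_ge0.
  have := ler_wpM2l mL0 S1; have := ler_wpM2l mL0 S2; nra.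
have T2 : k * (h ^+ 2 * (delta / 2 * b + 2 * iJ)) <=
    - (m * L + 1) * (h ^+ 2 * b) + 2 * k * L * (Cj * E * (g ^+ 2 * a)).
  have q1 : h ^+ 2 * (delta / 2 * b + 2 * iJ) <=
      - delta * (h ^+ 2 * b) + 2 * L * (h ^+ 2 * (r * p * e)).
    have db : 0 <= delta * b by exact: mulr_ge0.
    have := ler_wpM2l h20 hJ; have := ler_wpM2l h20 db; nra.
  apply: le_trans (ler_wpM2l k0 q1) _; rewrite -kd.
  have kL0 : 0 <= k * L by exact: mulr_ge0.
  have := ler_wpM2l kL0 S3; lra.
have c0 : 0 <= m * L + 2 * m * L * E + 2 * k * L * Cj * E.
  by do ?[apply: addr_ge0|apply: mulr_ge0].
have T3 : 0 <= (m * L + 2 * m * L * E + 2 * k * L * Cj * E) * g ^+ 2 *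
    (k * (h ^+ 2 * b)) by rewrite mulr_ge0 // mulr_ge0.
rewrite mulrDr; lra.
Qed.

(* The weight [h ^ 2], h = exp(delta t / 4), on the contracted component makes
   the quadratic form [|d|^2 + k h^2 |J d|^2] grow by an integrable rate only. *)
Lemma core_estimate n l (J : 'M[R]_(l, n)) (L delta E : R) :
  0 <= L -> 0 < delta -> 0 <= E ->
  exists C beta : R, [/\ 0 < C, 0 < beta &
  forall (d D : R -> 'cV[R]_n) (e : R -> R),
    (forall t : R, 0 <= t -> is_derive t (1 : R) d (D t)) ->
    (forall t, 0 <= t -> 0 <= e t /\ e t <= E * expR (- delta * t)) ->
    (forall t, 0 <= t -> `|D t| <= L * (`|J *m d t| + `|d t| * e t)) ->
    (forall t, 0 <= t -> inner (J *m d t) (J *m D t) <=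
       - delta * inner (J *m d t) (J *m d t) + L * `|J *m d t| * `|d t| * e t) ->
  forall t, 0 <= t -> `|d t| <= C * `|d 0| /\
     `|D t| <= C * `|d 0| * expR (- beta * t)].
Proof.
move=> L0 d0 E0.
have [Cj Cj0 hJ] := mulmx_bound J.
(* The weight for which the dissipation k delta exceeds by 1 the coefficient n L of the cross
   term. *)
pose k : R := (n%:R * L + 1) / delta.
have k0 : 0 < k by rewrite divr_gt0 // ltr_wpDl // mulr_ge0.
have k0' := ltW k0; have Cj0' := ltW Cj0; have d0' := ltW d0.
pose c0 : R := n%:R * L + 2 * n%:R * L * E + 2 * k * L * Cj * E.
have c00 : 0 <= c0 by do ?[apply: addr_ge0|apply: mulr_ge0]; rewrite ?invr_ge0.
pose c1 : R := n%:R + k * l%:R * Cj ^+ 2.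
have c10 : 0 <= c1.
  by rewrite /c1; do ?[apply: addr_ge0|apply: mulr_ge0]; rewrite ?invr_ge0 ?sqr_ge0.
(* 2 c0 / delta is the integral over the half-line of the growth rate c0 g^2, where g^2 = exp(-delta
   t / 2); c1 |d 0|^2 bounds the initial value of the quadratic form. *)
pose c3 : R := c1 * expR (2 * c0 / delta).
have c30 : 0 <= c3 by rewrite mulr_ge0 ?expR_ge0.
pose C := (c3 + 1) + L * ((c3 / k + 1) + (c3 + 1) * E).
have C0 : 0 < C.
  rewrite ltr_pwDl // ?ltr_wpDl //.
  by do ?[apply: addr_ge0|apply: mulr_ge0]; rewrite ?invr_ge0 ?expR_ge0 ?sqr_ge0.
(* Boundedness of h^2 |J d|^2, with h = exp(delta t / 4), gives decay of J d at rate delta / 4; the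
   other contribution to D, of size |d| e, decays faster. *)
exists C, (delta / 4); split=> //; first by rewrite divr_gt0.
move=> d D e hd he hD hJD T T0.
pose g (t : R) := expR (- (delta / 4) * t).
pose h (t : R) := expR (delta / 4 * t).
have gh t : h t * g t = 1 by rewrite /h /g mulNr expRxMexpNx_1.
have g4 t : expR (- delta * t) = g t ^+ 4.
  by rewrite /g -expRM_natl; congr expR; field.
have h1 t : 0 <= t -> 1 <= h t.
  by move=> t0; rewrite -expR0 ler_expR mulr_ge0 // divr_ge0 // ltW.
have g0 t : 0 < g t by exact: expR_gt0.
have g1 t : 0 <= t -> g t <= 1.
  move=> t0; rewrite -expR0 ler_expR mulr_le0_ge0 // oppr_le0 divr_ge0 //.
pose a t := inner (d t) (d t); pose b t := inner (J *m d t) (J *m d t).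
have dexp2 t : is_derive t (1 : R) (fun s => expR (delta / 2 * s))
   (delta / 2 * h t ^+ 2).
  rewrite (_ : h t ^+ 2 = expR (delta / 2 * t)).
    exact: is_derive_expR_lin.
  by rewrite /h -expRM_natl; congr expR; field.
have h2E t : expR (delta / 2 * t) = h t ^+ 2.
  by rewrite /h -expRM_natl; congr expR; field.
have key := @gronwall R (fun t => a t + k * (expR (delta / 2 * t) * b t))
  (fun t => 2 * inner (d t) (D t) + k * (h t ^+ 2 * (delta / 2 * b t +
     2 * inner (J *m d t) (J *m D t))))
  (fun t => - (2 * c0 / delta) * expR (- (delta / 2) * t))
  (fun t => c0 * g t ^+ 2) T T0.
have NT : a T + k * (h T ^+ 2 * b T) <= c3 * `|d 0| ^+ 2.
  apply: le_trans (_ : (a 0 + k * b 0) * expR (2 * c0 / delta) <= _); last first.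
    rewrite /c3 [leRHS]mulrAC ler_wpM2r ?expR_ge0 // /c1 mulrDl lerD //.
      exact: inner_le_sqr_norm.
    rewrite -2!(mulrA k) ler_pM2l //.
    rewrite -mulrA; apply: le_trans (inner_le_sqr_norm (J *m d 0)) _.
    rewrite -exprMn ler_wpM2l // ler_pXn2r ?nnegrE ?mulr_ge0 //.
  apply: le_trans (_ : (a 0 + k * b 0) * expR (2 * c0 / delta * (1 - expR (- (delta/2) * T))) <= _); last first.
    apply: ler_wpM2l; first by apply: addr_ge0; [|apply: mulr_ge0];
      rewrite ?inner_ge0.
    rewrite ler_expR -[leRHS]mulr1; apply: ler_wpM2l.
      by apply: divr_ge0 => //; apply: mulr_ge0.
    by rewrite gerBl expR_ge0.
  have := key; rewrite h2E mulr0 mulr0 expR0 mul1r => H.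
  apply: le_trans (H _ _ _) _.
  - move=> t; rewrite in_itv /= => /andP[t0 _].
    have hdt := hd t t0.
    have ha := is_derive_inner hdt hdt.
    have hJt := is_derive_mulmx J hdt.
    have hb := is_derive_inner hJt hJt.
    have hE := dexp2 t.
    have hp : is_derive t (1 : R) (fun s => expR (delta / 2 * s) * b s)
        (expR (delta / 2 * t) * (inner (J *m D t) (J *m d t) + inner (J *m d t) (J *m D t))
         + b t * (delta / 2 * h t ^+ 2)) by exact: is_deriveM.
    have hk : is_derive t (1 : R) (k \*: (fun s => expR (delta / 2 * s) * b s)) _ :=
      is_deriveZ k hp.
    have hs := is_deriveD ha hk.
    apply: is_derive_eq hs _.
    rewrite (innerC (D t)) (innerC (J *m D t)) h2E /GRing.scale /=; ring.
  - move=> t _; have h3 := is_derive_expR_lin (- (delta / 2)) t.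
    have := @is_deriveZ _ _ _ _ (- (2 * c0 / delta)) _ _ _ h3.
    move=> h4; apply: is_derive_eq h4 _.
    rewrite (_ : g t ^+ 2 = expR (- (delta / 2) * t)); last first.
      by rewrite /g -expRM_natl; congr expR; field.
    by rewrite /GRing.scale /=; field; exact: lt0r_neq0.
  - move=> t; rewrite in_itv /= => /andP[t0 _].
    have [e0 eE] := he t t0; rewrite g4 in eE.
    rewrite h2E; apply: (@core_arith _ L E k Cj delta `|d t| `|J *m d t| (e t))
      => //; rewrite ?expR_ge0 ?g1 //.
    - exact: sqr_norm_le_inner.
    - exact: sqr_norm_le_inner.
    - by rewrite /k divfK ?lt0r_neq0.
    - apply: le_trans (ler_norm _) _; apply: le_trans (inner_le _ _) _.
      by rewrite !ler_wpM2l // hD.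
    - exact: hJD.
  rewrite (_ : _ - _ = 2 * c0 / delta * (1 - expR (- (delta / 2) * T))) //.
  by ring.
have [e0 eE] := he T T0; rewrite g4 in eE.
have gT1 := g1 T T0; have gT0 := ltW (g0 T).
have bT0 : 0 <= b T by exact: inner_ge0.
have aT0 : 0 <= a T by exact: inner_ge0.
have khb : 0 <= k * (h T ^+ 2 * b T) by rewrite mulr_ge0 // mulr_ge0 // sqr_ge0.
have dT : `|d T| <= (c3 + 1) * `|d 0|.
  apply: le_of_sqr_le => //; apply: le_trans (sqr_norm_le_inner _) _.
  by rewrite -/(a T); lra.
have JT : `|J *m d T| <= (c3 / k + 1) * `|d 0| * g T.
  rewrite -[leLHS]mulr1 -[X in _ * X](gh T) mulrA; apply: ler_wpM2r => //.
  apply: le_of_sqr_le; rewrite ?mulr_ge0 ?expR_ge0 ?invr_ge0 //.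
  have -> : c3 / k * `|d 0| ^+ 2 = (c3 * `|d 0| ^+ 2) / k by rewrite mulrAC.
  rewrite ler_pdivlMr // mulrC; apply: le_trans NT; rewrite -[leLHS]add0r lerD // ler_pM2l // exprMn mulrC.
  by apply: ler_wpM2l; [exact: sqr_ge0|exact: sqr_norm_le_inner].
have x1 : 0 <= c3 / k + 1 by rewrite addr_ge0 // mulr_ge0 ?invr_ge0.
have x2 : 0 <= c3 + 1 by rewrite addr_ge0.
split.
  apply: le_trans dT _; apply: ler_wpM2r => //.
  by rewrite lerDl mulr_ge0 // addr_ge0 // mulr_ge0.
apply: le_trans (hD T T0) _.
apply: le_trans (_ : L * ((c3 / k + 1) * `|d 0| * g T +
   (c3 + 1) * `|d 0| * (E * g T)) <= _).
  apply: ler_wpM2l => //; apply: lerD => //; apply: ler_pM => //.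
  apply: le_trans eE _; apply: ler_wpM2l => //.
  by rewrite exprS ger_pMr // expr_le1.
rewrite -/(g T) /C.
have -> : L * ((c3 / k + 1) * `|d 0| * g T + (c3 + 1) * `|d 0| * (E * g T)) =
  (L * (c3 / k + 1 + (c3 + 1) * E)) * `|d 0| * g T by ring.
by apply: ler_wpM2r => //; apply: ler_wpM2r => //; rewrite lerDr.
Qed.

End Estimates.

(** * Continuity, compactness and exponentially convergent curves *)

Section Topology.
Context {R : realType}.

Lemma lipschitz_continuous (V W : normedModType R) (f : V -> W) (L : R) :
  0 < L -> (forall x y, `|f x - f y| <= L * `|x - y|) -> continuous f.
Proof.
move=> L0 h x; apply/cvgrPdist_le => e e0; near=> y.
apply: le_trans (h _ _) _; rewrite -ler_pdivlMl // mulrC.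
by near: y; apply: cvgr_dist_le; [exact: cvg_id|rewrite divr_gt0].
Unshelve. all: by end_near. Qed.

Lemma mulmx_continuous m n (M : 'M[R]_(m, n)) :
  continuous (fun x : 'cV[R]_n => M *m x).
Proof.
have [C C0 h] := mulmx_bound M.
by apply: (lipschitz_continuous C0) => x y; rewrite -mulmxBr.
Qed.

Lemma usubmx_continuous m n : continuous (@usubmx R m n 1).
Proof.
apply: (lipschitz_continuous ltr01) => x y; rewrite mul1r.
by rewrite (_ : _ - _ = usubmx (x - y)) ?norm_usubmx_le // linearB.
Qed.

Lemma dsubmx_continuous m n : continuous (@dsubmx R m n 1).
Proof.
apply: (lipschitz_continuous ltr01) => x y; rewrite mul1r.
by rewrite (_ : _ - _ = dsubmx (x - y)) ?norm_dsubmx_le // linearB.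
Qed.

Lemma closed_preim (T U : topologicalType) (f : T -> U) (D : set U) :
  continuous f -> closed D -> closed (f @^-1` D).
Proof. by move=> cf; apply: preimage_closed => x _; exact: cf. Qed.

Lemma open_preim (T U : topologicalType) (f : T -> U) (D : set U) :
  continuous f -> open D -> open (f @^-1` D).
Proof. by move=> cf oD; apply: open_comp oD => x _; exact: cf. Qed.

Lemma norm_comp_continuous (V W : normedModType R) (f : V -> W) :
  continuous f -> continuous (fun x => `|f x|).
Proof. by move=> cf x; apply: cvg_norm; exact: cf. Qed.

Lemma closed_norm_le (V W : normedModType R) (f : V -> W) (c : R) :
  continuous f -> closed [set x | `|f x| <= c].
Proof.
move=> cf.
exact: (@closed_preim _ _ (fun x => `|f x|) [set y | y <= c]
  (norm_comp_continuous cf) (@closed_le _ c)).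
Qed.

Lemma open_norm_lt (V W : normedModType R) (f : V -> W) (c : R) :
  continuous f -> open [set x | `|f x| < c].
Proof.
move=> cf.
exact: (@open_preim _ _ (fun x => `|f x|) [set y | y < c]
  (norm_comp_continuous cf) (@open_lt _ c)).
Qed.

(** Carried over from row vectors through transposition, which preserves the norm. *)
Lemma closed_bounded_compact_cV n (K : set 'cV[R]_n) (B : R) :
  (forall x, K x -> `|x| <= B) -> closed K -> compact K.
Proof.
move=> hB cK.
have ct p q : continuous (fun x : 'M[R]_(p, q) => x^T).
  apply: (lipschitz_continuous ltr01) => x y; rewrite mul1r -linearB /=.
  by apply: mx_norm_le => // i j; rewrite mxE mx_coord_le.
have -> : K = (fun x : 'rV[R]_n => x^T) @` [set x | K x^T].
  rewrite eqEsubset; split => [x Kx|_ [x Kx <-]] //.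
  by exists x^T; rewrite /= trmxK.
apply: continuous_compact.
  by apply: continuous_subspaceT => x; exact: ct.
apply: bounded_closed_compact.
  exists B; split; first exact: num_real.
  move=> b bB x /hB h; apply: le_trans (ltW bB); apply: le_trans h.
  by apply: mx_norm_le => // i j; rewrite (_ : x i j = x^T j i) ?mx_coord_le // mxE.
by apply: (@closed_preim _ _ (fun x : 'rV[R]_n => x^T) K) => //; exact: ct.
Qed.

Lemma exp_small (A beta e : R) : 0 < beta -> 0 < e ->
  exists2 T : R, 0 <= T & forall t, T <= t -> A * expR (- beta * t) <= e.
Proof.
move=> b0 e0; exists (`|A| / (e * beta)); first by rewrite divr_ge0 // mulr_ge0 // ltW.
move=> t ht; have t0 : 0 <= t by apply: le_trans ht; rewrite divr_ge0 // mulr_ge0 // ltW.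
rewrite mulNr expRN ler_pdivrMr ?expR_gt0 //.
apply: le_trans (ler_norm _) _.
apply: le_trans (_ : e * (1 + beta * t) <= _); last first.
  by rewrite ler_pM2l // expR_ge1Dx // mulr_ge0 // ltW.
move: ht; rewrite ler_pdivrMr ?mulr_gt0 // => ht.
by apply: le_trans ht _; rewrite mulrDr mulr1 mulrC mulrA ler_wpDl // ltW.
Qed.

Lemma exp_close_cvg n (f : R -> 'cV[R]_n) p (A beta : R) : 0 < beta ->
  (forall t, 0 <= t -> `|f t - p| <= A * expR (- beta * t)) -> f @ +oo --> p.
Proof.
move=> b0 h; apply/cvgrPdist_le => e e0.
have [T T0 hT] := exp_small A b0 e0.
exists T; split; first exact: num_real.
move=> t Tt; rewrite distrC; apply: le_trans (h _ _) _; first exact: le_trans T0 (ltW Tt).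
exact/hT/ltW.
Qed.

(** The limit is taken along the integers; a real time is compared with a later integer, and these
    two errors make up the factor 2. *)
Lemma exp_deriv_lim n (f df : R -> 'cV[R]_n) (A beta : R) : 0 < beta -> 0 <= A ->
  (forall t : R, 0 <= t -> is_derive t (1 : R) f (df t)) ->
  (forall t : R, 0 <= t -> `|df t| <= A * expR (- beta * t)) ->
  exists p, forall t, 0 <= t -> `|f t - p| <= 2 * A / beta * expR (- beta * t).
Proof.
move=> b0 A0 hd hb.
have Ab : 0 <= A / beta by rewrite divr_ge0 // ltW.
have step s t : 0 <= s -> s <= t -> `|f t - f s| <= A / beta * expR (- beta * s).
  move=> s0 st.
  have := @deriv_norm_le_cV R n f df (fun u => - (A / beta) * expR (- beta * u))
    (fun u => A * expR (- beta * u)) s t st.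
  move=> H; apply: le_trans (H _ _ _) _.
  - by move=> u; rewrite in_itv /= => /andP[su _]; apply: hd; exact: le_trans su.
  - move=> u _; have h := @is_deriveZ _ _ _ _ (- (A / beta)) _ _ _
      (is_derive_expR_lin (- beta) u).
    apply: is_derive_eq h _; rewrite /GRing.scale /=.
    by field; exact: lt0r_neq0.
  - by move=> u; rewrite in_itv /= => /andP[su _]; apply: hb; exact: le_trans su.
  rewrite !mulNr opprK addrC lerBlDr lerDl mulr_ge0 ?expR_ge0 //.
have [] := @cauchy_tail_lim R _ (fun k => f k%:R) (fun k => A / beta * expR (- beta * k%:R)).
- apply/cvgrPdist_le => e e0.
  have [T T0 hT] := exp_small (A / beta) b0 e0.
  near=> k; rewrite sub0r normrN ger0_norm; last by apply: mulr_ge0; rewrite ?expR_ge0.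
  by apply: hT; near: k; exact: nbhs_infty_ger.
- by move=> k m km; apply: step; rewrite ?ler_nat.
move=> p hp; exists p => t t0.
pose k := Num.bound t.
have tk : t <= k%:R by apply: ltW; exact: archi_boundP.
rewrite -(subrKA (f k%:R)) addrC; apply: le_trans (ler_normD _ _) _.
have -> : 2 * A / beta * expR (- beta * t) =
  A / beta * expR (- beta * t) + A / beta * expR (- beta * t) by ring.
apply: lerD.
  rewrite distrC; apply: le_trans (hp k) _; apply: ler_wpM2l => //.
  by rewrite ler_expR !mulNr lerN2 ler_pM2l.
by rewrite distrC; exact: step.
Unshelve. all: by end_near. Qed.

End Topology.

(** * Limits of orbits attracted by equilibria *)

Section NormallyAttracting.
Context {R : realType}.

Definition traj n (X : 'cV[R]_n -> 'cV[R]_n) (K : set 'cV[R]_n) (z0 : 'cV[R]_n)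
    (z : R -> 'cV[R]_n) :=
  [/\ z 0 = z0, forall t : R, 0 <= t -> is_derive t (1 : R) z (X (z t)) &
      forall t, 0 <= t -> K (z t)].

(* The kernel of the projector [P] (equivalently, of [J]) consists of
   equilibria of [X], and it attracts the trajectories at rate [delta] for the
   inner product carried by [J].  Trajectories issued from [Om] stay in [K]. *)
Record attracting n l (X : 'cV[R]_n -> 'cV[R]_n) (P : 'M[R]_n)
    (J : 'M[R]_(l, n)) (W K Om : set 'cV[R]_n) (delta : R) : Prop := Attracting {
  att_openW : open W;
  att_KW : K `<=` W;
  att_compact : compact K;
  att_convex : convex_set K;
  att_K0 : K 0;
  att_box : forall x y, K x -> K y -> K (x - P *m x + P *m y);
  att_smooth : forall k, Ckv k W X;
  att_PP : P *m P = P;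
  att_JP : J *m P = J;
  att_PJ : exists2 c : R, 0 < c & forall x : 'cV[R]_n, `|P *m x| <= c * `|J *m x|;
  att_eq : forall z, W z -> P *m z = 0 -> X z = 0;
  att_delta : 0 < delta;
  att_diss : forall z v, K z ->
    inner (J *m v) (J *m (jac X z *m (P *m v))) <=
    - delta * inner (J *m v) (J *m v);
  att_openOm : open Om;
  att_OmK : Om `<=` K;
  att_traj : forall z0, Om z0 -> exists z, traj X K z0 z }.

Lemma jac_lipschitz n m (W K : set 'cV[R]_n) (X : 'cV[R]_n -> 'cV[R]_m) :
  open W -> Ckv 2 W X -> compact K -> K `<=` W -> convex_set K ->
  exists2 L : R, 0 < L & forall x y (v : 'cV[R]_n), K x -> K y ->
    `|jac X x *m v - jac X y *m v| <= L * `|x - y| * `|v|.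
Proof.
move=> oW hX cK KW cvK.
have [] := @finite_bound R n (fun j B => forall x y, K x -> K y ->
   `|(\col_i partial j (fun x => X x i ord0) x) -
     (\col_i partial j (fun x => X x i ord0) y)| <= B * `|x - y|).
- move=> j a b ab h x y Kx Ky; apply: le_trans (h _ _ Kx Ky) _.
  exact: ler_wpM2r.
- move=> j; apply: (@C1_lipschitz _ _ _ 0 W) => // i.
  rewrite (_ : (fun x => _) = partial j (fun x => X x i ord0)); last first.
    by apply/funext => x; rewrite mxE.
  exact: Ck_partial.
move=> B B0 hB; exists (n%:R * B + 1).
  by rewrite ltr_wpDl // mulr_ge0 // ltW.
move=> x y v Kx Ky; rewrite -mulmxBl.
apply: le_trans (_ : n%:R * (B * `|x - y| * `|v|) <= _); last first.
  have -> : n%:R * (B * `|x - y| * `|v|) = n%:R * B * (`|x - y| * `|v|) by ring.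
  by rewrite -[leRHS]mulrA ler_wpM2r ?mulr_ge0 // lerDl.
apply: cV_norm_le => [|i]; first by rewrite !mulr_ge0 // ltW.
rewrite mxE; apply: ler_norm_sum_const => j; rewrite normrM.
apply: ler_pM => //; last exact: mx_coord_le.
apply: le_trans (hB j x y Kx Ky).
by have := mx_coord_le (\col_i partial j (fun x0 => X x0 i ord0) x -
   \col_i partial j (fun x0 => X x0 i ord0) y) i ord0; rewrite !mxE.
Qed.

Section Estimates.
Variables (n l : nat) (X : 'cV[R]_n -> 'cV[R]_n) (P : 'M[R]_n)
  (J : 'M[R]_(l, n)) (W K Om : set 'cV[R]_n) (delta : R).
Hypothesis hA : attracting X P J W K Om delta.

Let oW := att_openW hA.
Let KW := att_KW hA.
Let X1 : Ckv 1 W X. Proof. exact: att_smooth hA 1%N. Qed.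

Let JQ (v : 'cV[R]_n) : J *m (v - P *m v) = 0.
Proof. by rewrite mulmxBr mulmxA (att_JP hA) subrr. Qed.

Let PQ (v : 'cV[R]_n) : P *m (v - P *m v) = 0.
Proof. by rewrite mulmxBr mulmxA (att_PP hA) subrr. Qed.

Let KQ z : K z -> K (z - P *m z).
Proof. by move=> Kz; have := att_box hA Kz (att_K0 hA); rewrite mulmx0 addr0. Qed.

Let Q_bound : exists2 c : R, 0 < c & forall v : 'cV[R]_n, `|v - P *m v| <= c * `|v|.
Proof.
have [c c0 h] := mulmx_bound P; exists (1 + c); first by rewrite ltr_wpDr // ltW.
by move=> v; apply: le_trans (ler_normB _ _) _; rewrite mulrDl mul1r lerD2l.
Qed.

(** The field vanishes identically near z on the line z + s v, which lies in the kernel of [P]. *)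
Lemma jac_tangent_eq z (v : 'cV[R]_n) : W z -> P *m z = 0 -> P *m v = 0 -> jac X z *m v = 0.
Proof.
move=> Wz Pz Pv.
have [d d0 hd] := ball_cV_sub oW Wz.
have h0 : is_derive (0 : R) (1 : R) (fun s => X (z + s *: v)) (jac X z *m v).
  have := @C1_comp_segment R n n W X z v 0 oW X1; rewrite scale0r addr0.
  by apply.
have [_] : is_derive (0 : R) (1 : R) (cst 0 : R -> 'cV[R]_n) (jac X z *m v).
  apply: near_eq_is_derive h0; near=> s; apply: (att_eq hA).
    apply: hd; rewrite normrZ; near: s.
    have c : (fun s : R => `|s| * `|v|) @ 0 --> `|0 : R| * `|v|.
      by apply: cvgM; [exact: (@norm_continuous _ R^o 0)|exact: cvg_cst].
    move: c; rewrite normr0 mul0r => /cvgrPdist_le /(_ d d0).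
    apply: filterS => s; rewrite sub0r normrN; exact: le_trans (ler_norm _).
  by rewrite mulmxDr -scalemxAr Pz Pv scaler0 addr0.
by rewrite derive_cst.
Unshelve. all: by end_near. Qed.

(** The Jacobian at z is compared with that at z - P z, a point of the kernel where it annihilates v
    - P v; the distance between the two points is |P z|, controlled by |J z|. This is the smallness
    that makes the slow drift integrable. *)
Lemma jac_Q_bound : exists2 L : R, 0 < L & forall z (v : 'cV[R]_n), K z ->
  `|jac X z *m (v - P *m v)| <= L * `|J *m z| * `|v|.
Proof.
have [L L0 hL] := jac_lipschitz oW (att_smooth hA 2) (att_compact hA) KW
  (att_convex hA).
have [c c0 hc] := att_PJ hA; have [q q0 hq] := Q_bound.
exists (L * c * q); first by rewrite !mulr_gt0.
move=> z v Kz; have Kq := KQ Kz.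
have e0 : jac X (z - P *m z) *m (v - P *m v) = 0.
  by apply: jac_tangent_eq; [exact: KW|exact: PQ|exact: PQ].
rewrite -[X in `|X|]subr0 -{1}e0; apply: le_trans (hL _ _ _ Kz Kq) _.
rewrite opprB addrC subrK.
apply: le_trans (_ : L * (c * `|J *m z|) * (q * `|v|) <= _); last first.
  by rewrite le_eqVlt; apply/orP; left; apply/eqP; ring.
by apply: ler_pM; rewrite ?mulr_ge0 ?(ltW L0) // ler_pM2l.
Qed.

(* The inequalities required by [core_estimate], for the difference of two
   trajectories and for a solution of the variational equation. *)
Definition contracting_pair (L e : R) (d D : 'cV[R]_n) :=
  `|D| <= L * (`|J *m d| + `|d| * e) /\
  inner (J *m d) (J *m D) <= - delta * inner (J *m d) (J *m d) +
    L * `|J *m d| * `|d| * e.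

(** The vector is split along [P]: the dissipation acts on P v, while the image of v - P v carries
    the factor |J z|. *)
Lemma tangent_contracting : exists2 L : R, 0 < L & forall z (v : 'cV[R]_n), K z ->
  contracting_pair L `|J *m z| v (jac X z *m v).
Proof.
have [L L0 hL] := jac_Q_bound.
have [B B0 hB] := jac_compact_bound (att_smooth hA 1%N) (att_compact hA) KW.
have [c c0 hc] := att_PJ hA; have [j j0 hj] := mulmx_bound J.
exists (B * c + L + l%:R * (j * L)).
  by rewrite ltr_wpDr ?mulr_ge0 ?(ltW j0) ?(ltW L0) // addr_gt0 // mulr_gt0.
move=> z v Kz.
have split_v : jac X z *m v = jac X z *m (P *m v) + jac X z *m (v - P *m v).
  by rewrite -mulmxDr subrKC.
have x0 : 0 <= l%:R * (j * L) by rewrite !mulr_ge0 // ltW.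
have x1 : 0 <= B * c by rewrite mulr_ge0 // ltW.
have x2 : 0 <= `|v| * `|J *m z| by rewrite mulr_ge0.
split.
  rewrite split_v; apply: le_trans (ler_normD _ _) _.
  apply: le_trans (lerD (hB _ _ Kz) (hL _ _ Kz)) _.
  have h1 : B * `|P *m v| <= B * c * `|J *m v| by rewrite -mulrA ler_pM2l.
  have x3 := normr_ge0 (J *m v).
  have L0' := ltW L0; nra.
rewrite split_v mulmxDr innerDr; apply: lerD; first exact: (att_diss hA).
apply: le_trans (ler_norm _) _; apply: le_trans (inner_le _ _) _.
apply: le_trans (_ : l%:R * (`|J *m v| * (j * (L * `|J *m z| * `|v|))) <= _).
  rewrite ler_wpM2l // ler_wpM2l //; apply: le_trans (hj _) _.
  by rewrite ler_pM2l // hL.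
rewrite [leLHS](_ : _ = l%:R * (j * L) * `|J *m v| * `|v| * `|J *m z|); last by ring.
do 3 (apply: ler_wpM2r => //).
by rewrite lerDr addr_ge0 // ltW.
Qed.

(** The Jacobian estimates are integrated along a broken line adapted to [P]. Only one of the two
    points enters the coupling term |J z|, so it may be compared with an equilibrium, for which the
    coupling vanishes. *)
Lemma flow_contracting : exists2 L : R, 0 < L & forall z z', K z -> K z' ->
  contracting_pair L `|J *m z| (z' - z) (X z' - X z).
Proof.
have [L L0 hL] := jac_Q_bound.
have [B B0 hB] := jac_compact_bound (att_smooth hA 1%N) (att_compact hA) KW.
have [c c0 hc] := att_PJ hA; have [j j0 hj] := mulmx_bound J.
exists (B * c + L + l%:R * (j * L)).
  by rewrite ltr_wpDr ?mulr_ge0 ?(ltW j0) ?(ltW L0) // addr_gt0 // mulr_gt0.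
move=> z z' Kz Kz'; set d := z' - z.
have x0 : 0 <= l%:R * (j * L) by rewrite !mulr_ge0 // ltW.
have x1 : 0 <= B * c by rewrite mulr_ge0 // ltW.
(* The point with the fast component of z and the slow one of z'. From z to m the function J is
   constant, so the coupling bound holds with |J z| throughout; from m to z' the displacement is P
   d, on which the dissipation acts. *)
pose m := z' - P *m z' + P *m z.
have Km : K m by exact: (att_box hA).
have mz : m = z + (d - P *m d).
  rewrite /m /d mulmxBr; move: (P *m z') (P *m z) => a b.
  by apply/matrixP => i k; rewrite !mxE; ring.
have mz' : z' = m + P *m d.
  rewrite /m /d mulmxBr; move: (P *m z') (P *m z) => a b.
  by apply/matrixP => i k; rewrite !mxE; ring.
clearbody d.
have x2 : 0 <= `|d| * `|J *m z| by rewrite mulr_ge0.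
have dlin k (s : R) : is_derive s (1 : R) (fun s => k * s) k.
  have -> : (fun s : R => k * s) = k \*: id by [].
  by apply: is_derive_eq; rewrite /GRing.scale /= mulr1.
have Ks1 s : s \in `[0, 1]%R -> K (z + s *: (d - P *m d)).
  rewrite in_itv /= => /andP[s0 s1].
  have := att_convex hA Kz Km s0 s1.
  by have -> : m - z = d - P *m d by rewrite mz addrC addKr.
have Ks2 s : s \in `[0, 1]%R -> K (m + s *: (P *m d)).
  rewrite in_itv /= => /andP[s0 s1].
  have := att_convex hA Km Kz' s0 s1.
  by have -> : z' - m = P *m d by rewrite {1}mz' addrC addKr.
have F1 : `|X m - X z| <= L * `|J *m z| * `|d|.
  have := @deriv_norm_le_cV R n (fun s => X (z + s *: (d - P *m d)))
    (fun s => jac X (z + s *: (d - P *m d)) *m (d - P *m d))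
    (fun s => L * `|J *m z| * `|d| * s) (fun=> L * `|J *m z| * `|d|) 0 1 ler01.
  rewrite scale1r -mz scale0r addr0 mulr1 mulr0 subr0; apply.
  - by move=> s /Ks1 /KW Ws; exact: (C1_comp_segment oW X1 Ws).
  - move=> s /Ks1 Ks; apply: le_trans (hL _ _ Ks) _.
    by rewrite mulmxDr -scalemxAr JQ scaler0 addr0.
have F2 : `|X z' - X m| <= B * c * `|J *m d|.
  have := @deriv_norm_le_cV R n (fun s => X (m + s *: (P *m d)))
    (fun s => jac X (m + s *: (P *m d)) *m (P *m d))
    (fun s => B * c * `|J *m d| * s) (fun=> B * c * `|J *m d|) 0 1 ler01.
  rewrite scale1r -mz' scale0r addr0 mulr1 mulr0 subr0; apply.
  - by move=> s /Ks2 /KW Ws; exact: (C1_comp_segment oW X1 Ws).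
  - move=> s /Ks2 Ks; apply: le_trans (hB _ _ Ks) _.
    by rewrite -mulrA ler_pM2l.
have F3 : inner (J *m d) (J *m (X z' - X m)) <= - delta * inner (J *m d) (J *m d).
  have := @deriv_le_incr R (fun s => inner (J *m d) (J *m X (m + s *: (P *m d))))
    (fun s => inner (J *m d) (J *m (jac X (m + s *: (P *m d)) *m (P *m d))))
    (fun s => - delta * inner (J *m d) (J *m d) * s)
    (fun=> - delta * inner (J *m d) (J *m d)) 0 1 ler01.
  rewrite scale1r -mz' scale0r addr0 mulr1 mulr0 subr0 -innerBr -mulmxBr; apply.
  - move=> s /Ks2 /KW Ws.
    have h1 := is_derive_mulmx J (C1_comp_segment oW X1 Ws).
    have h2 := is_derive_inner (is_derive_cst (J *m d) s (1 : R)) h1.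
    by apply: is_derive_eq h2 _; rewrite innerC inner0r add0r.
  - by move=> s /Ks2 Ks; exact: (att_diss hA).
have XX : X z' - X z = (X z' - X m) + (X m - X z) by rewrite subrKA.
split.
  rewrite XX; apply: le_trans (ler_normD _ _) _.
  apply: le_trans (lerD F2 F1) _.
  have x3 := normr_ge0 (J *m d).
  have L0' := ltW L0; nra.
rewrite XX mulmxDr innerDr; apply: lerD; first exact: F3.
apply: le_trans (ler_norm _) _; apply: le_trans (inner_le _ _) _.
apply: le_trans (_ : l%:R * (`|J *m d| * (j * (L * `|J *m z| * `|d|))) <= _).
  rewrite ler_wpM2l // ler_wpM2l //; apply: le_trans (hj _) _.
  by rewrite ler_pM2l.
rewrite [leLHS](_ : _ = l%:R * (j * L) * `|J *m d| * `|d| * `|J *m z|); last by ring.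
do 3 (apply: ler_wpM2r => //).
by rewrite lerDr addr_ge0 // ltW.
Qed.

End Estimates.
End NormallyAttracting.

(** * The limit map: existence, Lipschitz continuity and directional derivatives *)

Section FlowLimit.
Context {R : realType}.

Lemma second_order_bound n m (W K : set 'cV[R]_n) (X : 'cV[R]_n -> 'cV[R]_m) :
  open W -> Ckv 2 W X -> compact K -> K `<=` W -> convex_set K ->
  exists2 L : R, 0 < L & forall x y, K x -> K y ->
    `|X y - X x - jac X x *m (y - x)| <= L * `|y - x| ^+ 2.
Proof.
move=> oW hX cK KW cvK; have [L L0 hL] := jac_lipschitz oW hX cK KW cvK.
have X1 : Ckv 1 W X by move=> i; exact: CkS (hX i).
exists L => // x y Kx Ky; set d := y - x.
have Ks s : s \in `[0, 1]%R -> K (x + s *: d).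
  by rewrite in_itv /= => /andP[s0 s1]; exact: cvK.
have := @deriv_norm_le_cV R m
  (fun s => X (x + s *: d) - (0 + s *: (jac X x *m d)))
  (fun s => jac X (x + s *: d) *m d - jac X x *m d)
  (fun s => L * `|d| ^+ 2 * s) (fun=> L * `|d| ^+ 2) 0 1 ler01.
rewrite !scale1r !scale0r !addr0 add0r subr0 mulr1 mulr0 subr0.
rewrite {1}/d subrKC addrAC; apply.
- move=> s /Ks /KW Ws; apply: is_deriveB.
    exact: (C1_comp_segment oW X1 Ws).
  exact: (is_derive_segment 0).
- move=> s _; have -> : (fun s : R => L * `|d| ^+ 2 * s) = (L * `|d| ^+ 2) \*: id.
    by [].
  by apply: is_derive_eq; rewrite /GRing.scale /= mulr1.
- move=> s sI; apply: le_trans (hL _ _ _ (Ks _ sI) Kx) _.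
  have -> : x + s *: d - x = s *: d by rewrite addrC addKr.
  move: sI; rewrite in_itv /= => /andP[s0 s1].
  rewrite normrZ (ger0_norm s0) expr2 [leRHS]mulrA; apply: ler_wpM2r => //.
  by rewrite ler_pM2l // ler_piMl.
Qed.

Lemma exp_close_unique n (f : R -> 'cV[R]_n) p q (A beta : R) : 0 < beta ->
  (forall t, 0 <= t -> `|f t - p| <= A * expR (- beta * t)) ->
  f @ +oo --> q -> p = q.
Proof.
by move=> b0 /(exp_close_cvg b0); apply: (cvg_unique (@norm_hausdorff _ _)).
Qed.

Variables (n l : nat) (X : 'cV[R]_n -> 'cV[R]_n) (P : 'M[R]_n)
  (J : 'M[R]_(l, n)) (W K Om : set 'cV[R]_n) (delta : R).
Hypothesis hA : attracting X P J W K Om delta.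

Let oW := att_openW hA.
Let KW := att_KW hA.
Let d0 := att_delta hA.

Lemma att_bounded : exists2 B : R, 0 < B & forall x, K x -> `|x| <= B.
Proof.
apply: (@Ckv_compact_bound _ _ _ 0 W K id) => //; last exact: att_compact hA.
by move=> i; exact: Ck_coord.
Qed.

(** A point z of the orbit is compared with the equilibrium z - P z, at which both [X] and [J]
    vanish: the coupling disappears and pure contraction at rate [delta] remains. *)
Let J_decay : exists2 E : R, 0 < E & forall z0 z, traj X K z0 z ->
  forall t, 0 <= t -> `|J *m z t| <= E * expR (- delta * t).
Proof.
have [B B0 hB] := att_bounded; have [L L0 hL] := flow_contracting hA.
have [j j0 hj] := mulmx_bound J.
exists ((l%:R + 1) * (j * B)); first by rewrite !mulr_gt0 // ltr_wpDl.
move=> z0 z [e0 hz Kz] t t0.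
apply: le_trans (@inner_decay R l (fun s => J *m z s) (fun s => J *m X (z s))
  delta _ _ t t0) _.
- by move=> s s0; exact: (is_derive_mulmx J (hz s s0)).
- move=> s s0; have Ks := Kz s s0.
  have Kq : K (z s - P *m z s).
    by have := att_box hA Ks (att_K0 hA); rewrite mulmx0 addr0.
  have Jq : J *m (z s - P *m z s) = 0.
    by rewrite mulmxBr mulmxA (att_JP hA) subrr.
  have Xq : X (z s - P *m z s) = 0.
    apply: (att_eq hA); first exact: KW.
    by rewrite mulmxBr mulmxA (att_PP hA) subrr.
  have [_] := hL _ _ Kq Ks; rewrite Jq normr0 mulr0 addr0 Xq subr0.
  by rewrite opprB addrC subrK mulmxA (att_JP hA).
apply: ler_wpM2r; first exact: expR_ge0.
apply: ler_wpM2l; first by rewrite addr_ge0.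
apply: le_trans (hj _) _; rewrite ler_pM2l //; apply: hB.
exact: Kz.
Qed.

Lemma flow_estimate : exists C beta : R, [/\ 0 < C, 0 < beta &
  forall z0 z z0' z', traj X K z0 z -> traj X K z0' z' -> forall t, 0 <= t ->
    `|z' t - z t| <= C * `|z0' - z0| /\
    `|X (z' t) - X (z t)| <= C * `|z0' - z0| * expR (- beta * t)].
Proof.
have [E E0 hE] := J_decay; have [L L0 hL] := flow_contracting hA.
have [C [beta [C0 b0 H]]] := core_estimate J (ltW L0) d0 (ltW E0).
exists C, beta; split => // z0 z z0' z' tz tz'.
have [ez hz Kz] := tz; have [ez' hz' Kz'] := tz'.
rewrite -ez -ez'.
apply: (H (fun t => z' t - z t) (fun t => X (z' t) - X (z t))
  (fun t => `|J *m z t|)) => t t0.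
- by apply: is_deriveB; [exact: hz'|exact: hz].
- by split => //; exact: hE tz _ t0.
- by have [] := hL _ _ (Kz t t0) (Kz' t t0).
- by have [] := hL _ _ (Kz t t0) (Kz' t t0).
Qed.

Lemma tangent_estimate : exists C beta : R, [/\ 0 < C, 0 < beta &
  forall z0 z (xi : R -> 'cV[R]_n), traj X K z0 z ->
    (forall t : R, 0 <= t -> is_derive t (1 : R) xi (jac X (z t) *m xi t)) ->
  forall t, 0 <= t -> `|xi t| <= C * `|xi 0| /\
    `|jac X (z t) *m xi t| <= C * `|xi 0| * expR (- beta * t)].
Proof.
have [E E0 hE] := J_decay; have [L L0 hL] := tangent_contracting hA.
have [C [beta [C0 b0 H]]] := core_estimate J (ltW L0) d0 (ltW E0).
exists C, beta; split => // z0 z xi tz hxi; have [ez hz Kz] := tz.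
apply: (H xi (fun t => jac X (z t) *m xi t) (fun t => `|J *m z t|)) => t t0.
- by split => //; exact: hE tz _ t0.
- by have [] := hL _ (xi t) (Kz t t0).
- by have [] := hL _ (xi t) (Kz t t0).
Qed.

(** By comparison with the equilibrium z - P z, the velocity is at most a multiple of |J z|, hence
    exponentially small. *)
Lemma orbit_lim z0 z : traj X K z0 z -> exists p : 'cV[R]_n, z @ +oo --> p.
Proof.
move=> tz; have [E E0 hE] := J_decay; have [L L0 hL] := flow_contracting hA.
have [ez hz Kz] := tz.
have LE0 : 0 <= L * E by rewrite mulr_ge0 // ltW.
have Xz t : 0 <= t -> `|X (z t)| <= L * E * expR (- delta * t).
  move=> t0; have Kt := Kz t t0.
  have Kq : K (z t - P *m z t).
    by have := att_box hA Kt (att_K0 hA); rewrite mulmx0 addr0.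
  have Jq : J *m (z t - P *m z t) = 0.
    by rewrite mulmxBr mulmxA (att_JP hA) subrr.
  have Xq : X (z t - P *m z t) = 0.
    apply: (att_eq hA); first exact: KW.
    by rewrite mulmxBr mulmxA (att_PP hA) subrr.
  have [h _] := hL _ _ Kq Kt; move: h; rewrite Jq normr0 mulr0 addr0 Xq subr0.
  rewrite opprB addrC subrK mulmxA (att_JP hA) => h.
  by apply: le_trans h _; rewrite -mulrA ler_pM2l //; exact: hE tz _ t0.
have [p hp] := exp_deriv_lim d0 LE0 hz Xz.
by exists p; exact: exp_close_cvg d0 hp.
Qed.

(** A choice, with default 0 where no convergent trajectory exists in [K]; uniqueness of
    trajectories makes the choice immaterial elsewhere. *)
Definition flow_lim (z0 : 'cV[R]_n) : 'cV[R]_n :=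
  xget 0 [set p | exists z, traj X K z0 z /\ z @ +oo --> p].

Lemma traj_unique z0 z z' : traj X K z0 z -> traj X K z0 z' ->
  forall t, 0 <= t -> z t = z' t.
Proof.
move=> tz tz' t t0; have [C [beta [C0 b0 H]]] := flow_estimate.
have [+ _] := H _ _ _ _ tz tz' t t0.
by rewrite subrr normr0 mulr0 normr_le0 subr_eq0 => /eqP.
Qed.

Lemma flow_limP z0 z : traj X K z0 z -> z @ +oo --> flow_lim z0.
Proof.
move=> tz; have [p hp] := orbit_lim tz.
rewrite /flow_lim; case: xgetP => [q _ [z' [tz' hq]]|/(_ p)[]]; last by exists z.
apply: cvg_trans hq; apply: near_eq_cvg; exists 0; split; first exact: num_real.
by move=> t /ltW t0; exact: traj_unique tz' tz t t0.
Qed.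

Lemma flow_lim_lipschitz : exists2 C : R, 0 < C & forall z z', Om z -> Om z' ->
  `|flow_lim z' - flow_lim z| <= C * `|z' - z|.
Proof.
have [C [beta [C0 b0 H]]] := flow_estimate; exists C => // z z' Oz Oz'.
have [y ty] := att_traj hA Oz; have [y' ty'] := att_traj hA Oz'.
have hc : (fun t => `|y' t - y t|) @ +oo --> `|flow_lim z' - flow_lim z|.
  by apply: cvg_norm; apply: cvgB; exact: flow_limP.
apply: (cvgr_to_le hc); exists 0; split; first exact: num_real.
by move=> t /ltW t0; have [] := H _ _ _ _ ty ty' t t0.
Qed.

(** On a bounded time interval [0, T] the error y - z - h xi of the first order expansion is O(h^2),
    with a constant growing exponentially in T. After T, what y - z and h xi still have to travel is
    h times an exponentially small quantity. Dividing by h, one fixes T and then lets h tend to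
    0. *)
Lemma flow_lim_derive z0 z (xi : R -> 'cV[R]_n) q : Om z0 -> traj X K z0 z ->
  (forall t : R, 0 <= t -> is_derive t (1 : R) xi (jac X (z t) *m xi t)) ->
  xi @ +oo --> q -> is_derive z0 (xi 0) flow_lim q.
Proof.
move=> Oz tz hxi cxi.
have [C1 [b1 [C10 b10 H1]]] := flow_estimate.
have [C2 [b2 [C20 b20 H2]]] := tangent_estimate.
have [L L0 hL] := second_order_bound oW (att_smooth hA 2) (att_compact hA) KW
  (att_convex hA).
have [B B0 hB] := jac_compact_bound (att_smooth hA 1%N) (att_compact hA) KW.
have [ez hz Kz] := tz.
set v := xi 0.
pose A1 := 2 * (C1 * `|v|) / b1; pose A2 := 2 * (C2 * `|v|) / b2.
have tail_xi t : 0 <= t -> `|xi t - q| <= A2 * expR (- b2 * t).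
  have [] := @exp_deriv_lim R n xi _ (C2 * `|v|) b2 b20 _ hxi.
  - by rewrite mulr_ge0 // ltW.
  - by move=> s s0; have [] := H2 _ _ _ tz hxi s s0.
  by move=> p hp; rewrite -(exp_close_unique b20 hp cxi); exact: hp.
pose c := L * (C1 * `|v|) ^+ 2.
have c0 : 0 <= c by rewrite mulr_ge0 ?sqr_ge0 // ltW.
(* Growth rate of the energy of the error [er]: 2 n B from the Jacobian and n from the quadratic
   remainder. *)
pose k := 2 * n%:R * B + n%:R.
have main h : Om (h *: v + z0) -> forall t, 0 <= t ->
  `|flow_lim (h *: v + z0) - flow_lim z0 - h *: q| <=
  c * h ^+ 2 * expR (k * t) + `|h| * (A1 * expR (- b1 * t) + A2 * expR (- b2 * t)).
  move=> Oh; have [y ty] := att_traj hA Oh; have [ey hy Ky] := ty.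
  have yz t : 0 <= t -> `|y t - z t| <= C1 * (`|h| * `|v|).
    by move=> t0; have [+ _] := H1 _ _ _ _ tz ty t t0; rewrite addrK normrZ.
  have tail_y t : 0 <= t -> `|(y t - z t) -
      (flow_lim (h *: v + z0) - flow_lim z0)| <= `|h| * (A1 * expR (- b1 * t)).
    have [] := @exp_deriv_lim R n (fun s => y s - z s)
      (fun s => X (y s) - X (z s)) (C1 * (`|h| * `|v|)) b1 b10.
    - by rewrite !mulr_ge0 // ltW.
    - by move=> s s0; apply: is_deriveB; [exact: hy|exact: hz].
    - move=> s s0; have [_] := H1 _ _ _ _ tz ty s s0.
      by rewrite addrK normrZ.
    move=> p hp.
    have -> : flow_lim (h *: v + z0) - flow_lim z0 = p.
      apply/esym; apply: (exp_close_unique b10 hp).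
      by apply: cvgB; exact: flow_limP.
    move=> /hp; rewrite (_ : 2 * _ / b1 = `|h| * A1) ?mulrA //.
    by rewrite /A1; field; exact: lt0r_neq0.
  pose er (s : R) := y s - z s - h *: xi s.
  pose rho := c * h ^+ 2.
  have rho0 : 0 <= rho by rewrite mulr_ge0 ?sqr_ge0.
  have der (s : R) : 0 <= s -> is_derive s (1 : R) er
      (X (y s) - X (z s) - h *: (jac X (z s) *m xi s)).
    move=> s0; apply: is_deriveB; last by apply: is_deriveZ; exact: hxi.
    by apply: is_deriveB; [exact: hy|exact: hz].
  have der_le s : 0 <= s -> `|X (y s) - X (z s) - h *: (jac X (z s) *m xi s)| <=
      B * `|er s| + rho.
    move=> s0.
    have -> : X (y s) - X (z s) - h *: (jac X (z s) *m xi s) =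
       jac X (z s) *m er s + (X (y s) - X (z s) - jac X (z s) *m (y s - z s)).
      rewrite /er mulmxBr scalemxAr.
      move: (jac X (z s) *m (y s - z s)) (jac X (z s) *m (h *: xi s)) => a b.
      by apply/matrixP => i j; rewrite !mxE; ring.
    apply: le_trans (ler_normD _ _) _; apply: lerD; first exact: hB (Kz s s0).
    apply: le_trans (hL _ _ (Kz s s0) (Ky s s0)) _.
    rewrite /rho /c -mulrA ler_pM2l // -(real_normK (num_real h)) -exprMn.
    rewrite ler_pXn2r ?nnegrE ?mulr_ge0 ?(ltW C10) //.
    by apply: le_trans (yz s s0) _; rewrite mulrA mulrAC.
  have er_le t : 0 <= t -> `|er t| <= rho * expR (k * t).
    move=> t0.
    (* Adding the constant rho^2 to the energy turns the inhomogeneous inequality into a homogeneous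
       one; as [er] vanishes at time 0, the initial value is rho^2. *)
    have := @gronwall R (fun s => inner (er s) (er s) + rho ^+ 2)
      (fun s => 2 * inner (er s) (X (y s) - X (z s) - h *: (jac X (z s) *m xi s)))
      (fun s => k * s) (fun=> k) t t0.
    have er0 : er 0 = 0 by rewrite /er ey ez addrK subrr.
    rewrite er0 inner0r add0r mulr0 subr0 => G.
    have {}G : inner (er t) (er t) + rho ^+ 2 <= rho ^+ 2 * expR (k * t).
      apply: G.
      - move=> s; rewrite in_itv /= => /andP[s0 _].
        have h1 := is_derive_inner (der s s0) (der s s0).
        have h2 := is_deriveD h1 (is_derive_cst (rho ^+ 2 : R) s (1 : R)).
        apply: is_derive_eq h2 _; rewrite (innerC (X (y s) - _ - _)); ring.
      - move=> s _; have -> : (fun s : R => k * s) = k \*: id by [].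
        by apply: is_derive_eq; rewrite /GRing.scale /= mulr1.
      - move=> s; rewrite in_itv /= => /andP[s0 _].
        set D := X (y s) - X (z s) - _.
        have e1 : inner (er s) D <= n%:R * (`|er s| * (B * `|er s| + rho)).
          apply: le_trans (ler_norm _) _; apply: le_trans (inner_le _ _) _.
          by rewrite ler_wpM2l // ler_wpM2l //; exact: der_le.
        have e2 := sqr_norm_le_inner (er s).
        have e3 : 2 * (`|er s| * rho) <= `|er s| ^+ 2 + rho ^+ 2.
          by rewrite -subr_ge0; have := sqr_ge0 (`|er s| - rho); nra.
        have n0 : 0 <= n%:R :> R by [].
        have nB : 0 <= 2 * n%:R * B :> R by rewrite !mulr_ge0 // ltW.
        have e4 := ler_wpM2l n0 e3; have e5 := ler_wpM2l nB e2.
        have e6 := ler_wpM2l n0 e2.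
        have e7 : 0 <= 2 * n%:R * B * rho ^+ 2 by rewrite mulr_ge0 ?sqr_ge0.
        rewrite /k; nra.
    have k0 : 0 <= k by rewrite addr_ge0 // !mulr_ge0 // ltW.
    have x1 : 1 <= expR (k * t) by rewrite -expR0 ler_expR mulr_ge0.
    have re0 : 0 <= rho * expR (k * t) by apply: mulr_ge0 => //; exact: expR_ge0.
    rewrite -(@ler_pXn2r _ 2) ?nnegrE //.
    apply: le_trans (sqr_norm_le_inner _) _.
    apply: le_trans (_ : rho ^+ 2 * expR (k * t) <= _).
      by apply: le_trans G; rewrite lerDl sqr_ge0.
    rewrite [leRHS]exprMn; apply: ler_wpM2l; first exact: sqr_ge0.
    rewrite [leRHS]expr2.
    by rewrite ler_pMr // expR_gt0.
  move=> t t0.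
  have -> : flow_lim (h *: v + z0) - flow_lim z0 - h *: q =
    er t + (- ((y t - z t) - (flow_lim (h *: v + z0) - flow_lim z0)) +
       h *: (xi t - q)).
    rewrite /er; move: (flow_lim _ - _) (y t) (z t) (xi t) => a b d e.
    by apply/matrixP => i j; rewrite !mxE; ring.
  apply: le_trans (ler_normD _ _) _; apply: lerD; first exact: er_le.
  apply: le_trans (ler_normD _ _) _; rewrite mulrDr; apply: lerD.
    by rewrite normrN; exact: tail_y.
  by rewrite normrZ; apply: ler_wpM2l => //; exact: tail_xi.
apply/is_derive_cvgP/cvgrPdist_le => e e0.
have e30 : 0 < e / 3 by rewrite divr_gt0.
have [T1 T10 hT1] := exp_small A1 b10 e30.
have [T2 T20 hT2] := exp_small A2 b20 e30.
(* The time is fixed before h is taken small: each tail contributes at most e / 3, and the remaining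
   third is a multiple, depending on T, of |h|. *)
pose T := Num.max T1 T2.
have T0 : 0 <= T by rewrite le_max T10.
have cT0 : 0 < c * expR (k * T) + 1.
  by rewrite ltr_wpDl // mulr_ge0 // expR_ge0.
have /nbhs_ballP[r /= r0 hr] := open_nbhs_nbhs (conj (att_openOm hA) Oz).
near=> h.
have h0 : h != 0 by near: h; exact: nbhs_dnbhs_neq.
have Oh : Om (h *: v + z0).
  apply: hr; rewrite -ball_normE /= opprD addrCA subrr addr0 normrN normrZ.
  apply: le_lt_trans (_ : `|h| * (`|v| + 1) < _); first by rewrite ler_wpM2l // lerDl.
  rewrite -ltr_pdivlMr ?ltr_wpDl //; near: h.
  by apply: dnbhs0_lt; rewrite divr_gt0 // ltr_wpDl.
have hT := main h Oh T T0.
rewrite distrC (_ : _ - q = h^-1 *: (flow_lim (h *: v + z0) - flow_lim z0 - h *: q)).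
  rewrite normrZ normfV ler_pdivrMl ?normr_gt0 //; apply: le_trans hT _.
  rewrite -(real_normK (num_real h)) expr2 [c * _]mulrCA -mulrA -mulrDr ler_pM2l ?normr_gt0 //.
  rewrite (_ : e = e / 3 + (e / 3 + e / 3)); last by field.
  apply: lerD; last first.
    by apply: lerD; [apply: hT1|apply: hT2]; rewrite le_max lexx ?orbT.
  apply: le_trans (_ : (c * expR (k * T) + 1) * `|h| <= _).
    by rewrite [leLHS]mulrAC ler_wpM2r // lerDl.
  rewrite -ler_pdivlMl //; near: h; apply: dnbhs0_le.
  by rewrite mulrC divr_gt0.
by rewrite [RHS]scalerBr scalerA mulVf // scale1r.
Unshelve. all: by end_near. Qed.

End FlowLimit.

(** * The tangent system and its Jacobian *)

Section TangentSystem.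
Context {R : realType}.

Definition tanX n (X : 'cV[R]_n -> 'cV[R]_n) (Z : 'cV[R]_(n + n)) :
    'cV[R]_(n + n) :=
  col_mx (X (usubmx Z)) (jac X (usubmx Z) *m dsubmx Z).

Definition tanP n (P : 'M[R]_n) : 'M[R]_(n + n) := block_mx P 0 0 P.

(** The weight [k] on the variational component will be taken small, so that the second derivatives
    of the field, which couple the first component into the second, are dominated. *)
Definition tanJ l n (k : R) (J : 'M[R]_(l, n)) : 'M[R]_(l + l, n + n) :=
  block_mx J 0 0 (k *: J).

Definition tanW n (W : set 'cV[R]_n) : set 'cV[R]_(n + n) :=
  [set Z | W (usubmx Z)].

(** The variational component is bounded separately along [P] and along its complement, so that fast
    components can be exchanged between two points of the set, as [att_box] demands. *)
Definition tanK n (P : 'M[R]_n) (K : set 'cV[R]_n) (r : R) :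
    set 'cV[R]_(n + n) :=
  [set Z | [/\ K (usubmx Z), `|P *m dsubmx Z| <= r &
               `|dsubmx Z - P *m dsubmx Z| <= r]].

(** The radius 2 leaves the coordinate vectors, of norm at most 1, inside an open set. *)
Definition tanOm n (Om : set 'cV[R]_n) : set 'cV[R]_(n + n) :=
  [set Z | Om (usubmx Z) /\ `|dsubmx Z| < 2].

Lemma tanP_col n (P : 'M[R]_n) (x y : 'cV[R]_n) :
  tanP P *m col_mx x y = col_mx (P *m x) (P *m y).
Proof. by rewrite /tanP mul_block_col !mul0mx addr0 add0r. Qed.

Lemma tanP_u n (P : 'M[R]_n) (Z : 'cV[R]_(n + n)) : usubmx (tanP P *m Z) = P *m usubmx Z.
Proof. by rewrite -{1}(vsubmxK Z) tanP_col col_mxKu. Qed.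

Lemma tanP_d n (P : 'M[R]_n) (Z : 'cV[R]_(n + n)) : dsubmx (tanP P *m Z) = P *m dsubmx Z.
Proof. by rewrite -{1}(vsubmxK Z) tanP_col col_mxKd. Qed.

Lemma tanJ_col l n k (J : 'M[R]_(l, n)) (x y : 'cV[R]_n) :
  tanJ k J *m col_mx x y = col_mx (J *m x) (k *: (J *m y)).
Proof. by rewrite /tanJ mul_block_col !mul0mx addr0 add0r -scalemxAl. Qed.

Lemma Ckv_usubmx m n k (W : set 'cV[R]_(m + n)) : open W ->
  Ckv k W (@usubmx R m n 1).
Proof.
move=> oW i; apply: (eq_Ck oW _ (Ck_coord k W (lshift n i))) => x _.
by rewrite mxE.
Qed.

Lemma Ckv_dsubmx m n k (W : set 'cV[R]_(m + n)) : open W ->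
  Ckv k W (@dsubmx R m n 1).
Proof.
move=> oW i; apply: (eq_Ck oW _ (Ck_coord k W (rshift m i))) => x _.
by rewrite mxE.
Qed.

Lemma Ckv_comp p m n k (U : set 'cV[R]_p) (W : set 'cV[R]_m)
    (f : 'cV[R]_m -> 'cV[R]_n) (g : 'cV[R]_p -> 'cV[R]_m) :
  open U -> open W -> (forall x, U x -> W (g x)) -> Ckv k W f -> Ckv k U g ->
  Ckv k U (fun x => f (g x)).
Proof. by move=> oU oW gW hf hg i; apply: Ck_comp (hf i) hg. Qed.

Lemma Ckv_col_mx p m n k (U : set 'cV[R]_p)
    (f : 'cV[R]_p -> 'cV[R]_m) (g : 'cV[R]_p -> 'cV[R]_n) : open U ->
  Ckv k U f -> Ckv k U g -> Ckv k U (fun x => col_mx (f x) (g x)).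
Proof.
move=> oU hf hg i; rewrite -(splitK i); case: (fintype.split i) => j /=.
  by apply: (eq_Ck oU _ (hf j)) => x _; rewrite col_mxEu.
by apply: (eq_Ck oU _ (hg j)) => x _; rewrite col_mxEd.
Qed.

Lemma Ckv_jac_mul p n m k (U : set 'cV[R]_p) (W : set 'cV[R]_n)
    (X : 'cV[R]_n -> 'cV[R]_m) (f g : 'cV[R]_p -> 'cV[R]_n) :
  open U -> open W -> (forall x, U x -> W (f x)) ->
  Ckv k.+1 W X -> Ckv k U f -> Ckv k U g ->
  Ckv k U (fun x => jac X (f x) *m g x).
Proof.
move=> oU oW fW hX hf hg i.
have h j : Ck k U (fun x => partial j (fun y => X y i ord0) (f x) * g x j ord0).
  apply: Ck_mul => //.
  by apply: (@Ck_comp _ _ _ _ _ W (partial j (fun y => X y i ord0)) f) => //;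
    exact: Ck_partial.
apply: (eq_Ck oU _ (Ck_sum (index_enum _) oU h)) => x _.
by rewrite mxE; apply: eq_bigr => j _; rewrite mxE.
Qed.

Lemma tanW_open n (W : set 'cV[R]_n) : open W -> open (tanW W).
Proof. by move=> oW; apply: (open_preim (@usubmx_continuous R n n)). Qed.

Lemma tanX_smooth n k (W : set 'cV[R]_n) (X : 'cV[R]_n -> 'cV[R]_n) :
  open W -> Ckv k.+1 W X -> Ckv k (tanW W) (tanX X).
Proof.
move=> oW hX; have oT := tanW_open oW; have hu := Ckv_usubmx k oT.
apply: Ckv_col_mx => //.
  apply: (@Ckv_comp _ _ _ _ _ W X) => // i.
  exact: CkS.
by apply: (@Ckv_jac_mul _ _ _ _ _ W) => //; exact: Ckv_dsubmx.
Qed.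

(** The derivative of the Jacobian matrix at [z] in the direction [v]. *)
Definition hess n (X : 'cV[R]_n -> 'cV[R]_n) (z v : 'cV[R]_n) : 'M[R]_n :=
  \matrix_(i, j) \sum_k v k ord0 *
     partial k (partial j (fun x => X x i ord0)) z.

Lemma is_derive_mulmx_fun m n (M : R -> 'M[R]_(m, n)) (y : R -> 'cV[R]_n)
    (s : R) (dM : 'M[R]_(m, n)) (dy : 'cV[R]_n) :
  (forall i j, is_derive s (1 : R) (fun t => M t i j) (dM i j)) ->
  is_derive s (1 : R) y dy ->
  is_derive s (1 : R) (fun t => M t *m y t) (dM *m y s + M s *m dy).
Proof.
move=> hM /is_derive_cVP hy; apply/is_derive_cVP => i.
have -> : (fun t => (M t *m y t) i ord0) =
    \sum_j ((fun t => M t i j) * (fun t => y t j ord0)).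
  by apply/funext => t; rewrite fct_sumE mxE.
apply: is_derive_eq; rewrite !mxE -big_split /=; apply: eq_bigr => j _.
by rewrite /GRing.scale /=; ring.
Qed.

(** Both sides are the derivative at s = 0 of the tangent field along the segment of direction (v,
    nu); uniqueness of the derivative replaces an entrywise computation. *)
Lemma jac_tanX n (W : set 'cV[R]_n) (X : 'cV[R]_n -> 'cV[R]_n)
    (z zeta v nu : 'cV[R]_n) :
  open W -> Ckv 2 W X -> W z ->
  jac (tanX X) (col_mx z zeta) *m col_mx v nu =
  col_mx (jac X z *m v) (hess X z v *m zeta + jac X z *m nu).
Proof.
move=> oW X2 Wz.
have X1 : Ckv 1 W X by move=> i; exact: CkS (X2 i).
have h1 : is_derive (0 : R) (1 : R) (fun s => tanX X (col_mx z zeta + s *: col_mx v nu))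
    (jac (tanX X) (col_mx z zeta) *m col_mx v nu).
  have := @C1_comp_segment R _ _ (tanW W) (tanX X) (col_mx z zeta)
    (col_mx v nu) 0 (tanW_open oW) (tanX_smooth oW X2).
  rewrite scale0r addr0; apply.
  by rewrite /tanW /= col_mxKu.
have E : (fun s : R => tanX X (col_mx z zeta + s *: col_mx v nu)) =
   (fun s => col_mx (X (z + s *: v)) (jac X (z + s *: v) *m (zeta + s *: nu))).
  apply/funext => s; rewrite /tanX scale_col_mx add_col_mx col_mxKu col_mxKd //.
rewrite E in h1.
have hX : is_derive (0 : R) (1 : R) (fun s => X (z + s *: v)) (jac X z *m v).
  have := @C1_comp_segment R _ _ W X z v 0 oW X1.
  by rewrite scale0r addr0; apply.
have hJ : is_derive (0 : R) (1 : R)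
    (fun s => jac X (z + s *: v) *m (zeta + s *: nu))
    (hess X z v *m zeta + jac X z *m nu).
  have := @is_derive_mulmx_fun n n (fun s => jac X (z + s *: v))
    (fun s => zeta + s *: nu) 0 (hess X z v) nu.
  rewrite !scale0r !addr0; apply; last exact: is_derive_segment.
  move=> i j; rewrite mxE.
  have hp := Ck_partial j (X2 i).
  have hs := is_derive_segment z v 0.
  have := @is_derive_C1_comp R R n W (partial j (fun x => X x i ord0))
    (fun s : R => z + s *: v) 0 1 v oW hp.
  rewrite scale0r addr0 => /(_ Wz hs).
  by under [X in _ -> is_derive _ _ X _]eq_fun do rewrite mxE.
have h2 : is_derive (0 : R) (1 : R)
   (fun s => col_mx (X (z + s *: v)) (jac X (z + s *: v) *m (zeta + s *: nu)))
   (col_mx (jac X z *m v) (hess X z v *m zeta + jac X z *m nu)).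
  apply/is_derive_cVP => i; rewrite -(splitK i).
  move/is_derive_cVP : hX => hX; move/is_derive_cVP : hJ => hJ.
  case: (fintype.split i) => j /=.
    rewrite col_mxEu (_ : (fun s => _) = (fun s => X (z + s *: v) j ord0)) //.
    by apply/funext => s; rewrite col_mxEu.
  rewrite col_mxEd (_ : (fun s => _) = (fun s => (jac X (z + s *: v) *m
    (zeta + s *: nu)) j ord0)) //.
  by apply/funext => s; rewrite col_mxEd.
by case: h1 => _ <-; case: h2 => _ <-.
Qed.

Lemma hess_bound n (W K : set 'cV[R]_n) (X : 'cV[R]_n -> 'cV[R]_n) :
  Ckv 2 W X -> compact K -> K `<=` W ->
  exists2 B : R, 0 < B & forall z (v zeta : 'cV[R]_n), K z ->
    `|hess X z v *m zeta| <= B * `|v| * `|zeta|.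
Proof.
move=> X2 cK KW.
have [] := @finite_bound R n (fun i B => forall j k x, K x ->
   `|partial k (partial j (fun x => X x i ord0)) x| <= B).
- by move=> i a b ab h j k x /(h j k) /le_trans; apply.
- move=> i; have [] := @finite_bound R n (fun j B => forall k x, K x ->
    `|partial k (partial j (fun x => X x i ord0)) x| <= B).
  + by move=> j a b ab h k x /(h k) /le_trans; apply.
  + move=> j; have [] := @finite_bound R n (fun k B => forall x, K x ->
      `|partial k (partial j (fun x => X x i ord0)) x| <= B).
    * by move=> k a b ab h x /h /le_trans; apply.
    * move=> k; apply: (continuous_compact_bound (k := 0) (W := W)) => //.
      by do 2 apply: Ck_partial; exact: X2.
    by move=> B B0 hB; exists B.
  by move=> B B0 hB; exists B.
move=> B B0 hB; exists (n%:R * n%:R * B + 1).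
  by rewrite ltr_wpDl // !mulr_ge0 // ltW.
move=> z v zeta Kz.
apply: le_trans (_ : n%:R * (n%:R * (`|v| * B)) * `|zeta| <= _); last first.
  apply: ler_wpM2r => //.
  have -> : n%:R * (n%:R * (`|v| * B)) = n%:R * n%:R * B * `|v| by ring.
  by apply: ler_wpM2r => //; rewrite lerDl.
apply: le_trans (mulmx_norm_le _ _) _; apply: ler_wpM2r => //.
apply: ler_wpM2l => //; apply: mx_norm_le => [|i j].
  by rewrite !mulr_ge0 // ltW.
rewrite mxE; apply: ler_norm_sum_const => k; rewrite normrM.
by apply: ler_pM => //; [exact: mx_coord_le|exact: hB].
Qed.

End TangentSystem.

(** * The tangent system of an attracting system is attracting *)

Section TangentAttracting.
Context {R : realType}.

Lemma norm_convex (V : normedModType R) (a b : V) (t r : R) :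
  0 <= t -> t <= 1 -> `|a| <= r -> `|b| <= r -> `|a + t *: (b - a)| <= r.
Proof.
move=> t0 t1 ha hb.
have -> : a + t *: (b - a) = (1 - t) *: a + t *: b.
  by rewrite scalerBr scalerBl scale1r -addrA [t *: b - _]addrC.
apply: le_trans (ler_normD _ _) _; rewrite !normrZ.
rewrite (ger0_norm t0) ger0_norm ?subr_ge0 //.
have -> : r = (1 - t) * r + t * r by ring.
by apply: lerD; apply: ler_wpM2l => //; rewrite subr_ge0.
Qed.

(** The equation is linear with coefficients bounded on [K], hence globally Lipschitz. Time is
    frozen before 0 because the orbit is known to lie in [K] only afterwards. *)
Lemma variational_solution n l (X : 'cV[R]_n -> 'cV[R]_n) (P : 'M[R]_n)
    (J : 'M[R]_(l, n)) (W K Om : set 'cV[R]_n) (delta : R) z0 z (zeta : 'cV[R]_n) :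
  attracting X P J W K Om delta -> traj X K z0 z ->
  exists xi : R -> 'cV[R]_n, xi 0 = zeta /\
    forall t : R, 0 <= t -> is_derive t (1 : R) xi (jac X (z t) *m xi t).
Proof.
move=> hA [ez hz Kz].
have oW := att_openW hA; have KW := att_KW hA.
have [B B0 hB] := jac_compact_bound (att_smooth hA 1%N) (att_compact hA) KW.
pose F t (x : 'cV[R]_n) := jac X (z (Num.max t 0)) *m x.
have m0 (t : R) : 0 <= Num.max t 0 by rewrite le_max lexx orbT.
have Fc y : continuous y -> continuous (fun t => F t (y t)).
  move=> cy t; apply: continuous_at_cV => i.
  have -> : (fun s => F s (y s) i ord0) =
    (fun s => \sum_j jac X (z (Num.max s 0)) i j * y s j ord0).
    by apply/funext => s; rewrite mxE.
  apply: cvg_sum_ord => j; apply: cvgM; last exact: (@continuous_cV_coord _ _ y j cy).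
  have -> : (fun s => jac X (z (Num.max s 0)) i j) =
     (partial j (fun x => X x i ord0) \o z) \o (fun s => Num.max s 0).
    by apply/funext => s; rewrite /= mxE.
  rewrite (_ : jac X _ i j = ((partial j (fun x => X x i ord0) \o z) \o
    (fun s => Num.max s 0)) t); last by rewrite /= mxE.
  apply: continuous_comp.
    by apply: continuous_max; [exact: cvg_id|exact: cvg_cst].
  apply: continuous_comp; first exact: is_derive_cont (hz _ (m0 t)).
  apply: Ck_cont (Ck_partial j (att_smooth hA 1%N i)) _.
  by apply: KW; exact: Kz.
have [] := @picard_global R n F (B + 1) (B * `|zeta|) zeta Fc.
- by rewrite lerDr ltW.
- move=> t x y t0; rewrite -mulmxBr; apply: le_trans (hB _ _ (Kz _ (m0 t))) _.
  by rewrite ler_wpM2r // lerDl.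
- by move=> t t0; exact: hB (Kz _ (m0 t)).
move=> xi [e0 hxi]; exists xi; split => // t t0.
by have := hxi t t0; rewrite /F max_l.
Qed.

Variables (n l : nat) (X : 'cV[R]_n -> 'cV[R]_n) (P : 'M[R]_n)
  (J : 'M[R]_(l, n)) (W K Om : set 'cV[R]_n) (delta : R).
Hypothesis hA : attracting X P J W K Om delta.

Lemma tangent_traj z0 z zeta xi r : traj X K z0 z -> xi 0 = zeta ->
  (forall t : R, 0 <= t -> is_derive t (1 : R) xi (jac X (z t) *m xi t)) ->
  (forall t, 0 <= t -> `|P *m xi t| <= r /\ `|xi t - P *m xi t| <= r) ->
  traj (tanX X) (tanK P K r) (col_mx z0 zeta) (fun t => col_mx (z t) (xi t)).
Proof.
move=> [ez hz Kz] e0 hxi hr; split.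
- by rewrite ez e0.
- move=> t t0; rewrite /tanX col_mxKu col_mxKd; apply/is_derive_cVP => i.
  have /is_derive_cVP h1 := hz t t0; have /is_derive_cVP h2 := hxi t t0.
  rewrite -(splitK i); case: (fintype.split i) => j /=.
    rewrite col_mxEu (_ : (fun s => _) = (fun s => z s j ord0)) //.
    by apply/funext => s; rewrite col_mxEu.
  rewrite col_mxEd (_ : (fun s => _) = (fun s => xi s j ord0)) //.
  by apply/funext => s; rewrite col_mxEd.
- by move=> t t0; rewrite /tanK /= col_mxKu col_mxKd; have [] := hr t t0;
    split => //; exact: Kz.
Qed.

Lemma tanK_compact r : compact (tanK P K r).
Proof.
have [B B0 hB] := att_bounded hA.
apply: (@closed_bounded_compact_cV _ _ _ (B + 2 * `|r|)).
  move=> Z [/hB h1 h2 h3]; rewrite -(vsubmxK Z).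
  have h4 : `|dsubmx Z| <= 2 * `|r|.
    have -> : dsubmx Z = P *m dsubmx Z + (dsubmx Z - P *m dsubmx Z).
      by rewrite subrKC.
    apply: le_trans (ler_normD _ _) _.
    by have := ler_norm r; lra.
  apply: norm_col_mx_le; first by apply: le_trans h1 _; rewrite lerDl mulr_ge0.
  by apply: le_trans h4 _; rewrite lerDr ltW.
have -> : tanK P K r = (@usubmx R n n 1) @^-1` K `&`
   ([set Z | `|P *m dsubmx Z| <= r] `&` [set Z | `|dsubmx Z - P *m dsubmx Z| <= r]).
  by rewrite eqEsubset; split => Z; [case|case=> ? []].
have cd := @dsubmx_continuous R n n.
have cP : continuous (fun Z : 'cV[R]_(n + n) => P *m dsubmx Z).
  move=> Z; apply: (@continuous_comp _ _ _ (@dsubmx R n n 1) (fun x => P *m x)).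
    exact: cd.
  exact: mulmx_continuous.
apply: closedI; last apply: closedI.
- apply: closed_preim; first exact: usubmx_continuous.
  by apply: compact_closed; [exact: norm_hausdorff|exact: att_compact hA].
- exact: closed_norm_le.
- apply: closed_norm_le => Z.
  by apply: continuousB; [exact: cd|exact: cP].
Qed.

(** Solutions of the variational equation are bounded for all times by [tangent_estimate], which
    provides the invariant compact set. The rate drops to delta / 2, half of the dissipation being
    spent on the second derivatives of the field. *)
Lemma tangent_attracting : exists k r delta', attracting (tanX X) (tanP P)
  (tanJ k J) (tanW W) (tanK P K r) (tanOm Om) delta'.
Proof.
have oW := att_openW hA; have KW := att_KW hA.
have [C [beta [C0 b0 hC]]] := tangent_estimate hA.
have [p p0 hp] := mulmx_bound P; have [j j0 hj] := mulmx_bound J.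
have [c c0 hc] := att_PJ hA.
have [B B0 hB] := hess_bound (att_smooth hA 2) (att_compact hA) KW.
have C10 : 0 < C + 1 by rewrite addr_gt0.
(* Bounds P xi and xi - P xi when |xi| <= 2 (C + 1), where C is the growth constant of the
   variational equation and 2 the radius in [tanOm]. *)
pose r := (1 + p) * ((C + 1) * 2).
have r0 : 0 < r by rewrite /r mulr_gt0 ?addr_gt0 // mulr_gt0.
have zbound (x : 'cV[R]_n) : `|x| <= (C + 1) * 2 -> `|P *m x| <= r /\ `|x - P *m x| <= r.
  move=> hx; have hPx : `|P *m x| <= p * ((C + 1) * 2).
    by apply: le_trans (hp _) _; rewrite ler_pM2l.
  split; rewrite /r mulrDl mul1r.
    by apply: le_trans hPx _; rewrite lerDr mulr_ge0 // ltW.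
  by apply: le_trans (ler_normB _ _) _; apply: lerD.
clearbody r.
have j0' := ltW j0; have B0' := ltW B0; have c0' := ltW c0; have r0' := ltW r0.
pose M := l%:R * (j * (B * c * (2 * r))) + 1.
have M0 : 0 < M by rewrite ltr_wpDl // !mulr_ge0.
(* With k M = delta the coupling k^2 M |J nu| |J v| equals delta (k |J nu|) |J v|, at most half of
   delta (|J v|^2 + k^2 |J nu|^2). *)
pose k := delta / M.
have d0 := att_delta hA.
have k0 : 0 < k by rewrite divr_gt0.
exists k, r, (delta / 2); split.
- exact: tanW_open.
- by move=> Z [/KW].
- exact: tanK_compact.
- move=> x y t [x1 x2 x3] [y1 y2 y3] t0 t1; split.
  + rewrite (_ : usubmx _ = usubmx x + t *: (usubmx y - usubmx x)).
      exact: (att_convex hA).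
    by apply/matrixP => i q; rewrite !mxE.
  + rewrite (_ : P *m _ = P *m dsubmx x + t *: (P *m dsubmx y - P *m dsubmx x)).
      exact: norm_convex.
    by rewrite -mulmxBr scalemxAr -mulmxDr; congr (_ *m _);
       apply/matrixP => i q; rewrite !mxE.
  + set a := dsubmx x; set b := dsubmx y.
    have -> : dsubmx (x + t *: (y - x)) = a + t *: (b - a).
      by apply/matrixP => i q; rewrite !mxE.
    rewrite (_ : _ - _ = (a - P *m a) + t *: ((b - P *m b) - (a - P *m a))).
      exact: norm_convex.
    rewrite mulmxDr -scalemxAr mulmxBr; move: (P *m a) (P *m b) => Pa Pb.
    by apply/matrixP => i q; rewrite !mxE; ring.
- have [z1 z2] : `|P *m (0 : 'cV[R]_n)| <= r /\ `|0 - P *m (0 : 'cV[R]_n)| <= r.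
    by apply: zbound; rewrite normr0 mulr_ge0 // ltW.
  have e1 : usubmx (0 : 'cV[R]_(n + n)) = 0 by exact: linear0.
  have e2 : dsubmx (0 : 'cV[R]_(n + n)) = 0 by exact: linear0.
  by split; rewrite ?e1 ?e2 //; exact: (att_K0 hA).
- move=> x y [x1 x2 x3] [y1 y2 y3].
  have eu : usubmx (x - tanP P *m x + tanP P *m y) =
      usubmx x - P *m usubmx x + P *m usubmx y.
    by rewrite -!tanP_u; apply/matrixP => i q; rewrite !mxE.
  have ed : dsubmx (x - tanP P *m x + tanP P *m y) =
      dsubmx x - P *m dsubmx x + P *m dsubmx y.
    by rewrite -!tanP_d; apply/matrixP => i q; rewrite !mxE.
  have ePd : P *m (dsubmx x - P *m dsubmx x + P *m dsubmx y) = P *m dsubmx y.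
    by rewrite mulmxDr mulmxBr !mulmxA (att_PP hA) subrr add0r.
  split; rewrite ?eu ?ed ?ePd //; first exact: (att_box hA).
  by rewrite addrK.
- by move=> q; apply: tanX_smooth => //; exact: (att_smooth hA).
- by rewrite /tanP mulmx_block !mulmx0 !mul0mx !addr0 !add0r (att_PP hA).
- rewrite /tanP /tanJ mulmx_block !mulmx0 !mul0mx !addr0 !add0r.
  by rewrite -scalemxAl (att_JP hA).
- exists (c * (1 + k^-1)); first by rewrite mulr_gt0 // ltr_wpDr // invr_ge0 ltW.
  move=> x; rewrite -(vsubmxK x) tanP_col tanJ_col.
  set a := usubmx x; set b := dsubmx x; set N := `|col_mx _ (k *: _)|.
  have n1 : `|J *m a| <= N.
    by have := norm_usubmx_le (col_mx (J *m a) (k *: (J *m b))); rewrite col_mxKu.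
  have n2 : k * `|J *m b| <= N.
    have := norm_dsubmx_le (col_mx (J *m a) (k *: (J *m b))).
    by rewrite col_mxKd normrZ gtr0_norm.
  have N0 : 0 <= N by exact: normr_ge0.
  apply: norm_col_mx_le.
    apply: le_trans (hc _) _; rewrite -mulrA ler_pM2l // mulrDl mul1r.
    by apply: le_trans n1 _; rewrite lerDl mulr_ge0 // invr_ge0 ltW.
  apply: le_trans (hc _) _; rewrite -mulrA ler_pM2l // mulrDl mul1r.
  by rewrite -ler_pdivlMl // in n2; apply: le_trans n2 _; rewrite lerDr.
- move=> Z Wz Pz.
  have e1 : P *m usubmx Z = 0 by rewrite -tanP_u Pz linear0.
  have e2 : P *m dsubmx Z = 0 by rewrite -tanP_d Pz linear0.
  rewrite /tanX (att_eq hA Wz e1) (jac_tangent_eq hA Wz e1 e2).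
  by rewrite -[RHS](vsubmxK 0) !linear0.
- by rewrite divr_gt0.
- move=> Z V [Kz z2 z3].
  rewrite -(vsubmxK V) -{1}(vsubmxK Z) tanP_col.
  set z := usubmx Z; set zeta := dsubmx Z; set v := usubmx V; set nu := dsubmx V.
  rewrite (jac_tanX zeta (P *m v) (P *m nu) oW (att_smooth hA 2) (KW _ Kz)).
  rewrite !tanJ_col !inner_col_mx.
  rewrite mulmxDr scalerDr innerDr !innerZl !innerZr.
  have h1 := att_diss hA v Kz; have h2 := att_diss hA nu Kz.
  set a := inner (J *m v) (J *m v) in h1 *.
  set b := inner (J *m nu) (J *m nu) in h2 *.
  have zeta_le : `|zeta| <= 2 * r.
    have -> : zeta = P *m zeta + (zeta - P *m zeta) by rewrite subrKC.
    by apply: le_trans (ler_normD _ _) _; lra.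
  have h3 : inner (J *m nu) (J *m (hess X z (P *m v) *m zeta)) <=
      M * (`|J *m nu| * `|J *m v|).
    apply: le_trans (ler_norm _) _; apply: le_trans (inner_le _ _) _.
    have h4 : `|J *m (hess X z (P *m v) *m zeta)| <= j * (B * (c * `|J *m v|) * (2 * r)).
      apply: le_trans (hj _) _; rewrite ler_pM2l //.
      apply: le_trans (hB _ _ _ Kz) _.
      apply: ler_pM => //; first by rewrite mulr_ge0 // ltW.
      by rewrite ler_pM2l.
    apply: le_trans (_ : l%:R * (`|J *m nu| * (j * (B * (c * `|J *m v|) * (2 * r)))) <= _).
      by rewrite ler_wpM2l // ler_wpM2l.
    rewrite [leLHS](_ : _ = l%:R * (j * (B * c * (2 * r))) * (`|J *m nu| * `|J *m v|)); last by ring.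
    by apply: ler_wpM2r; rewrite ?mulr_ge0 // lerDl.
  have sa := sqr_norm_le_inner (J *m v); have sb := sqr_norm_le_inner (J *m nu).
  rewrite -/a -/b in sa sb.
  have h5 : k * M = delta by rewrite /k divfK // lt0r_neq0.
  have h6 : 2 * (k * `|J *m nu| * `|J *m v|) <= k ^+ 2 * b + a.
    have := sqr_ge0 (k * `|J *m nu| - `|J *m v|).
    have := ler_wpM2l (sqr_ge0 k) sb; nra.
  have k20 : 0 <= k ^+ 2 by exact: sqr_ge0.
  have h7 := ler_wpM2l k20 h2; have h8 := ler_wpM2l k20 h3.
  have h9 : k ^+ 2 * (M * (`|J *m nu| * `|J *m v|)) =
    delta * (k * `|J *m nu| * `|J *m v|) by rewrite -h5; ring.
  have h10 := ler_wpM2l (ltW d0) h6.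
  rewrite h9 in h8; lra.
- have -> : tanOm Om = (@usubmx R n n 1) @^-1` Om `&` [set Z | `|dsubmx Z| < 2].
    by rewrite eqEsubset; split.
  apply: openI; last by apply: open_norm_lt; exact: dsubmx_continuous.
  apply: open_preim; first exact: usubmx_continuous.
  exact: (att_openOm hA).
- move=> Z [h1 h2]; have [|h3 h4] := zbound (dsubmx Z).
    by apply: le_trans (ltW h2) _; rewrite mulrDl mul1r lerDr mulr_ge0 // ltW.
  by split => //; exact: (att_OmK hA).
- move=> Z0 [h1 h2]; have [z tz] := att_traj hA h1.
  have [xi [e0 hxi]] := variational_solution (dsubmx Z0) hA tz.
  exists (fun t => col_mx (z t) (xi t)); rewrite -{1}(vsubmxK Z0).
  apply: (tangent_traj tz e0 hxi) => t t0; apply: zbound.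
  have [hh _] := hC _ _ _ tz hxi t t0; apply: le_trans hh _.
  rewrite e0; apply: ler_pM; rewrite ?(ltW C0) ?(ltW h2) //.
  by rewrite lerDl.
Qed.

End TangentAttracting.

(** * Smoothness of the limit map *)

Section FlowLimitSmooth.
Context {R : realType}.

Lemma lipschitz_at (V V' : normedModType R) (U : set V) (f : V -> V') (L : R) z :
  open U -> U z -> 0 < L -> (forall y, U y -> `|f z - f y| <= L * `|z - y|) ->
  {for z, continuous f}.
Proof.
move=> oU Uz L0 h; apply/cvgrPdist_le => e e0; near=> y.
have Uy : U y by near: y; exact: open_nbhs_nbhs (conj oU Uz).
apply: le_trans (h _ Uy) _; rewrite -ler_pdivlMl // mulrC.
by near: y; apply: cvgr_dist_le; [exact: cvg_id|rewrite divr_gt0].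
Unshelve. all: by end_near. Qed.

(* Partial derivatives of the limit map are limits of trajectories of the
   tangent system, which is again attracting; hence the induction on [k]. *)
Lemma flow_lim_smooth k n l (X : 'cV[R]_n -> 'cV[R]_n) (P : 'M[R]_n)
    (J : 'M[R]_(l, n)) (W K Om : set 'cV[R]_n) (delta : R) :
  attracting X P J W K Om delta -> Ckv k Om (flow_lim X K).
Proof.
have cont m p (Y : 'cV[R]_m -> 'cV[R]_m) Q (G : 'M[R]_(p, m)) V L U eps a z :
    attracting Y Q G V L U eps -> U z ->
    {for z, continuous (fun x => flow_lim Y L x a ord0)}.
  move=> hY Uz; have [C C0 hC] := flow_lim_lipschitz hY.
  apply: (lipschitz_at (att_openOm hY) Uz C0) => y Uy.
  have := mx_coord_le (flow_lim Y L z - flow_lim Y L y) a ord0.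
  by rewrite !mxE => /le_trans; apply; exact: hC.
elim: k n l X P J W K Om delta => [|k IH] n l X P J W K Om delta hA a.
  by split => // z Oz; exact: cont hA Oz.
have [q [r [delta' hT]]] := tangent_attracting hA.
(* The lower half of this tangent limit turns out to be the i-th partial derivative at z. *)
pose D i z := flow_lim (tanX X) (tanK P K r) (col_mx z (delta_mx i ord0)).
have e2 i : `|delta_mx i ord0 : 'cV[R]_n| < 2.
  apply: (@le_lt_trans _ _ 1); last by rewrite ltr1n.
  by apply: cV_norm_le => // j; rewrite !mxE; case: (_ && _); rewrite ?normr1 ?normr0.
have DP i z : Om z -> is_derive z (delta_mx i ord0) (flow_lim X K) (dsubmx (D i z)).
  move=> Oz; have Tz : tanOm Om (col_mx z (delta_mx i ord0)).
    by split; rewrite ?col_mxKu ?col_mxKd.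
  have [Z tZ] := att_traj hT Tz; have [eZ hZ KZ] := tZ.
  pose y t := usubmx (Z t); pose xi t := dsubmx (Z t).
  have ty : traj X K z y.
    split; first by rewrite /y eZ col_mxKu.
    - move=> t t0; apply/is_derive_cVP => j.
      have /is_derive_cVP /(_ (lshift n j)) := hZ t t0.
      rewrite /tanX col_mxEu (_ : (fun s => Z s _ _) = (fun s => y s j ord0)) //.
      by apply/funext => s; rewrite /y mxE.
    - by move=> t /KZ [].
  have hxi (t : R) : 0 <= t -> is_derive t (1 : R) xi (jac X (y t) *m xi t).
    move=> t0; apply/is_derive_cVP => j.
    have /is_derive_cVP /(_ (rshift n j)) := hZ t t0.
    rewrite /tanX col_mxEd (_ : (fun s => Z s _ _) = (fun s => xi s j ord0)) //.
    by apply/funext => s; rewrite /xi mxE.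
  have cxi : xi @ +oo --> dsubmx (D i z).
    have := flow_limP hT tZ; rewrite -/(D i z) => hc.
    exact: (cvg_comp _ _ hc (@dsubmx_continuous R n n (D i z))).
  have := flow_lim_derive hA Oz ty hxi cxi.
  by rewrite /xi eZ col_mxKd.
have dd i z : Om z -> is_derive z (delta_mx i ord0)
    (fun x => flow_lim X K x a ord0) (dsubmx (D i z) a ord0).
  move=> Oz; have [d1 e1] := DP i z Oz.
  split; first exact: ((derivable_mxP _ _ _).1 d1 a ord0).
  by rewrite -e1 derive_mx // mxE.
have oOm := att_openOm hA.
apply: (CkSP _ dd) => [z Oz|i]; first exact: cont hA Oz.
have hD : Ckv k Om (D i).
  apply: (@Ckv_comp R n (n + n) (n + n) k Om (tanOm Om)
    (flow_lim (tanX X) (tanK P K r)) (fun z => col_mx z (delta_mx i ord0))) => //.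
  - exact: att_openOm hT.
  - by move=> z Oz; split; rewrite ?col_mxKu ?col_mxKd.
  - exact: IH hT.
  - apply: Ckv_col_mx => // j; [exact: Ck_coord|exact: Ck_cst].
apply: (eq_Ck oOm _ (hD (rshift n a))) => z Oz.
by have [_ e] := dd i z Oz; rewrite /partial e mxE.
Qed.

End FlowLimitSmooth.

(** * The linear part *)

Section CharPoly.

Lemma char_poly_conj (F : fieldType) n (P A : 'M[F]_n) : P \in unitmx ->
  char_poly (P *m A *m invmx P) = char_poly A.
Proof.
move=> Pu; rewrite /char_poly.
have -> : char_poly_mx (P *m A *m invmx P) =
    map_mx polyC P *m char_poly_mx A *m map_mx polyC (invmx P).
  rewrite /char_poly_mx mulmxBr mulmxBl -!map_mxM; congr (_ - _).
  by rewrite mul_mx_scalar -scalemxAl -map_mxM mulmxV // map_mx1 scalemx1.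
rewrite !det_mulmx mulrAC -det_mulmx -map_mxM mulmxV // map_mx1 det1 mul1r //.
Qed.

Lemma char_poly_lblock0 (F : fieldType) n (c : 'cV[F]_n) (B : 'M[F]_n) :
  char_poly (block_mx (0 : 'M[F]_1) 0 c B) = 'X * char_poly B.
Proof.
rewrite /char_poly.
have -> : char_poly_mx (block_mx (0 : 'M[F]_1) 0 c B) =
    block_mx ('X%:M) 0 (- map_mx polyC c) (char_poly_mx B).
  rewrite /char_poly_mx (map_block_mx polyC) scalar_mx_block opp_block_mx add_block_mx.
  by rewrite !map_mx0 !subr0 add0r.
by rewrite det_lblock det_scalar1.
Qed.

End CharPoly.

(** * Real and imaginary parts of a complex triangularization *)

Section ComplexParts.
Context {R : realType}.
Implicit Types z : R[i].

Definition Rmx m n (M : 'M[R[i]]_(m, n)) : 'M[R]_(m, n) := map_mx (@complex.Re R) M.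
Definition Imx m n (M : 'M[R[i]]_(m, n)) : 'M[R]_(m, n) := map_mx (@complex.Im R) M.

Lemma complex_Re_sum I (s : seq I) (F : I -> R[i]) :
  complex.Re (\sum_(i <- s) F i) = \sum_(i <- s) complex.Re (F i).
Proof.
apply: (big_morph (@complex.Re R)) => // [[a b] [c d]]; exact: erefl.
Qed.

Lemma complex_Im_sum I (s : seq I) (F : I -> R[i]) :
  complex.Im (\sum_(i <- s) F i) = \sum_(i <- s) complex.Im (F i).
Proof.
apply: (big_morph (@complex.Im R)) => // [[a b] [c d]]; exact: erefl.
Qed.

Lemma Rmx_mul m n p (M : 'M[R[i]]_(m, n)) (N : 'M[R[i]]_(n, p)) :
  Rmx (M *m N) = Rmx M *m Rmx N - Imx M *m Imx N.
Proof.
apply/matrixP => i j; rewrite !mxE complex_Re_sum -sumrB.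
apply: eq_bigr => k _; rewrite !mxE.
by case: (M i k) => a b; case: (N k j) => c d.
Qed.

Lemma Imx_mul m n p (M : 'M[R[i]]_(m, n)) (N : 'M[R[i]]_(n, p)) :
  Imx (M *m N) = Rmx M *m Imx N + Imx M *m Rmx N.
Proof.
apply/matrixP => i j; rewrite !mxE complex_Im_sum -big_split.
apply: eq_bigr => k _; rewrite !mxE.
by case: (M i k) => a b; case: (N k j) => c d.
Qed.

Lemma Rmx_real m n (M : 'M[R]_(m, n)) : Rmx (map_mx (real_complex R) M) = M.
Proof. by apply/matrixP => i j; rewrite !mxE. Qed.

Lemma Imx_real m n (M : 'M[R]_(m, n)) : Imx (map_mx (real_complex R) M) = 0.
Proof. by apply/matrixP => i j; rewrite !mxE. Qed.

(* A complex triangularization of [B], read off on real and imaginary parts. *)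
Lemma real_triangularization n (B : 'M[R]_n) (mu : 'I_n -> R[i]) :
  char_poly (map_mx (real_complex R) B) = \prod_i ('X - (mu i)%:P) ->
  exists Pr Pi Tr Ti G H : 'M[R]_n,
    [/\ Pr *m B = Tr *m Pr - Ti *m Pi, Pi *m B = Tr *m Pi + Ti *m Pr,
        G *m Pr + H *m Pi = 1%:M,
        forall i j : 'I_n, (i < j)%N -> Tr i j = 0 /\ Ti i j = 0 &
        forall i, exists j, Tr i i = complex.Re (mu j)].
Proof.
move=> hc; set Bc := map_mx _ _ in hc.
(* Schur's triangularization, obtained as the simultaneous one of a single matrix; of unitarity only
   invertibility is kept. *)
have [P Pu /= /andP[PT _]] : exists2 P : 'M[R[i]]_n, P \is unitarymx &
    all [pred A | similar_trig P A] [:: Bc].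
  by apply: cotrigonalization => A A'; rewrite !inE => /eqP -> /eqP ->.
have {}Pu := unitarymx_unit Pu.
rewrite /similar_to conjumx // in PT; set T := P *m Bc *m invmx P in PT.
have PB : P *m Bc = T *m P by rewrite /T mulmxKV.
(* The real part of P^-1 P = 1 provides a left inverse of the real matrix that stacks Re P over Im
   P; hence the sign in the last witness. *)
exists (Rmx P), (Imx P), (Rmx T), (Imx T), (Rmx (invmx P)), (- Imx (invmx P)).
split.
- have := congr1 (@Rmx _ _) PB; rewrite !Rmx_mul Rmx_real Imx_real mulmx0 subr0.
  by [].
- have := congr1 (@Imx _ _) PB; rewrite !Imx_mul Rmx_real Imx_real mulmx0 add0r.
  by [].
- have := congr1 (@Rmx _ _) (mulVmx Pu); rewrite Rmx_mul mulNmx => ->.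
  by apply/matrixP => i j; rewrite !mxE; case: (i == j).
- move=> i j ij; have /is_trig_mxP /(_ i j ij) e := PT.
  by rewrite /Rmx /Imx [map_mx _ T i j]mxE [map_mx (@complex.Im R) T i j]mxE e.
- move=> i.
  have : root (char_poly T) (T i i).
    rewrite char_poly_trig // -(big_map (fun i => T i i) xpredT
      (fun a => 'X - a%:P)) root_prod_XsubC.
    by apply: map_f; rewrite mem_index_enum.
  rewrite char_poly_conj // hc -(big_map mu xpredT (fun a => 'X - a%:P)).
  rewrite root_prod_XsubC => /mapP [j _ e].
  by exists j; rewrite /Rmx [LHS]mxE e.
Qed.

End ComplexParts.

(** * Adapted inner products and the splitting of the linear part *)

Section Lyapunov.
Context {R : realType}.

Lemma finite_neg_bound n (a : 'I_n -> R) : (forall i, a i < 0) ->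
  exists2 d : R, 0 < d & forall i, a i <= - d.
Proof.
elim: n a => [|n IH] a h; first by exists 1; [exact: ltr01|case].
have [d d0 hd] := IH (fun i => a (lift ord0 i)) (fun i => h _).
exists (Num.min d (- a ord0)); first by rewrite lt_min d0 oppr_gt0 h.
move=> i; rewrite lerNr ge_min.
case: (unliftP ord0 i) => [j ->|->]; last by rewrite lexx orbT.
by rewrite lerNr hd.
Qed.

(* Rescaling the i-th coordinate by [eta ^ i] multiplies the strictly lower
   triangular part of the complex matrix [Tr + i Ti] by at most [eta]. *)
Lemma lyapunov_triangular n (B Pr Pi Tr Ti G H : 'M[R]_n) :
  Pr *m B = Tr *m Pr - Ti *m Pi -> Pi *m B = Tr *m Pi + Ti *m Pr ->
  G *m Pr + H *m Pi = 1%:M ->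
  (forall i j : 'I_n, (i < j)%N -> Tr i j = 0 /\ Ti i j = 0) ->
  (forall i, Tr i i < 0) ->
  exists (J : 'M[R]_(n + n, n)) (delta c : R), [/\ 0 < delta, 0 < c,
    forall x : 'cV[R]_n, `|x| <= c * `|J *m x| &
    forall x : 'cV[R]_n, inner (J *m x) (J *m (B *m x)) <=
       - delta * inner (J *m x) (J *m x)].
Proof.
move=> hr hi hG htri hneg.
have [d d0 hd] := finite_neg_bound hneg.
pose M := `|Tr| + `|Ti| + 1.
have M0 : 0 < M by rewrite ltr_wpDl // addr_ge0.
(* Each of the at most n^2 off-diagonal terms is a sum of four products and is at most 4 M eta r2;
   together they use up at most half of the diagonal dissipation d. *)
pose eta := Num.min 1 (d / (2 * (n%:R * n%:R * (4 * M) + 1))).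
have den0 : 0 < 2 * (n%:R * n%:R * (4 * M) + 1).
  by rewrite mulr_gt0 // ltr_wpDl // !mulr_ge0 // ltW.
have eta0 : 0 < eta by rewrite lt_min ltr01 divr_gt0.
have eta1 : eta <= 1 by rewrite ge_min lexx.
have eta2 : n%:R * n%:R * (4 * M) * eta <= d / 2.
  have : eta <= d / (2 * (n%:R * n%:R * (4 * M) + 1)) by rewrite ge_min lexx orbT.
  rewrite ler_pdivlMr // => h.
  by have := ltW eta0; lra.
clearbody eta.
pose D : 'M[R]_n := diag_mx (\row_i eta ^+ i).
pose D' : 'M[R]_n := diag_mx (\row_i (eta ^+ i)^-1).
have DD : D' *m D = 1%:M.
  rewrite mulmx_diag; apply/matrixP => i j; rewrite !mxE.
  by rewrite mulVf // expf_neq0 // lt0r_neq0.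
(* The Euclidean square of J x is the Hermitian square of the rescaled complex coordinates of x. *)
pose J : 'M[R]_(n + n, n) := col_mx (D *m Pr) (D *m Pi).
have [c c0 hc] := mulmx_bound (row_mx (G *m D') (H *m D')).
exists J, (d / 2), c; split => //; first by rewrite divr_gt0.
  move=> x; apply: le_trans (hc _); rewrite mulmxA /J mul_row_col.
  by rewrite -!mulmxA (mulmxA D') DD mul1mx (mulmxA D') DD mul1mx hG mul1mx.
move=> x; rewrite /J !mul_col_mx !inner_col_mx.
pose u := Pr *m x; pose v := Pi *m x.
pose a := D *m u; pose b := D *m v.
have -> : D *m Pr *m x = a by rewrite -mulmxA.
have -> : D *m Pi *m x = b by rewrite -mulmxA.
have -> : D *m Pr *m (B *m x) = D *m (Tr *m u - Ti *m v).
  by rewrite -mulmxA (mulmxA Pr) hr mulmxBl -!mulmxA.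
have -> : D *m Pi *m (B *m x) = D *m (Tr *m v + Ti *m u).
  by rewrite -mulmxA (mulmxA Pi) hi mulmxDl -!mulmxA.
have DE (y : 'cV[R]_n) i : (D *m y) i ord0 = eta ^+ i * y i ord0.
  by rewrite mul_diag_mx !mxE.
pose r2 := inner a a + inner b b.
have r20 : 0 <= r2 by rewrite addr_ge0 // inner_ge0.
have ab i j : `|a i ord0| * `|a j ord0| <= r2 /\ `|b i ord0| * `|b j ord0| <= r2 /\
   `|a i ord0| * `|b j ord0| <= r2.
  have A0 : `|a| ^+ 2 <= r2 by apply: le_trans (sqr_norm_le_inner a) _; rewrite lerDl inner_ge0.
  have B0 : `|b| ^+ 2 <= r2 by apply: le_trans (sqr_norm_le_inner b) _; rewrite lerDr inner_ge0.
  have AB : `|a| * `|b| <= r2.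
    have := sqr_norm_le_inner a; have := sqr_norm_le_inner b.
    have := sqr_ge0 (`|a| - `|b|); have := sqr_ge0 (`|a| + `|b|).
    by rewrite /r2; nra.
  split; [apply: le_trans A0|split; [apply: le_trans B0|apply: le_trans AB]];
    rewrite ?expr2; apply: ler_pM => //; exact: mx_coord_le.
pose tm i j := a i ord0 * (eta ^+ i * (Tr i j * u j ord0 - Ti i j * v j ord0)) +
               b i ord0 * (eta ^+ i * (Tr i j * v j ord0 + Ti i j * u j ord0)).
have -> : inner a (D *m (Tr *m u - Ti *m v)) + inner b (D *m (Tr *m v + Ti *m u)) =
    \sum_i \sum_j tm i j.
  rewrite /inner -big_split /=; apply: eq_bigr => i _.
  rewrite /tm big_split /= -!mulr_sumr !DE !mxE sumrB big_split /=.
  by [].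
have tmle i j : tm i j <= (if i == j then - d * (a i ord0 ^+ 2 + b i ord0 ^+ 2) else 0)
    + 4 * M * eta * r2.
  have e0 : 0 <= 4 * M * eta * r2 by rewrite !mulr_ge0 // ltW.
  have [<-{j}|ij] := eqVneq i j.
    (* The imaginary part of a diagonal entry acts as a rotation and cancels. *)
    have -> : tm i i = Tr i i * (a i ord0 ^+ 2 + b i ord0 ^+ 2).
      by rewrite /tm /a /b !DE; ring.
    apply: le_trans (_ : - d * (a i ord0 ^+ 2 + b i ord0 ^+ 2) <= _).
      by apply: ler_wpM2r; [rewrite addr_ge0 ?sqr_ge0|exact: hd].
    by rewrite lerDl.
  rewrite add0r; case: (ltngtP i j) => [lij|lij|/val_inj eij].
  - have [e1 e2] := htri i j lij.
    by rewrite /tm e1 e2 !mul0r subrr addr0 !mulr0 addr0.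
  - have ei : eta ^+ i = eta ^+ (i - j.+1) * eta * eta ^+ j.
      by rewrite -exprSr -exprD addSnnS subnK.
    have q1 : eta ^+ (i - j.+1) * eta <= eta.
      by rewrite ger_pMl // exprn_ile1 // ltW.
    have q0 : 0 <= eta ^+ (i - j.+1) * eta by rewrite mulr_ge0 ?exprn_ge0 ?ltW.
    set q := eta ^+ (i - j.+1) * eta in ei q1 q0.
    have -> : tm i j = q * (Tr i j * (a i ord0 * a j ord0) -
      Ti i j * (a i ord0 * b j ord0) + Tr i j * (b i ord0 * b j ord0) +
      Ti i j * (b i ord0 * a j ord0)).
      by rewrite /tm [a j ord0]DE [b j ord0]DE ei; ring.
    have [h1 [h2 h3]] := ab i j; have [_ [_ h4]] := ab j i.
    have Trm : `|Tr i j| <= M.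
      by apply: le_trans (mx_coord_le _ _ _) _; rewrite /M -addrA lerDl addr_ge0.
    have Tim : `|Ti i j| <= M.
      apply: le_trans (mx_coord_le _ _ _) _.
      by rewrite /M [`|Tr| + _]addrC -addrA lerDl addr_ge0.
    have bnd (t y z : R) : `|t| <= M -> `|y| * `|z| <= r2 -> `|t * (y * z)| <= M * r2.
      by move=> ht hyz; rewrite !normrM; apply: ler_pM; rewrite ?mulr_ge0.
    apply: le_trans (ler_norm _) _; rewrite normrM (ger0_norm q0).
    have -> : 4 * M * eta * r2 = eta * (M * r2 + M * r2 + M * r2 + M * r2) by ring.
    apply: ler_pM => //.
    apply: le_trans (ler_normD _ _) _; apply: lerD.
      apply: le_trans (ler_normD _ _) _; apply: lerD.
        apply: le_trans (ler_normB _ _) _; apply: lerD; exact: bnd.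
      exact: bnd.
    by apply: bnd; rewrite // mulrC.
  - by rewrite eij eqxx in ij.
apply: le_trans (_ : \sum_i \sum_j ((if i == j then - d * (a i ord0 ^+ 2 + b i ord0 ^+ 2)
   else 0) + 4 * M * eta * r2) <= _).
  by apply: ler_sum => i _; apply: ler_sum => j _; exact: tmle.
have -> : \sum_i \sum_j ((if i == j then - d * (a i ord0 ^+ 2 + b i ord0 ^+ 2)
   else 0) + 4 * M * eta * r2) = - d * r2 + n%:R * n%:R * (4 * M * eta * r2).
  rewrite (eq_bigr (fun i => - d * (a i ord0 ^+ 2 + b i ord0 ^+ 2) +
     n%:R * (4 * M * eta * r2))).
    rewrite big_split /= sumr_const card_ord -[(_ * _) *+ n]mulr_natl mulrA; congr (_ + _).
    rewrite -mulr_sumr; congr (_ * _); rewrite /r2 /inner -big_split /=.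
    by apply: eq_bigr => i _; rewrite -!expr2.
  move=> i _; rewrite big_split /= sumr_const card_ord -[(_ * _) *+ n]mulr_natl; congr (_ + _).
  rewrite (bigD1 i) //= eqxx big1 ?addr0 // => j ji.
  by rewrite eq_sym (negbTE ji).
have := ler_wpM2r r20 eta2.
by rewrite /r2; lra.
Qed.

Lemma lyapunov n (B : 'M[R]_n) (mu : 'I_n -> R[i]) (eps : R) :
  char_poly (map_mx (real_complex R) B) = \prod_i ('X - (mu i)%:P) ->
  (forall i, eps * complex.Re (mu i) < 0) ->
  exists (J : 'M[R]_(n + n, n)) (delta c : R), [/\ 0 < delta, 0 < c,
    forall x : 'cV[R]_n, `|x| <= c * `|J *m x| &
    forall x : 'cV[R]_n, inner (J *m x) (J *m (eps *: (B *m x))) <=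
       - delta * inner (J *m x) (J *m x)].
Proof.
move=> hc hneg.
have [Pr [Pi [Tr [Ti [G [H [h1 h2 h3 h4 h5]]]]]]] := real_triangularization hc.
have [||||J [delta [c [J1 J2 J3 J4]]]] := @lyapunov_triangular n (eps *: B) Pr Pi
  (eps *: Tr) (eps *: Ti) G H _ _ h3.
- by rewrite -scalemxAr h1 scalerBr !scalemxAl.
- by rewrite -scalemxAr h2 scalerDr !scalemxAl.
- by move=> i j /(h4 i j) [e1 e2]; rewrite !mxE e1 e2 mulr0.
- by move=> i; rewrite mxE; have [j ->] := h5 i.
exists J, delta, c; split => // x.
by rewrite scalemxAl; exact: J4.
Qed.

(** A left null vector of A, used as first row of a change of basis up to a scalar, makes A block
    lower triangular with a zero corner and a block B carrying the other eigenvalues. As B is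
    contracting after scaling, it is invertible, and the kernel of A is spanned by (1, - B^-1 c). *)
Lemma linear_structure n (n_gt0 : (0 < n)%N) (A : 'M[R]_n)
    (lambda : 'I_n -> R[i]) (eps : R) :
  eigenvalues_of A lambda -> lambda (Ordinal n_gt0) = 0 ->
  (forall i, i != Ordinal n_gt0 -> eps * complex.Re (lambda i) < 0) ->
  exists l (J : 'M[R]_(l, n)) (v : 'cV[R]_n) (w : 'rV[R]_n) (delta c : R),
    [/\ [/\ A *m v = 0, w *m A = 0, w *m v = 1%:M & J *m v = 0],
      0 < delta, 0 < c,
      forall x : 'cV[R]_n, `|x - v *m (w *m x)| <= c * `|J *m x| &
      forall x : 'cV[R]_n, inner (J *m x) (J *m (eps *: (A *m x))) <=
        - delta * inner (J *m x) (J *m x)].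
Proof.
case: n n_gt0 A lambda => // n n_gt0 A lambda hchar l0 hl.
have o0 : Ordinal n_gt0 = ord0 :> 'I_n.+1 by exact: val_inj.
rewrite o0 in l0 hl.
rewrite -[n.+1]/(1 + n)%N in A lambda hchar l0 hl *.
have hdet : \det A = 0.
  have := congr1 (fun p : {poly R[i]} => p`_0) hchar.
  rewrite char_poly_det det_map_mx big_ord_recl l0 subr0 coefXM eqxx.
  move/eqP; rewrite mulf_eq0 signr_eq0 /= fmorph_eq0 => /eqP; exact.
have /eqP /det0P [w0 w0n w0A] := hdet.
pose Pm : 'M[R]_(1 + n) := row_ebase w0.
have Pu : Pm \in unitmx by exact: row_ebase_unit.
have PA : usubmx (Pm *m A) = 0.
  rewrite -mul_usub_mx; have := mulmx_ebase w0; rewrite rank_rV w0n.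
  rewrite (_ : pid_mx (true : nat) = row_mx 1%:M 0); last exact: pid_mx_row.
  rewrite -mulmxA -/Pm -{1}(vsubmxK Pm) mul_row_col mul1mx mul0mx addr0 => e.
  have ce := col_ebase_unit w0.
  have := congr1 (mulmx (invmx (col_ebase w0))) e; rewrite mulKmx // => ->.
  by rewrite -mulmxA w0A mulmx0.
pose A1 := Pm *m A *m invmx Pm.
pose c := dlsubmx A1; pose B := drsubmx A1.
have A1E : A1 = block_mx (0 : 'M[R]_1) 0 c B.
  rewrite /block_mx row_mx0 /c /B /dlsubmx /drsubmx hsubmxK -{1}(vsubmxK A1).
  by congr col_mx; rewrite /A1 -mul_usub_mx PA mul0mx.
(* The factor X is cancelled from both expressions of the characteristic polynomial. *)
have hB : char_poly (map_mx (real_complex R) B) =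
    \prod_i ('X - (lambda (lift ord0 i))%:P).
  have Pcu : map_mx (real_complex R) Pm \in unitmx by rewrite map_unitmx.
  have := char_poly_conj (map_mx (real_complex R) A) Pcu.
  rewrite -map_invmx -!map_mxM -/A1 A1E (map_block_mx (real_complex R)).
  rewrite !map_mx0 char_poly_lblock0 hchar big_ord_recl l0 subr0.
  by apply: mulfI; rewrite polyX_eq0.
have [|J [delta [k [d0 k0 hk hJ]]]] := lyapunov (eps := eps) hB.
  by move=> i; apply: hl; rewrite eq_sym neq_lift.
(* For y in the kernel of B the dissipation inequality reads 0 <= - delta |J y|^2, forcing J y = 0
   and then y = 0. *)
have Bu : B \in unitmx.
  rewrite unitmxE unitfE -det_tr; apply/negP => /det0P [y yn yB].
  have yB' : B *m y^T = 0 by rewrite -[B]trmxK -trmx_mul yB trmx0.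
  have := hJ y^T; rewrite yB' scaler0 mulmx0 inner0r mulNr oppr_ge0.
  rewrite pmulr_rle0 // => h.
  have := le_trans (sqr_norm_le_inner _) h => h'.
  have : `|J *m y^T| ^+ 2 == 0 by rewrite eq_le h' sqr_ge0.
  rewrite sqrf_eq0 => /eqP J0; have := hk y^T.
  rewrite J0 mulr0 normr_le0 => /eqP e.
  by move: yn; rewrite -[y]trmxK e trmx0 eqxx.
pose g := invmx B *m c.
have Bg : B *m g = c by rewrite /g mulKVmx.
pose v1 : 'cV[R]_(1 + n) := col_mx 1%:M (- g).
pose w1 : 'rV[R]_(1 + n) := row_mx 1%:M 0.
(* Measures the offset y + g s of a vector (s, y) from the kernel line, spanned by (1, - g). *)
pose J1 := J *m row_mx g 1%:M.
have AE : A = invmx Pm *m A1 *m Pm by rewrite /A1 -[RHS]mulmxA mulmxKV // mulKmx.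
have Av1 : A1 *m v1 = 0.
  rewrite A1E /v1 mul_block_col !mul0mx addr0 mulmx1 mulmxN Bg subrr.
  by rewrite col_mx0.
have wA1 : w1 *m A1 = 0 by rewrite A1E /w1 mul_row_block mul1mx !mul0mx mulmx0 !addr0 row_mx0.
have wv1 : w1 *m v1 = 1%:M by rewrite /w1 /v1 mul_row_col mul1mx mul0mx addr0.
have Jv1 : J1 *m v1 = 0.
  by rewrite /J1 -mulmxA /v1 mul_row_col mulmx1 mul1mx subrr mulmx0.
have [C C0 hC] := mulmx_bound (invmx Pm).
exists (n + n)%N, (J1 *m Pm), (invmx Pm *m v1), (w1 *m Pm), delta, (C * k).
have J1E (x : 'cV[R]_n.+1) : J1 *m Pm *m x =
    J *m (g *m usubmx (Pm *m x : 'cV[R]_(1 + n)) + dsubmx (Pm *m x : 'cV[R]_(1 + n))).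
  rewrite -mulmxA -{1}(vsubmxK (Pm *m x : 'cV[R]_(1 + n))) /J1 -mulmxA.
  by rewrite mul_row_col mul1mx.
split; [split|exact: d0|by rewrite mulr_gt0| |].
- by rewrite AE -(mulmxA _ Pm) mulKVmx // -mulmxA Av1 mulmx0.
- by rewrite AE -(mulmxA (invmx Pm)) -(mulmxA w1) mulKVmx // mulmxA wA1 mul0mx.
- by rewrite mulmxA mulmxK // wv1.
- by rewrite mulmxA mulmxK.
- move=> x; have -> : x - invmx Pm *m v1 *m (w1 *m Pm *m x) =
     invmx Pm *m (Pm *m x - v1 *m (w1 *m (Pm *m x))).
    by rewrite mulmxBr mulKmx // !mulmxA.
  apply: le_trans (hC _) _; rewrite -mulrA ler_pM2l // J1E.
  set s := usubmx _; set y := dsubmx _.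
  apply: le_trans (hk _).
  have -> : Pm *m x = col_mx s y by rewrite vsubmxK.
  rewrite /w1 mul_row_col mul1mx mul0mx addr0 /v1 mul_col_mx mul1mx.
  rewrite opp_col_mx add_col_mx subrr mulNmx opprK [g *m s + y]addrC.
  by apply: norm_col_mx_le; rewrite ?normr0.
- move=> x; rewrite J1E J1E.
  set s := usubmx (Pm *m x : 'cV[R]_(1 + n)); set y := dsubmx (Pm *m x : 'cV[R]_(1 + n)).
  have E : Pm *m (eps *: (A *m x)) = col_mx 0 (eps *: (c *m s + B *m y)) :> 'cV[R]_(1 + n).
    rewrite -scalemxAr {1}AE -(mulmxA _ Pm) -(mulmxA (invmx Pm)) mulKVmx //.
    rewrite -{1}(vsubmxK (Pm *m x : 'cV[R]_(1 + n))) A1E mul_block_col !mul0mx addr0.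
    by rewrite scale_col_mx scaler0.
  rewrite E col_mxKu col_mxKd mulmx0 add0r -Bg -mulmxA -mulmxDr.
  exact: hJ.
Qed.

End Lyapunov.

(** * From first integrals to singular points *)

Section Homogeneous.
Context {R : realType} {n : nat}.
Implicit Types (g : 'cV[R]_n -> R) (x : 'cV[R]_n).

(* The homogeneous part of degree [k] of the Taylor expansion of [g] at 0,
   built by Euler's identity; no symmetry of the partial derivatives is used. *)
Fixpoint homog k g x : R :=
  if k is k'.+1 then k%:R^-1 * \sum_j x j ord0 * homog k' (partial j g) x
  else g 0.

Definition flat_below m g := forall s, (size s < m)%N -> iter_partial s g 0 = 0.

Lemma iter_partial_rcons s j g :
  iter_partial (rcons s j) g = iter_partial s (partial j g).
Proof. by rewrite -cats1 /iter_partial foldr_cat. Qed.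

Lemma flat_below_partial m g j : flat_below m.+1 g -> flat_below m (partial j g).
Proof. by move=> h s sm; rewrite -iter_partial_rcons h // size_rcons. Qed.

Lemma homog_scale k g t x : homog k g (t *: x) = t ^+ k * homog k g x.
Proof.
elim: k g => [|k IH] g /=; first by rewrite expr0 mul1r.
rewrite exprS mulrCA; congr (_ * _); rewrite mulr_sumr; apply: eq_bigr => j _.
by rewrite mxE IH; ring.
Qed.

Lemma Cinf_homog k g : Cinf setT (homog k g).
Proof.
move=> q; elim: k g => [|k IH] g /=; first exact: Ck_cst.
apply: Ck_mul; [exact: openT|exact: Ck_cst|].
apply: Ck_sum => [|j]; first exact: openT.
by apply: Ck_mul; [exact: openT|exact: Ck_coord|exact: IH].
Qed.

Lemma homog_continuous k g : continuous (homog k g).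
Proof. by move=> x; apply: (Ck_cont (Cinf_homog k g 0)). Qed.

Lemma homog_flat k g x : flat_below k.+1 g -> homog k g x = 0.
Proof.
elim: k g => [|k IH] g h /=; first exact: (h [::]).
rewrite big1 ?mulr0 // => j _; rewrite IH ?mulr0 //.
exact: flat_below_partial.
Qed.

Lemma ball_compact (r : R) : compact [set x : 'cV[R]_n | `|x| <= r].
Proof.
apply: (@closed_bounded_compact_cV _ _ _ r) => //.
apply: (@closed_norm_le _ _ _ id) => x; exact: cvg_id.
Qed.

Lemma ball_convex (r : R) : convex_set [set x : 'cV[R]_n | `|x| <= r].
Proof. by move=> x y t hx hy t0 t1; exact: norm_convex. Qed.

Lemma is_derive_ray (W : set 'cV[R]_n) g x (t : R) : open W -> Ck 1 W g ->
  W (t *: x) -> is_derive t (1 : R) (fun s => g (s *: x))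
    (\sum_j x j ord0 * partial j g (t *: x)).
Proof.
move=> oW g1 Wt; have hs := is_derive_segment 0 x t.
have := @is_derive_C1_comp R R n W g (fun s : R => 0 + s *: x) t 1 x oW g1.
rewrite add0r => /(_ Wt hs); rewrite (_ : (fun s => g (0 + s *: x)) = (fun s => g (s *: x))) //.
by apply/funext => s; rewrite add0r.
Qed.

(** Induction on [m]. Along the ray t x, the difference between g and its homogeneous part of degree
    m + 1 has a derivative controlled by the case of degree m for the partial derivatives of g. *)
Lemma taylor_homog (W : set 'cV[R]_n) (r : R) m g : open W -> 0 <= r ->
  (forall x, `|x| <= r -> W x) -> Cinf W g -> flat_below m g ->
  exists2 C : R, 0 < C & forall x, `|x| <= r ->
    `|g x - homog m g x| <= C * `|x| ^+ m.+1.
Proof.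
move=> oW r0 rW; elim: m g => [|m IH] g hg hf.
  have gv : Ckv 1 W (fun x => \col_(i < 1) g x).
    move=> i; apply: (eq_Ck oW _ (hg 1%N)) => x _; by rewrite mxE.
  have [L L0 hL] := C1_lipschitz oW gv (ball_compact (r := r)) rW (ball_convex (r := r)).
  exists L => // x hx; have := hL x 0 hx; rewrite subr0 expr1.
  have h0 : `|0 : 'cV[R]_n| <= r by rewrite normr0.
  move=> /(_ h0); apply: le_trans.
  have := mx_coord_le ((\col_(i < 1) g x) - (\col_(i < 1) g 0)) ord0 ord0.
  by rewrite !mxE.
have [C C0 hC] : exists2 C : R, 0 < C & forall j x, `|x| <= r ->
    `|partial j g x - homog m (partial j g) x| <= C * `|x| ^+ m.+1.
  apply: finite_bound => [j a b ab h x hx|j].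
    by apply: le_trans (h x hx) _; apply: ler_wpM2r => //; rewrite exprn_ge0.
  by apply: IH; [exact: Cinf_partial|exact: flat_below_partial].
exists (n%:R * C + 1); first by rewrite ltr_wpDl // mulr_ge0 // ltW.
move=> x hx.
pose a := n%:R * (C * `|x| ^+ m.+2).
have step := @deriv_norm_le R
  (fun t => g (t *: x) - t ^+ m.+1 * homog m.+1 g x)
  (fun t => \sum_j x j ord0 * partial j g (t *: x) -
     m.+1%:R * t ^+ m * homog m.+1 g x)
  (fun t => a * t) (fun=> a) 0 1 ler01.
have g0 : g 0 = 0 by exact: (hf [::]).
rewrite /= scale1r scale0r expr1n mul1r expr0n /= mul0r subr0 g0 subr0 mulr1 mulr0 subr0 in step.
apply: le_trans (step _ _ _) _.
- move=> t; rewrite in_itv /= => /andP[t0 t1].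
  have Wt : W (t *: x).
    by apply: rW; rewrite normrZ (ger0_norm t0) (le_trans _ hx) // ler_piMl.
  have h1 := is_derive_ray oW (hg 1%N) Wt.
  have h2 : is_derive t (1 : R) (fun t => t ^+ m.+1 * homog m.+1 g x)
     (m.+1%:R * t ^+ m * homog m.+1 g x).
    have h3 : is_derive t (1 : R) (@GRing.exp R ^~ m.+1) (m.+1%:R * t ^+ m).
      by split; [exact: exprn_derivable|rewrite exp_derive /GRing.scale /= mulr1].
    have h4 := is_deriveZ (homog m.+1 g x) h3.
    have -> : (fun t => t ^+ m.+1 * homog m.+1 g x) =
        homog m.+1 g x \*: (@GRing.exp R ^~ m.+1).
      by apply/funext => s; rewrite mulrC.
    by apply: is_derive_eq h4 _; rewrite /GRing.scale /= mulrC.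
  exact: is_deriveB.
- move=> t _; have -> : (fun t : R => a * t) = a \*: id by [].
  by apply: is_derive_eq; rewrite /GRing.scale /= mulr1.
- move=> t; rewrite in_itv /= => /andP[t0 t1].
  rewrite /a.
  have -> : m.+1%:R * t ^+ m * (m.+1%:R^-1 * \sum_j x j ord0 * homog m (partial j g) x) =
     \sum_j x j ord0 * homog m (partial j g) (t *: x).
    rewrite [m.+1%:R * _]mulrC -mulrA mulVKf ?pnatr_eq0 // mulr_sumr.
    by apply: eq_bigr => j _; rewrite homog_scale mulrCA.
  rewrite -sumrB; apply: ler_norm_sum_const => j; rewrite -mulrBr normrM.
  have tx : `|t *: x| <= `|x| by rewrite normrZ (ger0_norm t0) ler_piMl.
  rewrite exprS mulrCA; apply: ler_pM => //; first exact: mx_coord_le.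
  apply: le_trans (hC j _ (le_trans tx hx)) _; rewrite ler_pM2l //.
  by rewrite ler_pXn2r ?nnegrE.
rewrite /a mulrA; apply: ler_wpM2r; first exact: exprn_ge0.
by rewrite lerDl.
Qed.

Lemma flat_bound (W : set 'cV[R]_n) (r : R) m g : open W -> 0 <= r ->
  (forall x, `|x| <= r -> W x) -> Cinf W g -> flat_below m g ->
  exists2 C : R, 0 < C & forall x, `|x| <= r -> `|g x| <= C * `|x| ^+ m.
Proof.
move=> oW r0 rW hg; case: m => [|m] hf.
  have [B B0 hB] := continuous_compact_bound (hg 0%N) (ball_compact (r := r)) rW.
  by exists B => // x hx; rewrite expr0 mulr1; exact: hB.
have hf' : flat_below m g by move=> s sm; apply: hf; exact: ltnW.
have [C C0 hC] := taylor_homog oW r0 rW hg hf'.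
by exists C => // x hx; have := hC x hx; rewrite homog_flat // subr0.
Qed.

(** Comparison of leading orders as t tends to 0, in a form free of limits. *)
Lemma le0_of_small (a b t0 : R) : 0 < t0 -> 0 <= b ->
  (forall t, 0 < t -> t <= t0 -> a <= b * t) -> a <= 0.
Proof.
move=> t00 b0 h; rewrite leNgt; apply/negP => a0.
pose t := Num.min t0 (a / (2 * (b + 1))).
have b1 : 0 < 2 * (b + 1) by rewrite mulr_gt0 // ltr_wpDl.
have tp : 0 < t by rewrite lt_min t00 divr_gt0.
have tt : t <= t0 by rewrite ge_min lexx.
have := h t tp tt.
have : t <= a / (2 * (b + 1)) by rewrite ge_min lexx orbT.
by rewrite ler_pdivlMr //; nra.
Qed.

(** By induction through the partial derivatives, it suffices that the homogeneous part of degree m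
    of h = partial j g vanish at every x0. If its value q were nonzero, then along the segment from
    tau x0 in the direction j, of length tau e, the function g would vary by about e tau^(m+1) q,
    whereas g is O(tau^(m+2)) at both ends. *)
Lemma homog_eq0_flat (W : set 'cV[R]_n) (r : R) m g : open W -> 0 < r ->
  (forall x, `|x| <= r -> W x) -> Cinf W g -> flat_below m g ->
  (forall x, homog m g x = 0) -> flat_below m.+1 g.
Proof.
move=> oW r0 rW; elim: m g => [|m IH] g hg hf h0.
  by case=> // _; exact: h0 0.
move=> ss; case/lastP: ss => [_|ss j]; first exact: (hf [::]).
rewrite size_rcons ltnS => sm; rewrite iter_partial_rcons.
have fj := flat_below_partial j hf.
apply: (IH _ (Cinf_partial j hg) fj) sm => x0.
set h := partial j g in fj *.
have [C C0 hC] := taylor_homog oW (ltW r0) rW hg hf.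
have [C' C'0 hC'] := taylor_homog oW (ltW r0) rW (Cinf_partial j hg) fj.
rewrite -/h in hC'.
apply/eqP; rewrite -normr_le0; set q := homog m h x0.
have [->|qn0] := eqVneq q 0; first by rewrite normr0.
have q20 : 0 < `|q| / 2 by rewrite divr_gt0 // normr_gt0.
(* On this segment the homogeneous part of h stays within |q| / 2 of q. *)
have [e e0 he] : exists2 e : R, 0 < e & forall t, 0 <= t -> t <= e ->
    `|homog m h (x0 + t *: delta_mx j ord0) - q| <= `|q| / 2.
  have cc : {for 0, continuous (fun t : R => homog m h (x0 + t *: delta_mx j ord0))}.
    apply: (@continuous_comp _ _ _ (fun t : R => x0 + t *: delta_mx j ord0) (homog m h)).
      exact: is_derive_cont (is_derive_segment x0 (delta_mx j ord0) 0).
    exact: homog_continuous.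
  have := cc; rewrite /prop_for /continuous_at scale0r addr0.
  move=> /cvgrPdist_le /(_ _ q20) /nbhs_ballP [d /= d0 hd].
  exists (d / 2); first by rewrite divr_gt0.
  move=> t t0 td; rewrite distrC; apply: hd.
  rewrite /ball /= sub0r normrN (ger0_norm t0).
  by apply: le_lt_trans td _; rewrite ltr_pdivrMr // ltr_pMr // ltr1n.
have [B B0 BE] : exists2 B : R, 0 < B & B = `|x0| + e.
  by exists (`|x0| + e) => //; rewrite ltr_wpDl.
have Bx t : 0 <= t -> t <= e -> `|x0 + t *: delta_mx j ord0| <= B.
  move=> t0 te; apply: le_trans (ler_normD _ _) _; rewrite BE lerD2l normrZ.
  rewrite (ger0_norm t0) -[leRHS]mulr1; apply: ler_pM => //.
  by apply: cV_norm_le => // i; rewrite !mxE; case: (_ && _); rewrite ?normr1 ?normr0.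
(* The constant results from dividing the estimate [q1] below by e tau^(m+1) and moving |q| / 2 to
   the left. *)
apply: (@le0_of_small _ (2 * (C' * B ^+ m.+1 + 2 * C * B ^+ m.+2 / e)) (r / B)).
- by rewrite divr_gt0.
- have C1 := ltW C0; have C1' := ltW C'0; have B1 := ltW B0; have e1 := ltW e0.
  apply: mulr_ge0 => //; apply: addr_ge0; first by rewrite mulr_ge0 ?exprn_ge0.
  by apply: divr_ge0 => //; apply: mulr_ge0; [apply: mulr_ge0|apply: exprn_ge0].
move=> tau tau0 taur.
have taux t : 0 <= t -> t <= e ->
    `|tau *: (x0 + t *: delta_mx j ord0)| <= tau * B /\
    `|tau *: (x0 + t *: delta_mx j ord0)| <= r.
  move=> t0 te; have := Bx t t0 te => h1.
  have h2 : `|tau *: (x0 + t *: delta_mx j ord0)| <= tau * B.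
    by rewrite normrZ gtr0_norm // ler_pM2l.
  by split => //; apply: le_trans h2 _; rewrite -ler_pdivlMr.
pose a := tau ^+ m.+1 * (C' * B ^+ m.+1 * tau + `|q| / 2).
have step := @deriv_norm_le R
  (fun t => g (tau *: (x0 + t *: delta_mx j ord0)) - t * (tau ^+ m.+1 * q))
  (fun t => tau * h (tau *: (x0 + t *: delta_mx j ord0)) - tau ^+ m.+1 * q)
  (fun t => a * t) (fun=> a) 0 e (ltW e0).
have {}step : `|g (tau *: (x0 + e *: delta_mx j ord0)) - e * (tau ^+ m.+1 * q) -
   g (tau *: x0)| <= a * e.
  have := step _ _ _; rewrite scale0r addr0 mul0r subr0 mulr0 subr0; apply.
  - move=> t; rewrite in_itv /= => /andP[t0 te].
    have [_ tr] := taux t t0 te.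
    have hs := is_derive_segment (tau *: x0) (tau *: delta_mx j ord0) t.
    have Wt : W (tau *: x0 + t *: (tau *: delta_mx j ord0)).
      by apply: rW; move: tr; rewrite scalerDr scalerA mulrC -scalerA.
    have h1 := @is_derive_C1_comp R R n W g
      (fun s : R => tau *: x0 + s *: (tau *: delta_mx j ord0)) t 1 _ oW (hg 1%N) Wt hs.
    have E s : tau *: x0 + s *: (tau *: delta_mx j ord0) =
       tau *: (x0 + s *: delta_mx j ord0 : 'cV[R]_n).
      by rewrite scalerDr !scalerA mulrC.
    rewrite E in h1.
    have h2 : is_derive t (1 : R) (fun s => g (tau *: (x0 + s *: delta_mx j ord0)))
       (tau * h (tau *: (x0 + t *: delta_mx j ord0))).
      rewrite (_ : (fun s => _) = (fun s : R => g (tau *: x0 + s *: (tau *: delta_mx j ord0)))).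
        apply: is_derive_eq h1 _.
        rewrite (bigD1 j) //= !mxE !eqxx mulr1 big1 ?addr0 // => k kj.
        by rewrite !mxE (negbTE kj) mulr0 mul0r.
      by apply/funext => s; rewrite E.
    apply: is_deriveB.
    have -> : (fun t : R => t * (tau ^+ m.+1 * q)) = (tau ^+ m.+1 * q) \*: id.
      by apply/funext => s; rewrite mulrC.
    by apply: is_derive_eq; rewrite /GRing.scale /= mulr1.
  - move=> t _; have -> : (fun t : R => a * t) = a \*: id by [].
    by apply: is_derive_eq; rewrite /GRing.scale /= mulr1.
  - move=> t; rewrite in_itv /= => /andP[t0 te].
    have [tB tr] := taux t t0 te.
    have := hC' _ tr; rewrite homog_scale.
    set y := tau *: _; set p := homog m h _ => h1.
    have h2 : `|p - q| <= `|q| / 2 by exact: he.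
    have -> : tau * h y - tau ^+ m.+1 * q =
      tau * (h y - tau ^+ m * p) + tau ^+ m.+1 * (p - q) by rewrite exprS; ring.
    apply: le_trans (ler_normD _ _) _.
    have tm0 : 0 <= tau ^+ m.+1 by rewrite exprn_ge0 // ltW.
    rewrite /a [leRHS]mulrDr; apply: lerD; rewrite normrM.
      rewrite (gtr0_norm tau0).
      have -> : tau ^+ m.+1 * (C' * B ^+ m.+1 * tau) = tau * (C' * (tau * B) ^+ m.+1).
        by rewrite exprMn; ring.
      rewrite ler_pM2l //; apply: le_trans h1 _; rewrite ler_pM2l //.
      by rewrite ler_pXn2r ?nnegrE ?mulr_ge0 // ltW.
    by rewrite (ger0_norm tm0) ler_wpM2l.
have [yB yr] := taux e (ltW e0) (lexx e).
have [zB zr] := taux 0 (lexx 0) (ltW e0); rewrite scale0r addr0 in zB zr.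
have gle x : `|x| <= tau * B -> `|x| <= r -> `|g x| <= C * (tau * B) ^+ m.+2.
  move=> xB xr; have := hC x xr; rewrite h0 subr0 => /le_trans; apply.
  by rewrite ler_pM2l // ler_pXn2r ?nnegrE ?mulr_ge0 // ltW.
have tm0 : 0 < tau ^+ m.+1 by rewrite exprn_gt0.
have q1 : e * (tau ^+ m.+1 * `|q|) <= a * e + 2 * (C * (tau * B) ^+ m.+2).
  set g1 := g _ in step; set g2 := g _ in step.
  have -> : e * (tau ^+ m.+1 * `|q|) = `|e * (tau ^+ m.+1 * q)|.
    by rewrite !normrM (gtr0_norm e0) (gtr0_norm tm0).
  have -> : e * (tau ^+ m.+1 * q) = - (g1 - e * (tau ^+ m.+1 * q) - g2) + (g1 - g2) by ring.
  apply: le_trans (ler_normD _ _) _; rewrite normrN; apply: lerD => //.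
  apply: le_trans (ler_normB _ _) _; rewrite [leRHS]mulr_natl mulr2n.
  by apply: lerD; exact: gle.
rewrite -(ler_pM2l tm0) -(ler_pM2l e0); apply: le_trans (_ : 2 * (e * (tau ^+ m.+1 * `|q|) -
   e * (tau ^+ m.+1 * (`|q| / 2))) <= _).
  by rewrite le_eqVlt; apply/orP; left; apply/eqP; field.
apply: le_trans (_ : 2 * (a * e + 2 * (C * (tau * B) ^+ m.+2) - e * (tau ^+ m.+1 * (`|q| / 2))) <= _).
  by rewrite ler_pM2l // lerD2r.
rewrite /a le_eqVlt; apply/orP; left; apply/eqP.
rewrite exprMn [tau ^+ m.+2]exprS.
by field; exact: lt0r_neq0.
Qed.

End Homogeneous.

(** * The curve of points where the field is parallel to the kernel *)

Section SlowCurve.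
Context {R : realType}.

(** [v *m w] is the projector onto the kernel of [A] along its image, and |J x| is an adapted norm
    modulo the line of [v], in which [A] contracts. *)
Record linear_data l n (A : 'M[R]_n) (J : 'M[R]_(l, n)) (v : 'cV[R]_n)
    (w : 'rV[R]_n) (delta c : R) : Prop := LinearData {
  lin_Av : A *m v = 0;
  lin_wA : w *m A = 0;
  lin_wv : w *m v = 1%:M;
  lin_Jv : J *m v = 0;
  lin_delta : 0 < delta;
  lin_c : 0 < c;
  lin_PJ : forall x : 'cV[R]_n, `|x - v *m (w *m x)| <= c * `|J *m x|;
  lin_diss : forall x : 'cV[R]_n, inner (J *m x) (J *m (A *m x)) <=
    - delta * inner (J *m x) (J *m x) }.

Lemma contraction_ball n (T : 'cV[R]_n -> 'cV[R]_n) (rho : R) : 0 <= rho ->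
  (forall x, `|x| <= rho -> `|T x| <= rho) ->
  (forall x y, `|x| <= rho -> `|y| <= rho -> `|T x - T y| <= 2^-1 * `|x - y|) ->
  exists2 x, `|x| <= rho & T x = x.
Proof.
move=> r0 hb hc; pose y k := iter k T 0.
have yb k : `|y k| <= rho by elim: k => [|k IH]; [rewrite normr0|exact: hb].
have step k : `|y k.+1 - y k| <= rho / 2 ^+ k.
  elim: k => [|k IH]; first by rewrite subr0 expr0 divr1; exact: (yb 1%N).
  apply: le_trans (hc _ _ (yb k.+1) (yb k)) _.
  rewrite exprS invfM mulrCA; apply: ler_wpM2l => //; by rewrite invr_ge0.
have [x hx] := geometric_tail_lim step.
have lim0 := @cvg_half_expn R (2 * rho).
have xb : `|x| <= rho.
  have h : (fun k => rho + 2 * rho / 2 ^+ k) @ \oo --> rho + 0.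
    by apply: cvgD => //; exact: cvg_cst.
  rewrite -[leRHS]addr0; apply: (cvgr_to_ge h); apply: nearW => k.
  rewrite -(subrKC (y k) x); apply: le_trans (ler_normD _ _) _.
  exact: lerD.
exists x => //; apply/eqP; rewrite -subr_eq0 -normr_le0.
apply: (cvgr_to_ge (@cvg_half_expn R (4 * rho))); apply: nearW => k.
rewrite -(subrKA (y k.+1)); apply: le_trans (ler_normD _ _) _.
apply: le_trans (lerD (hc _ _ xb (yb k)) _) _.
  by rewrite distrC; exact: (hx k.+1).
apply: le_trans (lerD (ler_wpM2l _ (hx k)) (lexx _)) _; first by rewrite invr_ge0.
have p0 : (2 ^+ k : R) != 0 by rewrite expf_neq0.
have q0 : 0 <= rho / 2 ^+ k by rewrite divr_ge0 // exprn_ge0.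
rewrite [leLHS](_ : _ = 2 * (rho / 2 ^+ k)); last by rewrite exprS; field.
by rewrite -mulrA; apply: ler_wpM2r => //; rewrite ler_nat.
Qed.

(** The Jacobian is Lipschitz and vanishes at 0, so it is at most L rho on the ball of radius
    rho. *)
Lemma quad_lipschitz n m (V : set 'cV[R]_n) (f : 'cV[R]_n -> 'cV[R]_m) :
  open V -> V 0 -> Ckv 2 V f -> jac f 0 = 0 ->
  exists L r : R, [/\ 0 < L, 0 < r, forall x, `|x| <= r -> V x &
    forall rho x y, rho <= r -> `|x| <= rho -> `|y| <= rho ->
      `|f x - f y| <= L * rho * `|x - y| /\
      (forall u : 'cV[R]_n, `|jac f x *m u| <= L * rho * `|u|)].
Proof.
move=> oV V0 f2 df0; have [r r0 hr] := ball_cV_sub oV V0.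
have rV x : `|x| <= r -> V x by move=> /hr; rewrite add0r.
have f1 : Ckv 1 V f by move=> i; exact: CkS (f2 i).
have [L L0 hL] := jac_lipschitz oV f2 (ball_compact (r := r)) rV
  (ball_convex (r := r)).
have jb rho x (u : 'cV[R]_n) : rho <= r -> `|x| <= rho -> `|jac f x *m u| <= L * rho * `|u|.
  move=> rr xr; have := hL x 0 u; rewrite df0 mul0mx !subr0 /= normr0.
  move=> /(_ (le_trans xr rr) (ltW r0)) /le_trans; apply.
  by apply: ler_wpM2r => //; rewrite ler_pM2l.
exists L, r; split => // rho x y rr xr yr; split => [|u]; last exact: jb.
have Ks s : s \in `[0, 1]%R -> `|y + s *: (x - y)| <= rho.
  by rewrite in_itv /= => /andP[s0 s1]; exact: norm_convex.
have := @deriv_norm_le_cV R m (fun s => f (y + s *: (x - y)))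
   (fun s => jac f (y + s *: (x - y)) *m (x - y)) (fun s => L * rho * `|x - y| * s)
   (fun=> L * rho * `|x - y|) 0 1 ler01.
rewrite scale1r subrKC scale0r addr0 mulr1 mulr0 subr0; apply.
- move=> s /Ks Ws; apply: (C1_comp_segment oV f1); apply: rV.
  exact: le_trans Ws rr.
- move=> s _; have -> : (fun s : R => L * rho * `|x - y| * s) =
    (L * rho * `|x - y|) \*: id by [].
  by apply: is_derive_eq; rewrite /GRing.scale /= mulr1.
- by move=> s /Ks; exact: jb.
Qed.

Variables (l n : nat) (A : 'M[R]_n) (J : 'M[R]_(l, n)) (v : 'cV[R]_n)
  (w : 'rV[R]_n) (delta c : R).
Hypothesis hlin : linear_data A J v w delta c.
Variables (V : set 'cV[R]_n) (f : 'cV[R]_n -> 'cV[R]_n).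
Hypotheses (V_open : open V) (V_0 : V 0) (f_smooth : forall k, Ckv k V f)
  (f0 : f 0 = 0) (df0 : jac f 0 = 0).

Definition slow_coord (x : 'cV[R]_n) : R := (w *m x) ord0 ord0.

Local Notation ws := slow_coord.

Lemma slow_coordE x : v *m (w *m x) = ws x *: v.
Proof. by rewrite {1}[w *m x]mx11_scalar mul_mx_scalar. Qed.

Lemma slow_coordD x y : ws (x + y) = ws x + ws y.
Proof. by rewrite /ws mulmxDr mxE. Qed.

Lemma slow_coordZ a x : ws (a *: x) = a * ws x.
Proof. by rewrite /ws -scalemxAr mxE. Qed.

Lemma slow_coordB x y : ws (x - y) = ws x - ws y.
Proof. by rewrite slow_coordD -scaleN1r slow_coordZ mulN1r. Qed.

Lemma slow_coord0 : ws 0 = 0.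
Proof. by rewrite /ws mulmx0 mxE. Qed.

Lemma slow_coord_v : ws v = 1.
Proof. by rewrite /ws (lin_wv hlin) mxE. Qed.

Lemma slow_coord_A x : ws (A *m x) = 0.
Proof. by rewrite /ws mulmxA (lin_wA hlin) mul0mx mxE. Qed.

Lemma slow_coord_bound : exists2 C : R, 0 < C & forall x, `|ws x| <= C * `|x|.
Proof.
have [C C0 hC] := mulmx_bound w; exists C => // x.
by apply: le_trans (hC x); exact: mx_coord_le.
Qed.

Lemma slow_coord_continuous : continuous ws.
Proof.
move=> x; have [C C0 hC] := slow_coord_bound.
apply: (@lipschitz_at _ _ _ setT _ C) => //; first exact: openT.
by move=> y _; rewrite -slow_coordB.
Qed.

(** The points where the field is a multiple of [v], as in a Lyapunov-Schmidt reduction; since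
    [w *m A = 0] and [w *m v = 1], the multiplier can only be the slow coordinate of f p. *)
Definition slow (p : 'cV[R]_n) := A *m p + f p = ws (f p) *: v.

Lemma slow0 : slow 0.
Proof. by rewrite /slow f0 mulmx0 addr0 slow_coord0 scale0r. Qed.

(** Deflation of the zero eigenvalue. Applying w to a kernel vector y gives w y = 0, hence A y = 0;
    the dissipation then forces J y = 0, and y = 0. *)
Lemma deflated_unit : A + v *m w \in unitmx.
Proof.
rewrite unitmxE unitfE -det_tr; apply/negP => /det0P [y yn yB].
have hy : (A + v *m w) *m y^T = 0 by rewrite -[X in X *m _]trmxK -trmx_mul yB trmx0.
have e1 : w *m y^T = 0.
  have := congr1 (mulmx w) hy.
  by rewrite mulmx0 mulmxA mulmxDr (lin_wA hlin) add0r mulmxA (lin_wv hlin) mul1mx.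
have e2 : A *m y^T = 0.
  by move: hy; rewrite mulmxDl -mulmxA e1 mulmx0 addr0.
have := lin_diss hlin y^T; rewrite e2 mulmx0 inner0r mulNr oppr_ge0.
rewrite pmulr_rle0 ?(lin_delta hlin) // => h.
have := le_trans (sqr_norm_le_inner _) h => h'.
have : `|J *m y^T| ^+ 2 == 0 by rewrite eq_le h' sqr_ge0.
rewrite sqrf_eq0 => /eqP J0; have := lin_PJ hlin y^T.
rewrite J0 mulr0 e1 mulmx0 subr0 normr_le0 => /eqP e.
by move: yn; rewrite -[y]trmxK e trmx0 eqxx.
Qed.

Let Mi := invmx (A + v *m w).

Let MiE x : Mi *m (A *m x + ws x *: v) = x.
Proof.
by rewrite -slow_coordE mulmxA -mulmxDl mulKmx // deflated_unit.
Qed.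

Let P_bound : exists2 C : R, 0 < C & forall x, `|Mi *m (x - ws x *: v)| <= C * `|x|.
Proof.
have [C C0 hC] := mulmx_bound (Mi *m (1%:M - v *m w)); exists C => // x.
apply: le_trans (hC x); rewrite -mulmxA mulmxBl mul1mx -mulmxA slow_coordE.
exact: lexx.
Qed.

(** Slow points are the solutions of p = s v - Mi (f p - ws(f p) v) with s = ws p, whose last term
    has Lipschitz constant 1/2 on a small ball. This one equation yields the Lipschitz dependence on
    s, the tangency to [v] and, by the fixed point theorem, the existence for every small s. *)
Lemma slow_estimates : exists r k : R,
  [/\ [/\ 0 < r, 0 < k & forall x, `|x| <= r -> V x],
  forall p q, `|p| <= r -> `|q| <= r -> slow p -> slow q ->
    `|p - q| <= k * `|ws p - ws q|,
  forall p, `|p| <= r -> slow p -> `|p - ws p *: v| <= k * `|ws p| ^+ 2 &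
  exists2 s0 : R, 0 < s0 & forall s, `|s| <= s0 ->
    exists p, [/\ `|p| <= r, slow p & ws p = s]].
Proof.
have [L [r1 [L0 r10 r1V hL]]] := quad_lipschitz V_open V_0 (f_smooth 2) df0.
have [C C0 hC] := P_bound; have [C2 C20 hC2] := mulmx_bound Mi.
(* The radius makes C L r at most 1/2, with C the norm of x |-> Mi (x - ws x v). *)
pose r := Num.min r1 (2 * (C * L))^-1.
have CL0 : 0 < 2 * (C * L) by rewrite !mulr_gt0.
have r0 : 0 < r by rewrite lt_min r10 invr_gt0.
have rr1 : r <= r1 by rewrite ge_min lexx.
have CLr : C * L * r <= 2^-1.
  have : r <= (2 * (C * L))^-1 by rewrite ge_min lexx orbT.
  by rewrite invfM -ler_pdivrMr ?invr_gt0 ?mulr_gt0 // invrK mulrC.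
clearbody r.
pose k1 := 2 * (C2 * `|v|).
have k10 : 0 <= k1 by rewrite !mulr_ge0 // ltW.
have lip p q : `|p| <= r -> `|q| <= r -> slow p -> slow q ->
    `|p - q| <= k1 * `|ws p - ws q|.
  move=> pr qr sp sq.
  have e : p - q = - (Mi *m ((f p - f q) - ws (f p - f q) *: v)) +
     (ws p - ws q) *: (Mi *m v).
    rewrite -{1}(MiE (p - q)) -mulmxN scalemxAr -mulmxDr; congr (_ *m _).
    have Ap : A *m p = ws (f p) *: v - f p by rewrite -sp addrK.
    have Aq : A *m q = ws (f q) *: v - f q by rewrite -sq addrK.
    rewrite mulmxBr Ap Aq !slow_coordB.
    move: (f p) (f q) (ws _) (ws _) (ws _) (ws _) => fp fq a b d g.
    by apply/matrixP => i j; rewrite !mxE; ring.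
  have h1 : `|p - q| <= 2^-1 * `|p - q| + `|ws p - ws q| * (C2 * `|v|).
    rewrite {1}e; apply: le_trans (ler_normD _ _) _; rewrite normrN normrZ.
    apply: lerD; last by apply: ler_wpM2l.
    apply: le_trans (hC _) _.
    have [h _] := hL r p q rr1 pr qr.
    apply: le_trans (ler_wpM2l (ltW C0) h) _; rewrite !mulrA.
    exact: ler_wpM2r.
  rewrite /k1; lra.
pose k := k1 + C * L * k1 ^+ 2 + 1.
have k0 : 0 < k.
  by rewrite ltr_wpDl // addr_ge0 // mulr_ge0 ?sqr_ge0 // ltW // mulr_gt0.
have kk1 : k1 <= k.
  by rewrite /k -addrA lerDl addr_ge0 // mulr_ge0 ?sqr_ge0 // ltW // mulr_gt0.
exists r, k; split.
- by split => // x xr; apply: r1V; exact: le_trans xr rr1.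
- move=> p q pr qr sp sq; apply: le_trans (lip _ _ pr qr sp sq) _.
  exact: ler_wpM2r.
- move=> p pr sp.
  have e : p - ws p *: v = - (Mi *m (f p - ws (f p) *: v)).
    rewrite -[LHS]MiE -mulmxN; congr (_ *m _).
    rewrite mulmxBr -scalemxAr (lin_Av hlin) scaler0 subr0.
    rewrite slow_coordB slow_coordZ slow_coord_v mulr1 subrr scale0r addr0.
    by rewrite opprB -sp addrK.
  have pk : `|p| <= k1 * `|ws p|.
    have z0 : `|0 : 'cV[R]_n| <= r by rewrite normr0 ltW.
    by have := lip p 0 pr z0 sp slow0; rewrite subr0 slow_coord0 subr0.
  have zp : `|0 : 'cV[R]_n| <= `|p| by rewrite normr0.
  have [h _] := hL _ p 0 (le_trans pr rr1) (lexx _) zp.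
  rewrite f0 !subr0 in h.
  rewrite e normrN; apply: le_trans (hC _) _.
  apply: le_trans (ler_wpM2l (ltW C0) h) _.
  apply: le_trans (_ : C * L * k1 ^+ 2 * `|ws p| ^+ 2 <= _); last first.
    apply: ler_wpM2r; first exact: exprn_ge0.
    by rewrite /k; lra.
  rewrite [leLHS](_ : _ = C * L * `|p| ^+ 2); last by ring.
  rewrite [leRHS](_ : _ = C * L * (k1 * `|ws p|) ^+ 2); last by ring.
  apply: ler_wpM2l; first by rewrite mulr_ge0 // ltW.
  have q0 : 0 <= k1 * `|ws p| := mulr_ge0 k10 (normr_ge0 _).
  by rewrite ler_pXn2r ?nnegrE.
pose rho := r / 2.
have rho0 : 0 < rho by rewrite divr_gt0.
exists (rho / (`|v| + 1)); first by rewrite divr_gt0 // ltr_wpDl.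
move=> s hs.
have sv : `|s *: v| <= rho.
  rewrite normrZ; apply: le_trans (_ : `|s| * (`|v| + 1) <= _).
    by apply: ler_wpM2l => //; rewrite lerDl.
  by rewrite -ler_pdivlMr // ltr_wpDl.
have svy y : `|y| <= rho -> `|s *: v + y| <= r.
  move=> yr; apply: le_trans (ler_normD _ _) _.
  by apply: le_trans (lerD sv yr) _; rewrite /rho; lra.
have fb p : `|p| <= r -> C * `|f p| <= rho.
  move=> pr; have z0 : `|0 : 'cV[R]_n| <= r by rewrite normr0 ltW.
  have [h _] := hL r p 0 rr1 pr z0; rewrite f0 !subr0 in h.
  apply: le_trans (ler_wpM2l (ltW C0) h) _; rewrite !mulrA.
  apply: le_trans (ler_wpM2r (normr_ge0 _) CLr) _.
  by rewrite /rho; lra.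
have [] := @contraction_ball n (fun y => - (Mi *m (f (s *: v + y) - ws (f (s *: v + y)) *: v)))
  rho (ltW rho0).
- move=> y /svy yr; rewrite normrN; apply: le_trans (hC _) _.
  exact: fb.
- move=> x y /svy xr /svy yr.
  rewrite opprK addrC -mulmxBr.
  have -> : f (s *: v + y) - ws (f (s *: v + y)) *: v -
    (f (s *: v + x) - ws (f (s *: v + x)) *: v) =
    (f (s *: v + y) - f (s *: v + x)) - ws (f (s *: v + y) - f (s *: v + x)) *: v.
    rewrite slow_coordB; move: (f _) (f _) (ws _) (ws _) => fx fy a b.
    by apply/matrixP => i j; rewrite !mxE; ring.
  apply: le_trans (hC _) _.
  have [h _] := hL r _ _ rr1 yr xr.
  apply: le_trans (ler_wpM2l (ltW C0) h) _.
  rewrite opprD addrACA subrr add0r distrC !mulrA.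
  exact: ler_wpM2r.
move=> y yr ey; set p := s *: v + y in ey.
have Ap : A *m y + ws y *: v = - (f p - ws (f p) *: v).
  have := congr1 (mulmx (A + v *m w)) ey.
  rewrite mulmxN mulKVmx ?deflated_unit // => ->.
  by rewrite mulmxDl -mulmxA slow_coordE.
(* The correction y has no slow coordinate, so that s v + y keeps the prescribed one. *)
have wy : ws y = 0.
  have := congr1 ws Ap; rewrite slow_coordD slow_coord_A add0r slow_coordZ slow_coord_v.
  rewrite -scaleN1r slow_coordZ slow_coordB slow_coordZ slow_coord_v !mulr1.
  by rewrite subrr mulr0.
exists p; split; first exact: svy.
  rewrite /slow mulmxDr -scalemxAr (lin_Av hlin) scaler0 add0r.
  by move: Ap; rewrite wy scale0r addr0 => ->; rewrite opprB subrK.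
by rewrite slow_coordD slow_coordZ slow_coord_v wy mulr1 addr0.
Qed.

End SlowCurve.

(** * A non-flat first integral produces a curve of singular points *)

Section NecessaryCondition.
Context {R : realType}.
Variables (l n : nat) (A : 'M[R]_n) (J : 'M[R]_(l, n)) (v : 'cV[R]_n)
  (w : 'rV[R]_n) (delta c : R).
Hypothesis hlin : linear_data A J v w delta c.

Local Notation ws := (slow_coord w).

(** w z is conserved and J z decays, so z tends to the projection of x on the line of [v]. *)
Lemma linear_flow (x : 'cV[R]_n) : exists z : R -> 'cV[R]_n,
  [/\ z 0 = x, forall t : R, 0 <= t -> is_derive t (1 : R) z (A *m z t),
      z @ +oo --> ws x *: v &
      exists2 B : R, 0 < B & forall t, 0 <= t -> `|z t| <= B].
Proof.
have [a a0 ha] := mulmx_bound A; have [j j0 hj] := mulmx_bound J.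
have [] := @picard_global R n (fun _ y => A *m y) (a + 1) (a * `|x|) x.
- move=> y cy t; apply: (@continuous_comp _ _ _ y (fun y => A *m y)).
    exact: cy.
  exact: mulmx_continuous.
- by rewrite lerDr ltW.
- move=> t y y' _; rewrite -mulmxBr; apply: le_trans (ha _) _.
  by apply: ler_wpM2r => //; rewrite lerDl.
- by move=> t _; exact: ha.
move=> z [z0 hz]; exists z.
have wz t : 0 <= t -> w *m z t = w *m x.
  move=> t0; have := @deriv_norm_le_cV R 1 (fun s => w *m z s) (fun=> 0)
    (fun=> 0) (fun=> 0) 0 t t0.
  rewrite subrr z0 => H; apply/eqP; rewrite -subr_eq0 -normr_le0; apply: H.
  - move=> s; rewrite in_itv /= => /andP[s0 _].
    have := is_derive_mulmx w (hz s s0).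
    by rewrite mulmxA (lin_wA hlin) mul0mx.
  - by move=> s _; rewrite normr0.
have tail t : 0 <= t -> `|z t - ws x *: v| <=
    c * ((l%:R + 1) * (j * `|x|)) * expR (- delta * t).
  move=> t0; rewrite -slow_coordE -(wz t t0).
  apply: le_trans (lin_PJ hlin _) _; rewrite -[leRHS]mulrA.
  rewrite ler_pM2l ?(lin_c hlin) //.
  apply: le_trans (@inner_decay R l (fun s => J *m z s) (fun s => J *m (A *m z s))
    delta _ _ t t0) _.
  - by move=> s s0; exact: (is_derive_mulmx J (hz s s0)).
  - by move=> s s0; exact: (lin_diss hlin).
  apply: ler_wpM2r; first exact: expR_ge0.
  by rewrite z0; apply: ler_wpM2l; rewrite ?addr_ge0.
split => //.
  exact: exp_close_cvg (lin_delta hlin) tail.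
set k := c * _ in tail.
have k0 : 0 <= k.
  by rewrite mulr_ge0 ?(ltW (lin_c hlin)) // !mulr_ge0 ?addr_ge0 // ltW.
exists (k + `|ws x *: v| + 1); first by rewrite ltr_wpDl // addr_ge0.
move=> t t0; rewrite -(subrK (ws x *: v) (z t)).
apply: le_trans (ler_normD _ _) _; rewrite -addrA; apply: lerD; last by rewrite lerDl.
apply: le_trans (tail t t0) _; rewrite -[leRHS]mulr1; apply: ler_wpM2l => //.
by rewrite -expR0 ler_expR mulNr oppr_le0 mulr_ge0 // ltW // (lin_delta hlin).
Qed.

Variables (V : set 'cV[R]_n) (f : 'cV[R]_n -> 'cV[R]_n).
Hypotheses (V_open : open V) (V_0 : V 0) (f_smooth : forall k, Ckv k V f)
  (f0 : f 0 = 0) (df0 : jac f 0 = 0).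

Variables (U : set 'cV[R]_n) (H : 'cV[R]_n -> R).
Hypotheses (oU : open U) (U0 : U 0) (H_smooth : Cinf U H)
  (H0 : H 0 = 0)
  (H_inv : forall x, U x ->
     \sum_i partial i H x * (A *m x + f x) i ord0 = 0)
  (H_nonflat : exists s, iter_partial s H 0 != 0).

(** The leading degree is m + 1; it is at least 1 because H vanishes at 0. *)
Lemma leading_order : exists m, flat_below m.+1 H /\ ~ flat_below m.+2 H.
Proof.
apply: contrapT => hn.
have hall m : flat_below m.+1 H.
  elim: m => [|m IH]; first by case=> // _; exact: H0.
  by apply: contrapT => hm; apply: hn; exists m.
have [s] := H_nonflat; rewrite (hall (size s) s) ?eqxx //.
Qed.

(* The leading homogeneous part is constant along the linear flow, which tends
   to the kernel of the linear part. *)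
Lemma leading_part m x : flat_below m.+1 H ->
  homog m.+1 H x = ws x ^+ m.+1 * homog m.+1 H v.
Proof.
move=> hf; have [z [z0 hz zlim [B B0 zB]]] := linear_flow x.
have [rU rU0 hrU] := ball_cV_sub oU U0.
have [L [rV [L0 rV0 _ hL]]] := quad_lipschitz V_open V_0 (f_smooth 2) df0.
pose r := Num.min rU rV.
have r0 : 0 < r by rewrite lt_min rU0.
have rW y : `|y| <= r -> U y.
  move=> hy; rewrite -[y]add0r; apply: hrU; apply: le_trans hy _.
  by rewrite ge_min lexx.
have fq y : `|y| <= r -> `|f y| <= L * `|y| ^+ 2.
  move=> hy; have zy : `|0 : 'cV[R]_n| <= `|y| by rewrite normr0.
  have yV : `|y| <= rV by apply: le_trans hy _; rewrite ge_min lexx orbT.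
  have [h _] := hL _ y 0 yV (lexx `|y|) zy.
  by rewrite f0 !subr0 -mulrA -expr2 in h.
have [C C0 hC] := taylor_homog oU (ltW r0) rW H_smooth hf.
have [D D0 hD] : exists2 D : R, 0 < D & forall j y, `|y| <= r ->
    `|partial j H y| <= D * `|y| ^+ m.
  apply: finite_bound => [j a b ab h y hy|j].
    by apply: le_trans (h y hy) _; apply: ler_wpM2r => //; rewrite exprn_ge0.
  apply: (flat_bound oU (ltW r0) rW); first exact: Cinf_partial.
  exact: flat_below_partial.
have const t : 0 <= t -> homog m.+1 H (z t) = homog m.+1 H x.
  move=> t0; apply/eqP; rewrite -subr_eq0 -normr_le0.
  pose k := n%:R * (D * L * B ^+ m.+2).
  apply: (@le0_of_small _ _ (k * t + 2 * (C * B ^+ m.+2)) (r / B)).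
  - by rewrite divr_gt0.
  - have B1 := ltW B0; have C1 := ltW C0; have D1 := ltW D0; have L1 := ltW L0.
    have k0 : 0 <= k.
      apply: (mulr_ge0 (ler0n _ _)); apply: mulr_ge0; last exact: exprn_ge0.
      exact: mulr_ge0.
    apply: addr_ge0; first exact: mulr_ge0.
    by apply: mulr_ge0 => //; apply: mulr_ge0 => //; exact: exprn_ge0.
  move=> tau tau0 taur.
  have tz s : 0 <= s -> `|tau *: z s| <= tau * B /\ `|tau *: z s| <= r.
    move=> s0; have h : `|tau *: z s| <= tau * B.
      by rewrite normrZ gtr0_norm // ler_pM2l // zB.
    by split => //; apply: le_trans h _; rewrite -ler_pdivlMr.
  (* H is followed along tau z, an orbit of the linear part. Its derivative there is minus the
     derivative of H along f, of order tau^m tau^2, so H varies by O(tau^(m+2)) only; dividing by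
     tau^(m+1) shows that the leading part does not vary. *)
  have step := @deriv_norm_le R (fun s => H (tau *: z s))
    (fun s => \sum_i (tau *: (A *m z s)) i ord0 * partial i H (tau *: z s))
    (fun s => tau ^+ m.+2 * k * s) (fun=> tau ^+ m.+2 * k) 0 t t0.
  have {}step : `|H (tau *: z t) - H (tau *: x)| <= tau ^+ m.+2 * k * t.
    have := step _ _ _; rewrite z0 mulr0 subr0; apply.
    - move=> s; rewrite in_itv /= => /andP[s0 _]; have [_ sr] := tz s s0.
      have hs : is_derive s (1 : R) (fun s => tau *: z s) (tau *: (A *m z s)).
        by apply: is_deriveZ; exact: hz.
      exact: (is_derive_C1_comp (z := fun s : R => tau *: z s) oU (H_smooth 1%N) (rW _ sr) hs).
    - move=> s _; have -> : (fun s : R => tau ^+ m.+2 * k * s) =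
        (tau ^+ m.+2 * k) \*: id by [].
      by apply: is_derive_eq; rewrite /GRing.scale /= mulr1.
    - move=> s; rewrite in_itv /= => /andP[s0 _]; have [sB sr] := tz s s0.
      set y := tau *: z s in sB sr *.
      have -> : \sum_i (tau *: (A *m z s)) i ord0 * partial i H y =
          - \sum_i partial i H y * f y i ord0.
        apply/eqP; rewrite -addr_eq0 -big_split /=; apply/eqP.
        rewrite -[RHS](H_inv (rW _ sr)); apply: eq_bigr => i _.
        by rewrite [in RHS]mxE /y -scalemxAr; ring.
      rewrite normrN; apply: le_trans (ler_norm_sum_const (c := D * L * `|y| ^+ m.+2) _) _.
        move=> i; rewrite normrM.
        have -> : D * L * `|y| ^+ m.+2 = (D * `|y| ^+ m) * (L * `|y| ^+ 2).
          by rewrite -addn2 exprD; ring.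
        apply: ler_pM => //; first exact: hD.
        by apply: le_trans (mx_coord_le _ _ _) _; exact: fq.
      have -> : tau ^+ m.+2 * k = n%:R * (D * L * (tau * B) ^+ m.+2).
        by rewrite exprMn /k; ring.
      apply: ler_wpM2l; first exact: ler0n.
      apply: ler_wpM2l; first by apply: mulr_ge0; exact: ltW.
      by rewrite ler_pXn2r ?nnegrE // mulr_ge0 // ltW.
  have tm0 : 0 < tau ^+ m.+1 by rewrite exprn_gt0.
  have hz1 s : 0 <= s -> `|H (tau *: z s) - tau ^+ m.+1 * homog m.+1 H (z s)| <=
      tau ^+ m.+2 * (C * B ^+ m.+2).
    move=> s0; have [sB sr] := tz s s0.
    rewrite -homog_scale; apply: le_trans (hC _ sr) _.
    rewrite [leRHS]mulrCA -exprMn; apply: ler_wpM2l; first exact: ltW.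
    by rewrite ler_pXn2r ?nnegrE // mulr_ge0 // ltW.
  have e1 := hz1 t t0; have e2 := hz1 0 (lexx 0); rewrite z0 in e2.
  rewrite -(ler_pM2l tm0) -[X in X * `|_|](gtr0_norm tm0) -normrM mulrBr.
  set a := tau ^+ m.+1 * homog _ _ _ in e1 *; set b := tau ^+ m.+1 * homog _ _ _ in e2 *.
  have -> : a - b = - (H (tau *: z t) - a) + ((H (tau *: z t) - H (tau *: x)) +
     (H (tau *: x) - b)) by ring.
  apply: le_trans (ler_normD _ _) _; rewrite normrN.
  apply: le_trans (lerD e1 (le_trans (ler_normD _ _) (lerD step e2))) _.
  by rewrite le_eqVlt; apply/orP; left; apply/eqP; rewrite [tau ^+ m.+2]exprS; ring.
have hlim : (fun t => homog m.+1 H (z t)) @ +oo --> homog m.+1 H (ws x *: v).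
  exact: (cvg_comp _ _ zlim (@homog_continuous R n m.+1 H (ws x *: v))).
rewrite -homog_scale.
apply: (@cvg_unique _ (@Rhausdorff R) ((fun t => homog m.+1 H (z t)) @ +oo)) => //.
apply: cvg_near_cst; exists 0; split; first exact: num_real.
by move=> t /ltW t0; exact: const.
Qed.

Lemma slow_is_singular : exists2 eta : R, 0 < eta &
  forall p, `|p| <= eta -> slow A v w f p -> A *m p + f p = 0.
Proof.
have [m [hf hnf]] := leading_order.
have [rU rU0 hrU] := ball_cV_sub oU U0.
have rW y : `|y| <= rU -> U y by move=> hy; rewrite -[y]add0r; exact: hrU.
have Pv : homog m.+1 H v != 0.
  apply/eqP => Pv0; apply: hnf; apply: (homog_eq0_flat oU rU0 rW) => // x.
  by rewrite (leading_part x hf) Pv0 mulr0.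
(* The part of degree m of the derivative of H along v; by Euler's identity its value at v is (m +
   1) times that of the leading part of H. *)
pose G x := \sum_j v j ord0 * homog m (partial j H) x.
have Gv : G v != 0.
  apply: contra_neq Pv => Gv0 /=; rewrite -/(G v) Gv0 mulr0 //.
have cG : continuous G.
  move=> x; have oT : open [set: 'cV[R]_n] := openT.
  apply: (@Ck_cont _ _ 0 setT) => //; apply: (Ck_sum _ oT) => j.
  apply: (Ck_mul oT); [exact: Ck_cst|exact: Cinf_homog].
have G2 : 0 < `|G v| / 2 by rewrite divr_gt0 // normr_gt0.
have [d d0 hd] : exists2 d : R, 0 < d & forall y, `|y| <= d -> `|G (v + y) - G v| <= `|G v| / 2.
  have /cvgrPdist_le /(_ _ G2) /nbhs_ballP [d /= d0 hd] := cG v.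
  exists (d / 2); first by rewrite divr_gt0.
  move=> y yd; rewrite distrC; apply: hd.
  rewrite -ball_normE /= opprD addNKr normrN.
  by apply: le_lt_trans yd _; rewrite ltr_pdivrMr // ltr_pMr // ltr1n.
have [D D0 hD] : exists2 D : R, 0 < D & forall j y, `|y| <= rU ->
    `|partial j H y - homog m (partial j H) y| <= D * `|y| ^+ m.+1.
  apply: finite_bound => [j a b ab h y hy|j].
    by apply: le_trans (h y hy) _; apply: ler_wpM2r => //; rewrite exprn_ge0.
  apply: (taylor_homog oU (ltW rU0) rW); first exact: Cinf_partial.
  exact: flat_below_partial.
have [r [k [[r0 k0 rV] hlip hquad _]]] :=
  slow_estimates hlin V_open V_0 f_smooth f0 df0.
have [W W0 hW] := slow_coord_bound w.
pose Q := n%:R * (`|v| * (D * k ^+ m.+1)) + 1.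
have Q0 : 0 < Q.
  by rewrite ltr_wpDl // !mulr_ge0 ?exprn_ge0 // ltW.
(* The first bound keeps v + y where |G| is at least |G v| / 2, the second makes the Taylor error,
   relative to |s|^m, at most |G v| / 4. *)
pose sg := Num.min (d / k) (`|G v| / 2 / Q / 2).
have sg0 : 0 < sg by rewrite lt_min !divr_gt0 // normr_gt0.
pose eta := Num.min (Num.min r rU) (sg / W).
exists eta; first by rewrite !lt_min r0 rU0 divr_gt0.
move=> p; rewrite !le_min => /andP[/andP[pr pU] pW] sp.
set s := ws p.
have ssg : `|s| <= sg.
  by apply: le_trans (hW p) _; rewrite mulrC -ler_pdivlMr.
have z0 : `|0 : 'cV[R]_n| <= r by rewrite normr0 ltW.
have pk : `|p| <= k * `|s|.
  have := hlip p 0 pr z0 sp (slow0 A v w f0); rewrite subr0 slow_coord0 subr0.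
  exact.
have [s00|sn0] := eqVneq s 0.
  have p0 : p = 0.
    by apply/eqP; rewrite -normr_le0; apply: le_trans pk _; rewrite s00 normr0 mulr0.
  by rewrite p0 mulmx0 f0 addr0.
have sp0 : 0 < `|s| by rewrite normr_gt0.
pose y := s^-1 *: (p - s *: v).
have pE : p = s *: (v + y).
  by rewrite /y scalerDr scalerA mulfV // scale1r subrKC.
have yd : `|y| <= d.
  rewrite /y normrZ normfV ler_pdivrMl //; apply: le_trans (hquad p pr sp) _.
  rewrite -/s expr2 mulrA mulrC; apply: ler_wpM2l => //.
  rewrite -ler_pdivlMl // mulrC; apply: le_trans ssg _.
  by rewrite ge_min lexx.
have DH : \sum_j v j ord0 * partial j H p != 0.
  have h1 : `|\sum_j v j ord0 * partial j H p - G p| <=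
      n%:R * (`|v| * (D * k ^+ m.+1)) * `|s| ^+ m.+1.
    rewrite /G -sumrB -mulrA; apply: ler_norm_sum_const => j.
    rewrite -mulrBr normrM -mulrA; apply: ler_pM => //; first exact: mx_coord_le.
    apply: le_trans (hD j p pU) _; rewrite -mulrA ler_pM2l // -exprMn.
    by rewrite ler_pXn2r ?nnegrE ?mulr_ge0 // ltW.
  have GE : G p = s ^+ m * G (v + y).
    rewrite {1}pE /G mulr_sumr; apply: eq_bigr => j _.
    by rewrite homog_scale mulrCA.
  have h2 : `|G v| / 2 <= `|G (v + y)|.
    have := hd y yd; have := ler_distD 0 (G v) (G (v + y)).
    rewrite subr0 sub0r normrN => _ h.
    have := ler_normD (G v - G (v + y)) (G (v + y)); rewrite subrK distrC.
    by lra.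
  apply/eqP => e0; rewrite e0 sub0r normrN GE normrM normrX in h1.
  have sm : 0 < `|s| ^+ m by rewrite exprn_gt0.
  rewrite [`|s| ^+ m.+1]exprSr mulrCA ler_pM2l // in h1.
  have h3 : Q * `|s| <= `|G v| / 2 / 2.
    rewrite -ler_pdivlMl // mulrC; apply: le_trans ssg _.
    by rewrite ge_min [`|G v| / 2 / Q / 2]mulrAC lexx orbT.
  have h4 : n%:R * (`|v| * (D * k ^+ m.+1)) * `|s| <= Q * `|s|.
    by apply: ler_wpM2r => //; rewrite lerDl.
  by move: h1 h2 h3 h4 G2; lra.
have := H_inv (rW p pU); rewrite sp => e.
have e2 : ws (f p) * \sum_j v j ord0 * partial j H p = 0.
  rewrite -[RHS]e mulr_sumr; apply: eq_bigr => i _.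
  by rewrite !mxE; ring.
move/eqP: e2; rewrite mulf_eq0 (negbTE DH) orbF => /eqP e3.
by rewrite e3 scale0r.
Qed.

Lemma integral_singular_curve : exists C : set 'cV[R]_n,
  curve_through_origin C /\ (forall p, C p -> V p /\ A *m p + f p = 0).
Proof.
have [eta eta0 heta] := slow_is_singular.
have [r [k [[r0 k0 rV] hlip hquad [s0 s00 hs]]]] :=
  slow_estimates hlin V_open V_0 f_smooth f0 df0.
(* With this bound the curve stays in the ball where slow points are singular. *)
pose eps := Num.min s0 (eta / (k + 1)).
have k10 : 0 < k + 1 by rewrite addr_gt0.
have eps0 : 0 < eps by rewrite lt_min s00 divr_gt0.
have /choice [Y hY] : forall s : R, exists p, `|s| < eps ->
    [/\ `|p| <= r, slow A v w f p & ws p = s].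
  move=> s; have [se|_] := ltP `|s| eps; last by exists 0.
  have [|p hp] := hs s; last by exists p.
  by apply: le_trans (ltW se) _; rewrite ge_min lexx.
have itvE s : s \in `]- eps, eps[%R -> `|s| < eps.
  by rewrite in_itv /= ltr_norml.
have Ylip s t : `|s| < eps -> `|t| < eps -> `|Y s - Y t| <= k * `|s - t|.
  move=> /hY [a1 a2 a3] /hY [b1 b2 b3].
  by have := hlip _ _ a1 b1 a2 b2; rewrite a3 b3.
have z0 : `|0 : 'cV[R]_n| <= r by rewrite normr0 ltW.
have Y0 : Y 0 = 0.
  have [|a1 a2 a3] := hY 0; first by rewrite normr0.
  apply/eqP; rewrite -normr_le0.
  have := hlip _ _ a1 z0 a2 (slow0 A v w f0).
  by rewrite a3 slow_coord0 subrr normr0 mulr0 subr0.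
exists (Y @` `]- eps, eps[); split.
  exists eps, Y; split => //.
  - apply: continuous_in_subspaceT => s /set_mem /= /itvE se.
    have oI : open [set t : R | `|t| < eps].
      by apply: (@open_norm_lt R R R id) => t; exact: cvg_id.
    by apply: (lipschitz_at oI se k0) => t te; exact: Ylip.
  (* The slow coordinate is a left inverse of the curve. *)
  - move=> s t /itvE se /itvE te e.
    by have [_ _ <-] := hY s se; have [_ _ <-] := hY t te; rewrite e.
move=> _ [s /itvE se <-]; have [a1 a2 a3] := hY s se.
split; first exact: rV.
apply: heta => //.
have := Ylip s 0 se; rewrite normr0 Y0 !subr0 => /(_ eps0) /le_trans; apply.
apply: le_trans (_ : (k + 1) * `|s| <= _); first by apply: ler_wpM2r => //; rewrite lerDl.
rewrite -ler_pdivlMl // mulrC; apply: le_trans (ltW se) _.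
by rewrite ge_min lexx orbT.
Qed.

End NecessaryCondition.

(** * From singular points to first integrals *)

Section CalculusComplements.
Context {R : realType}.

Lemma quad_is_derive (V W : normedModType R) (f : V -> W) a u l (C d : R) :
  0 < d -> 0 < C ->
  (forall h : R, `|h| <= d -> `|f (h *: u + a) - f a - h *: l| <= C * `|h| ^+ 2) ->
  is_derive a u f l.
Proof.
move=> d0 C0 hf; apply/is_derive_cvgP/cvgrPdist_le => e e0; near=> h.
have h0 : h != 0 by near: h; exact: nbhs_dnbhs_neq.
have hp : 0 < `|h| by rewrite normr_gt0.
rewrite distrC -(ler_pM2l hp) -normrZ scalerBr scalerA mulfV // scale1r.
apply: le_trans (hf h _) _.
  by near: h; apply: dnbhs0_le.
rewrite expr2 mulrCA ler_pM2l // -ler_pdivlMl // mulrC.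
by near: h; apply: dnbhs0_le; rewrite divr_gt0.
Unshelve. all: by end_near. Qed.

(** Needed because the first integral is known to be constant along orbits in forward time only. *)
Lemma right_cst_derive0 (W : normedModType R) (f : R -> W) l :
  is_derive (0 : R) (1 : R) f l -> (forall t : R, 0 <= t -> f t = f 0) -> l = 0.
Proof.
move=> /is_derive_cvgP /cvgrPdist_le hf hc.
apply/eqP; rewrite -normr_le0; apply/ler_addgt0Pr => e e0; rewrite add0r.
have [d /= d0 hd] := hf e e0.
have d20 : 0 < d / 2 by rewrite divr_gt0.
have := hd (d / 2); rewrite /= sub0r normrN gtr0_norm // => /(_ _ (lt0r_neq0 d20)).
rewrite [_%:A + 0]addr0 [X in f X](_ : _ = d / 2); last exact: mulr1.
rewrite (hc _ (ltW d20)) subrr scaler0 subr0; apply.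
by rewrite ltr_pdivrMr // ltr_pMr // ltr1n.
Qed.

Lemma norm_scale_delta n (h : R) j : `|h *: (delta_mx j ord0 : 'cV[R]_n)| <= `|h|.
Proof.
rewrite normrZ -[leRHS]mulr1; apply: ler_wpM2l => //; apply: cV_norm_le => // i.
by rewrite !mxE; case: (_ && _); rewrite ?normr1 ?normr0.
Qed.

Lemma jac_quad0 n m k (W : set 'cV[R]_n) (F : 'cV[R]_n -> 'cV[R]_m) (C d : R) :
  open W -> W 0 -> Ckv k.+1 W F -> 0 < C -> 0 < d ->
  (forall x, `|x| <= d -> `|F x| <= C * `|x| ^+ 2) -> jac F 0 = 0.
Proof.
move=> oW W0 hF C0 d0 hq.
have F0 : F 0 = 0.
  have h : `|0 : 'cV[R]_n| <= d by rewrite normr0 ltW.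
  apply/eqP; rewrite -normr_le0; apply: le_trans (hq 0 h) _.
  by rewrite normr0 expr0n mulr0.
apply/matrixP => i j; rewrite !mxE; apply: derive_val.
apply: (@quad_is_derive _ _ _ _ _ _ C d) => // h hd.
have hn := norm_scale_delta (n := n) h j.
rewrite F0 addr0 scaler0 mxE !subr0; apply: le_trans (mx_coord_le _ _ _) _.
apply: le_trans (hq _ (le_trans hn hd)) _; rewrite ler_pM2l //.
by rewrite ler_pXn2r ?nnegrE.
Qed.

Lemma Ck_det n m k (W : set 'cV[R]_n) (M : 'cV[R]_n -> 'M[R]_m) : open W ->
  (forall i j, Ck k W (fun x => M x i j)) -> Ck k W (fun x => \det (M x)).
Proof.
move=> oW hM; apply: Ck_sum => // s; apply: Ck_mul => //; first exact: Ck_cst.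
by apply: Ck_prod => // i.
Qed.

(** The entries of the inverse are cofactors divided by the determinant. *)
Lemma Ck_invmx n m k (W : set 'cV[R]_n) (M : 'cV[R]_n -> 'M[R]_m) i j : open W ->
  (forall x, W x -> M x \in unitmx) ->
  (forall i j, Ck k W (fun x => M x i j)) -> Ck k W (fun x => invmx (M x) i j).
Proof.
move=> oW hu hM.
apply: (@eq_Ck _ _ _ _ (fun x => (\det (M x))^-1 * cofactor (M x) j i)) => //.
  by move=> x Wx; rewrite /invmx hu // !mxE.
apply: Ck_mul => //.
  apply: Ck_inv => //; first exact: Ck_det.
  by move=> x /hu; rewrite unitmxE unitfE.
apply: Ck_mul => //; first exact: Ck_cst.
apply: Ck_det => // a b; apply: (eq_Ck oW _ (hM (lift j a) (lift i b))) => x _.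
by rewrite !mxE.
Qed.

End CalculusComplements.

(** * A curve of singular points is a smooth graph *)

Section SingularGraph.
Context {R : realType}.
Variables (l n : nat) (A : 'M[R]_n) (J : 'M[R]_(l, n)) (v : 'cV[R]_n)
  (w : 'rV[R]_n) (delta c : R).
Hypothesis hlin : linear_data A J v w delta c.
Variables (V : set 'cV[R]_n) (f : 'cV[R]_n -> 'cV[R]_n).
Hypotheses (V_open : open V) (V_0 : V 0) (f_smooth : forall k, Ckv k V f)
  (f0 : f 0 = 0) (df0 : jac f 0 = 0).
Hypothesis curve : exists C : set 'cV[R]_n,
  curve_through_origin C /\ (forall p, C p -> V p /\ A *m p + f p = 0).

Local Notation ws := (slow_coord w).

Lemma singular_slow p : A *m p + f p = 0 -> slow A v w f p.
Proof.
move=> e; rewrite /slow e; have := congr1 ws e.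
by rewrite slow_coordD (slow_coord_A hlin) add0r slow_coord0 => ->; rewrite scale0r.
Qed.

(** Singular points are slow, so on the curve a point is determined by its slow coordinate. Along
    the parameter this coordinate is continuous and injective, hence strictly monotone; as 0 is
    interior to the parameter interval, every value near 0 is attained. No regularity of the
    parametrization is used. *)
Lemma singular_graph : exists (r k d : R) (Y : R -> 'cV[R]_n),
  [/\ [/\ 0 < r, 0 < k, 0 < d & forall x, `|x| <= r -> V x],
   forall s, `|s| < d -> [/\ `|Y s| <= r, A *m Y s + f (Y s) = 0 & ws (Y s) = s],
   forall s t, `|s| < d -> `|t| < d -> `|Y s - Y t| <= k * `|s - t| &
   forall s, `|s| < d -> `|Y s - s *: v| <= k * `|s| ^+ 2].
Proof.
have [C [[eps [g [e0 cg ig g0 CE]]] hC]] := curve.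
have [r [k [[r0 k0 rV] hlip hquad _]]] :=
  slow_estimates hlin V_open V_0 f_smooth f0 df0.
have gC t : t \in `]- eps, eps[ -> A *m g t + f (g t) = 0.
  by move=> te; have [] := hC (g t); [rewrite CE; exists t|].
have gat t : t \in `]- eps, eps[ -> {for t, continuous g}.
  move: cg; rewrite continuous_open_subspace; last exact: interval_open.
  by move=> h te; apply: h; rewrite inE.
have z0I : (0 : R) \in `]- eps, eps[ by rewrite in_itv /= oppr_lt0 e0.
have [e [e1 e2 ge]] : exists e, [/\ 0 < e, e < eps & forall t, `|t| <= e -> `|g t| <= r].
  have /cvgrPdist_le /(_ _ r0) /nbhs_ballP [d /= d0 hd] := gat 0 z0I.
  exists (Num.min (d / 2) (eps / 2)).
  have h2 (x : R) : 0 < x -> x / 2 < x by move=> x0; rewrite ltr_pdivrMr // ltr_pMr // ltr1n.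
  split; first by rewrite lt_min !divr_gt0.
    by rewrite gt_min h2 ?orbT.
  move=> t; rewrite le_min => /andP[td _]; have := hd t.
  rewrite g0 sub0r normrN; apply; rewrite -ball_normE /= sub0r normrN.
  by apply: le_lt_trans td _; exact: h2.
have eI t : t \in `[- e, e] -> t \in `]- eps, eps[.
  rewrite !in_itv /= => /andP[t1 t2]; apply/andP; split.
    by apply: lt_le_trans t1; rewrite ltrN2.
  exact: le_lt_trans t2 e2.
have eN t : t \in `[- e, e] -> `|t| <= e by rewrite in_itv /= ler_norml.
pose s t := ws (g t).
have s0 : s 0 = 0 by rewrite /s g0 slow_coord0.
have is_ : {in `[- e, e] &, injective s}.
  move=> t t' te t'e est; apply: ig; [exact: eI|exact: eI|].
  have := hlip _ _ (ge _ (eN _ te)) (ge _ (eN _ t'e)) (singular_slow (gC _ (eI _ te)))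
    (singular_slow (gC _ (eI _ t'e))).
  rewrite -/(s t) -/(s t') est subrr normr0 mulr0 normr_le0 subr_eq0.
  by move/eqP.
have cs : {within `[- e, e], continuous s}.
  apply: continuous_in_subspaceT => t /set_mem /= /eI /gat gt.
  have cw : continuous ws := @slow_coord_continuous _ _ w.
  exact: (continuous_comp gt (cw (g t))).
have me : - e \in `[- e, e] by rewrite in_itv /= lexx ge0_cp // ltW.
have pe : e \in `[- e, e] by rewrite in_itv /= lexx andbT ge0_cp // ltW.
have ze : 0 \in `[- e, e] by rewrite in_itv /= oppr_le0 ltW.
have ne : - e < e by rewrite gt0_cp.
have le_ne : - e <= e := ltW ne.
(* The values at the two ends have opposite signs, whether the slow coordinate increases or
   decreases. *)
have [d d0 hd] : exists2 d : R, 0 < d & forall a, `|a| < d ->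
    Num.min (s (- e)) (s e) <= a <= Num.max (s (- e)) (s e).
  have e0' : - e < 0 by rewrite oppr_lt0.
  have [hm|hm] := itv_continuous_inj_mono cs is_.
    have m1 := hm _ _ me ze e0'; have m2 := hm _ _ ze pe e1; rewrite s0 in m1 m2.
    exists (Num.min (- s (- e)) (s e)); first by rewrite lt_min oppr_gt0 m1.
    move=> a; rewrite lt_min !ltr_norml => /andP[/andP[+ _] /andP[_ a2]].
    by rewrite opprK => a1; rewrite ge_min le_max (ltW a1) (ltW a2) orbT.
  have m1 := hm _ _ ze me e0'; have m2 := hm _ _ pe ze e1; rewrite s0 in m1 m2.
  exists (Num.min (s (- e)) (- s e)); first by rewrite lt_min oppr_gt0 m1.
  move=> a; rewrite lt_min !ltr_norml => /andP[/andP[_ a2] /andP[+ _]].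
  by rewrite opprK => a1; rewrite ge_min le_max (ltW a1) (ltW a2) orbT.
have /choice [Y hY] : forall a : R, exists p, `|a| < d ->
    [/\ `|p| <= r, A *m p + f p = 0 & ws p = a].
  move=> a; have [ad|_] := ltP `|a| d; last by exists 0.
  have [t te <-] := IVT le_ne cs (hd a ad).
  by exists (g t) => _; split; [exact: ge (eN _ te)|exact: gC (eI _ te)|].
exists r, k, d, Y; split => //.
- move=> a b /hY [a1 /singular_slow a2 a3] /hY [b1 /singular_slow b2 b3].
  by have := hlip _ _ a1 b1 a2 b2; rewrite a3 b3.
- move=> a /hY [a1 /singular_slow a2 a3].
  by have := hquad _ a1 a2; rewrite a3.
Qed.

(** Differentiating A Y + f(Y) = 0 and ws Y = s gives M(Y) Y' = v with M = A + v w + Df, invertible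
    near 0: the graph solves Y' = M(Y)^-1 v and inherits its regularity. Here [q z] is Y' at ws z;
    everything is composed with [ws] because [Ck] speaks of functions of column vectors. *)
Lemma singular_graph_smooth : exists (k d : R) (Y : R -> 'cV[R]_n)
    (q : 'cV[R]_n -> 'cV[R]_n),
  [/\ 0 < k /\ 0 < d,
   forall s, `|s| < d ->
     [/\ V (Y s), A *m Y s + f (Y s) = 0, ws (Y s) = s &
         `|Y s - s *: v| <= k * `|s| ^+ 2],
   forall j, Ckv j [set z | `|ws z| < d] (fun z => Y (ws z)) /\
             Ckv j [set z | `|ws z| < d] q,
   forall z u, `|ws z| < d -> jac (fun z => Y (ws z)) z *m u = ws u *: q z &
   forall z, `|ws z| < d -> ws (q z) = 1].
Proof.
have [r [k [d1 [Y [[r0 k0 d10 rV] hY Ylip Yquad]]]]] := singular_graph.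
have [Cw Cw0 hCw] := slow_coord_bound w.
have cw : continuous ws := @slow_coord_continuous _ _ w.
pose M x := A + v *m w + jac f x.
have hM i j k' : Ck k' V (fun x => M x i j).
  apply: (@eq_Ck _ _ _ _ (fun x => (A + v *m w) i j + partial j (fun y => f y i ord0) x)) => //.
    by move=> x _; rewrite [in RHS]mxE [jac f x i j]mxE.
  by apply: Ck_add => //; [exact: Ck_cst|exact: (Ck_partial _ (f_smooth k'.+1 i))].
have [rho [rho0 rhor hdet]] : exists rho, [/\ 0 < rho, rho <= r &
    forall x, `|x| < rho -> M x \in unitmx].
  have c0 : {for 0, continuous (fun x => \det (M x))}.
    by apply: (Ck_cont (Ck_det (k := 0) V_open (fun i j => hM i j 0%N))).
  have u0 : 0 < `|\det (M 0)|.
    by rewrite normr_gt0 -unitfE -unitmxE /M df0 addr0; exact: deflated_unit hlin.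
  have /cvgrPdist_lt /(_ _ u0) /nbhs_ballP [dd /= dd0 hd] := c0.
  exists (Num.min dd r); split; [by rewrite lt_min dd0|by rewrite ge_min lexx orbT|].
  move=> x; rewrite lt_min => /andP[xd _]; rewrite unitmxE unitfE.
  have := hd x; rewrite -ball_normE /= sub0r normrN => /(_ xd).
  by apply: contraTneq => ->; rewrite subr0 ltxx.
have Y0 : Y 0 = 0.
  have z : `|0 : R| < d1 by rewrite normr0.
  by have := Yquad 0 z; rewrite scale0r subr0 normr0 expr0n mulr0 normr_le0 => /eqP.
pose d := Num.min d1 (rho / k).
have d0 : 0 < d by rewrite lt_min d10 divr_gt0.
have dd1 (s : R) : `|s| < d -> `|s| < d1 by rewrite lt_min => /andP[].
have Yrho (s : R) : `|s| < d -> `|Y s| < rho.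
  move=> sd; have z : `|0 : R| < d1 by rewrite normr0.
  have := Ylip s 0 (dd1 s sd) z; rewrite Y0 !subr0 => /le_lt_trans; apply.
  by rewrite -ltr_pdivlMl // mulrC; move: sd; rewrite lt_min => /andP[].
clearbody d.
pose Wd := [set z | `|ws z| < d].
have oW : open Wd by exact: open_norm_lt.
pose B := [set x : 'cV[R]_n | `|x| < rho].
have oB : open B by apply: (@open_norm_lt _ _ _ id) => x; exact: cvg_id.
have BV x : B x -> V x by move=> xB; apply: rV; apply: le_trans (ltW xB) rhor.
pose q0 x := invmx (M x) *m v.
have sq0 j : Ckv j B q0.
  move=> i; apply: (@eq_Ck _ _ _ _ (fun x => \sum_a invmx (M x) i a * v a ord0)) => //.
    by move=> x _; rewrite [RHS]mxE.
  apply: Ck_sum => // a; apply: Ck_mul => //; last exact: Ck_cst.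
  by apply: Ck_invmx => // i' j'; apply: sub_Ck (hM i' j' j).
pose g z := Y (ws z).
have gB z : Wd z -> B (g z) by move=> /Yrho.
have [L L0 hL] := second_order_bound V_open (f_smooth 2) (ball_compact (r := r)) rV
  (ball_convex (r := r)).
(* The second order expansion of f at Y t is inserted in the difference of the two equations of
   singular points, then M(Y t) is inverted. *)
have est (t : R) : `|t| < d -> exists2 C : R, 0 < C & forall s, `|s| < d ->
    `|Y s - Y t - (s - t) *: q0 (Y t)| <= C * `|s - t| ^+ 2.
  move=> td; have [C C0 hC] := mulmx_bound (invmx (M (Y t))).
  exists (C * (L * k ^+ 2)); first by rewrite !mulr_gt0 // exprn_gt0.
  move=> s sd; have [s1 s2 s3] := hY s (dd1 s sd); have [t1 t2 t3] := hY t (dd1 t td).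
  set E := f (Y s) - f (Y t) - jac f (Y t) *m (Y s - Y t).
  have e1 : M (Y t) *m (Y s - Y t) = (s - t) *: v - E.
    rewrite /M !mulmxDl -mulmxA slow_coordE slow_coordB s3 t3.
    rewrite addrAC addrC; congr (_ + _); rewrite mulmxBr.
    have -> : A *m Y s = - f (Y s) by apply/eqP; rewrite -addr_eq0 s2.
    have -> : A *m Y t = - f (Y t) by apply/eqP; rewrite -addr_eq0 t2.
    rewrite /E; move: (jac _ _ *m _) => a.
    by apply/matrixP => i j; rewrite !mxE; ring.
  have e2 : Y s - Y t - (s - t) *: q0 (Y t) = - (invmx (M (Y t)) *m E).
    apply/eqP; rewrite subr_eq [X in _ == X]addrC /q0 scalemxAr -mulmxBr -e1 mulKmx //.
    by apply: hdet; exact: Yrho.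
  rewrite e2 normrN; apply: le_trans (hC _) _; rewrite -!mulrA ler_pM2l //.
  apply: le_trans (hL _ _ t1 s1) _; rewrite ler_pM2l // [k * _]mulrA -expr2 -exprMn.
  by rewrite ler_pXn2r ?nnegrE ?mulr_ge0 ?(ltW k0) //; exact: Ylip (dd1 s sd) (dd1 t td).
have dg a z j : Wd z -> is_derive z (delta_mx j ord0) (fun x => g x a ord0)
    (w ord0 j * q0 (g z) a ord0).
  move=> Wz; have [C C0 hC] := est (ws z) Wz; have [b b0 hb] := ball_cV_sub oW Wz.
  apply: (@quad_is_derive _ _ _ _ _ _ _ (C * (Cw + 1) ^+ 2) b) => //.
    by rewrite mulr_gt0 // exprn_gt0 // addr_gt0.
  move=> h hb'.
  have hn := norm_scale_delta (n := n) h j.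
  have wd : ws (delta_mx j ord0 : 'cV[R]_n) = w ord0 j.
    rewrite /slow_coord mxE (bigD1 j) //= mxE !eqxx mulr1 big1 ?addr0 // => i ij.
    by rewrite mxE (negbTE ij) mulr0.
  have Wh : Wd (h *: delta_mx j ord0 + z) by rewrite addrC; apply: hb; exact: le_trans hb'.
  have := hC _ Wh; rewrite slow_coordD slow_coordZ wd addrK => hq.
  rewrite (_ : _ - _ - _ = (g (h *: delta_mx j ord0 + z) - g z -
      (h * w ord0 j) *: q0 (g z)) a ord0); last by rewrite !mxE -mulrA.
  apply: le_trans (mx_coord_le _ _ _) _.
  move: hq; rewrite /g slow_coordD slow_coordZ wd => /le_trans; apply.
  rewrite -mulrA ler_pM2l // -exprMn ler_pXn2r ?nnegrE ?mulr_ge0 ?addr_ge0 ?(ltW Cw0) //.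
  rewrite -wd -slow_coordZ; apply: le_trans (hCw _) _.
  apply: ler_pM => //; first exact: ltW.
  by rewrite lerDl.
(* Bootstrap: if g is of class C^j, so is q0(g), which up to the entries of w is the derivative of
   g. *)
have sg j : Ckv j Wd g.
  elim: j => [|j IH] a.
    split=> // z Wz; apply: (@lipschitz_at _ _ _ Wd _ (k * Cw)) => //.
      by rewrite mulr_gt0.
    move=> y Wy.
    have -> : g z a ord0 - g y a ord0 = (g z - g y) a ord0 by rewrite !mxE.
    apply: le_trans (mx_coord_le _ _ _) _.
    apply: le_trans (Ylip _ _ (dd1 _ Wz) (dd1 _ Wy)) _.
    by rewrite -slow_coordB -mulrA ler_pM2l.
  apply: (CkSP (df := fun i z => w ord0 i * q0 (g z) a ord0)) => //.
    by move=> z Wz; exact: Ck_cont (IH a) Wz.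
  move=> i; apply: (@eq_Ck _ _ _ _ (fun z => w ord0 i * q0 (g z) a ord0)) => //.
    by move=> z Wz; apply/esym/derive_val; exact: dg.
  apply: Ck_mul => //; first exact: Ck_cst.
  exact: (Ckv_comp oW oB gB (sq0 j) IH).
exists k, d, Y, (fun z => q0 (g z)); split => //.
- move=> s sd; have [s1 s2 s3] := hY s (dd1 s sd).
  by split => //; [apply: rV|exact: Yquad (dd1 s sd)].
- by move=> j; split=> //; exact: (Ckv_comp oW oB gB (sq0 j) (sg j)).
- move=> z u Wz; apply/matrixP => a b; rewrite ord1 {b} mxE [RHS]mxE.
  rewrite /slow_coord mxE mulr_suml; apply: eq_bigr => i _; rewrite mxE.
  have -> : partial i (fun x => g x a ord0) z = w ord0 i * q0 (g z) a ord0.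
    by apply: derive_val; exact: dg.
  by rewrite mulrAC.
(* The slow coordinate is applied to the expansion of Y, and the increment t tends to 0. *)
- move=> z Wz; have [C C0 hC] := est (ws z) Wz.
  apply/eqP; rewrite eq_sym -subr_eq0 -normr_le0.
  apply: (@le0_of_small _ _ (Cw * C) ((d - `|ws z|) / 2)).
  - by rewrite divr_gt0 // subr_gt0.
  - by rewrite mulr_ge0 // ltW.
  move=> t t0 td; have sd : `|t + ws z| < d.
    apply: le_lt_trans (ler_normD _ _) _; rewrite gtr0_norm //.
    by have : `|ws z| < d := Wz; lra.
  have [_ _ s3] := hY _ (dd1 _ sd); have [_ _ t3] := hY _ (dd1 _ Wz).
  have := le_trans (hCw _) (ler_wpM2l (ltW Cw0) (hC _ sd)).
  rewrite addrK !slow_coordB slow_coordZ s3 t3 addrK -[X in X - _]mulr1 -mulrBr.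
  by rewrite normrM gtr0_norm // expr2 mulrA mulrA [leRHS]mulrC ler_pM2l.
Qed.

End SingularGraph.

(** * Nonexpansive retractions *)

Section Clamp.
Context {R : realType}.

Definition clamp (a t : R) := Num.max (- a) (Num.min a t).

Lemma clamp_le a t : 0 <= a -> `|clamp a t| <= a.
Proof.
by move=> a0; rewrite ler_norml /clamp le_max lexx /= ge_max ge_min lexx ge0_cp.
Qed.

Lemma clamp_id a t : `|t| <= a -> clamp a t = t.
Proof.
by rewrite ler_norml => /andP[t1 t2]; rewrite /clamp (min_r t2) (max_r t1).
Qed.

Lemma clamp_lip a s t : `|clamp a s - clamp a t| <= `|s - t|.
Proof.
have h x y : x <= y -> 0 <= clamp a y - clamp a x <= y - x.
  move=> xy; rewrite /clamp /Num.max /Num.min.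
  by do ![case: ifP]; move=> *; lra.
have [st|/ltW st] := leP s t; last first.
  by have /andP[h1 h2] := h _ _ st; rewrite ger0_norm // ger0_norm // subr_ge0.
rewrite distrC [leRHS]distrC.
by have /andP[h1 h2] := h _ _ st; rewrite ger0_norm // ger0_norm // subr_ge0.
Qed.

(** For the maximum norm, clamping each coordinate is a nonexpansive retraction onto a ball. *)
Definition clampv n (a : R) (x : 'cV[R]_n) : 'cV[R]_n := map_mx (clamp a) x.

Lemma clampv_le n a (x : 'cV[R]_n) : 0 <= a -> `|clampv a x| <= a.
Proof. by move=> a0; apply: cV_norm_le => // i; rewrite mxE clamp_le. Qed.

Lemma clampv_id n a (x : 'cV[R]_n) : `|x| <= a -> clampv a x = x.
Proof.
move=> xa; apply/matrixP => i j; rewrite mxE clamp_id //.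
by apply: le_trans xa; exact: mx_coord_le.
Qed.

Lemma clampv_lip n a (x y : 'cV[R]_n) : `|clampv a x - clampv a y| <= `|x - y|.
Proof.
apply: cV_norm_le => // i; rewrite !mxE; apply: le_trans (clamp_lip _ _ _) _.
by have := mx_coord_le (x - y) i ord0; rewrite !mxE.
Qed.

End Clamp.

(** * A perturbation vanishing on the line of equilibria gives an attracting system *)

Section PerturbedLinear.
Context {R : realType}.
Variables (l n : nat) (A : 'M[R]_n) (J : 'M[R]_(l, n)) (v : 'cV[R]_n)
  (w : 'rV[R]_n) (delta c : R).
Hypothesis hlin : linear_data A J v w delta c.

Local Notation ws := (slow_coord w).
Local Notation P := (1%:M - v *m w).

Lemma fast_projE (x : 'cV[R]_n) : P *m x = x - ws x *: v.
Proof. by rewrite mulmxBl mul1mx -mulmxA slow_coordE. Qed.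

Lemma slow_coord_proj (x : 'cV[R]_n) : ws (P *m x) = 0.
Proof. by rewrite fast_projE slow_coordB slow_coordZ (slow_coord_v hlin) mulr1 subrr. Qed.

Lemma fast_projK (x : 'cV[R]_n) : P *m (P *m x) = P *m x.
Proof. by rewrite fast_projE slow_coord_proj scale0r subr0. Qed.

Lemma fast_proj_v : P *m v = 0.
Proof. by rewrite fast_projE (slow_coord_v hlin) scale1r subrr. Qed.

Variables (W : set 'cV[R]_n) (F : 'cV[R]_n -> 'cV[R]_n).
Hypotheses (oW : open W) (W0 : W 0) (F_smooth : forall k, Ckv k W F)
  (dF0 : jac F 0 = 0) (F_slow : forall z, W z -> P *m z = 0 -> F z = 0).

Let X z := A *m z + F z.

Lemma perturbed_smooth k : Ckv k W X.
Proof.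
move=> i; apply: (@eq_Ck _ _ _ _ (fun z => (A *m z) i ord0 + F z i ord0)) => //.
  by move=> x _; rewrite [in RHS]mxE.
apply: Ck_add => //; last exact: F_smooth.
by apply: (@Ck_mulmx _ _ _ _ _ A (fun x => x)) => // j; exact: Ck_coord.
Qed.

Lemma perturbed_jac z : W z -> jac X z = A + jac F z.
Proof.
move=> Wz; apply/matrixP => i j; rewrite [in RHS]mxE !mxE.
have d1 : is_derive z (delta_mx j ord0) (fun x => (A *m x) i ord0) (A i j).
  apply: (@quad_is_derive _ _ _ _ _ _ _ 1 1) => // h _.
  rewrite mulmxDr -scalemxAr -colE !mxE addrK [leLHS](_ : _ = 0) ?mulr_ge0 //.
  by rewrite -[RHS](normr0 R); congr (`|_|); rewrite /GRing.scale /= subrr.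
have d2 := is_derive_C1 (delta_mx j ord0) oW (F_smooth 1 i) Wz.
have d3 := is_deriveD d1 d2.
have XE : (fun x => X x i ord0) = (fun x => (A *m x) i ord0) + (fun x => F x i ord0).
  by apply/funext => x; rewrite [LHS]mxE.
rewrite /partial XE (derive_val (is_derive := d3)); congr (_ + _).
rewrite (bigD1 j) //= mxE !eqxx mul1r big1 ?addr0 // => b bj.
by rewrite mxE (negbTE bj) mul0r.
Qed.

(** The truncated field has global solutions, along which J z decays at rate delta / 2 and the slow
    coordinate drifts by an integrable amount. Solutions issued near 0 thus never leave the box [K],
    where the truncation is the identity, and they are trajectories of the original field. *)
Lemma perturbed_attracting : exists K Om,
  attracting X P J W K Om (delta / 2) /\ Om 0.
Proof.
have [L [r [L0 r0 rW hL]]] := quad_lipschitz oW W0 (F_smooth 2) dF0.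
have [Cw Cw0 hCw] := slow_coord_bound w.
have [b0 b00 hb0] := mulmx_bound P.
have [b [b1 bb hb]] : exists b : R, [/\ 1 <= b, 0 < b & forall x : 'cV[R]_n, `|P *m x| <= b * `|x|].
  exists (b0 + 1); split; [by rewrite lerDr ltW|by rewrite addr_gt0|move=> x].
  by apply: le_trans (hb0 x) _; rewrite ler_wpM2r // lerDl.
have [j j0 hj] := mulmx_bound J; have [a0 a00 ha0] := mulmx_bound A.
have c0 := lin_c hlin; have dl0 := lin_delta hlin.
have PJ (x : 'cV[R]_n) : `|P *m x| <= c * `|J *m x|.
  by rewrite fast_projE -slow_coordE; exact: lin_PJ hlin x.
have JP (x : 'cV[R]_n) : J *m (P *m x) = J *m x.
  by rewrite fast_projE mulmxBr -scalemxAr (lin_Jv hlin) scaler0 subr0.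
(* A perturbation of size at most e |J u| spends at most half of the dissipation, as [small] will
   show. *)
have [e [e0 ehalf]] : exists e : R, 0 < e /\ (l%:R + 1) * (j * e) <= delta / 2.
  exists (delta / 2 / (l%:R + 1) / j); split.
    by rewrite !divr_gt0 // ltr_wpDl.
  by rewrite [leLHS](_ : _ = delta / 2) //; field; rewrite !lt0r_neq0 // ltr_wpDl.
pose rr := Num.min r (e / (L * b * c)).
have rr0 : 0 < rr by rewrite lt_min r0 divr_gt0 // !mulr_gt0.
have rrr : rr <= r by rewrite ge_min lexx.
have Lrr : L * rr * b * c <= e.
  have : rr <= e / (L * b * c) by rewrite ge_min lexx orbT.
  by rewrite ler_pdivlMr ?mulr_gt0 //; lra.
clearbody rr.
have vb : 0 < `|v| + b by rewrite ltr_wpDl.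
(* Half-width of the box [K]: a slow coordinate and a fast part bounded by a give a norm of at most
   rr. *)
pose a := rr / (`|v| + b).
have a_gt0 : 0 < a by rewrite divr_gt0.
have avb : a * `|v| + b * a = rr by rewrite /a; field; exact: lt0r_neq0.
clearbody a.
have small (u y : 'cV[R]_n) : `|y| <= e * `|J *m u| ->
    inner (J *m u) (J *m y) <= delta / 2 * inner (J *m u) (J *m u).
  move=> hy; apply: le_trans (ler_norm _) _; apply: le_trans (inner_le _ _) _.
  have h1 : `|J *m y| <= j * (e * `|J *m u|).
    by apply: le_trans (hj _) _; apply: ler_wpM2l => //; exact: ltW.
  apply: le_trans (_ : l%:R * (`|J *m u| * (j * (e * `|J *m u|))) <= _).
    by do 2!(apply: ler_wpM2l => //).
  apply: le_trans (_ : delta / 2 * `|J *m u| ^+ 2 <= _); last first.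
    by rewrite ler_pM2l ?divr_gt0 //; exact: sqr_norm_le_inner.
  apply: le_trans (_ : (l%:R + 1) * (j * e) * `|J *m u| ^+ 2 <= _); last first.
    by rewrite ler_wpM2r // exprn_ge0.
  rewrite [leLHS](_ : _ = l%:R * (j * e) * `|J *m u| ^+ 2); last by ring.
  by rewrite ler_wpM2r ?exprn_ge0 // ler_wpM2r ?mulr_ge0 ?lerDl // ltW.
pose K := [set z | `|ws z| <= a] `&` [set z | `|P *m z| <= a].
have Kr z : K z -> `|z| <= rr.
  move=> [/= h1 h2]; rewrite -(subrK (ws z *: v) z) -fast_projE.
  apply: le_trans (ler_normD _ _) _; rewrite normrZ addrC -avb; apply: lerD.
    exact: ler_wpM2r.
  by apply: le_trans h2 _; rewrite ler_peMl // ltW.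
have KW z : K z -> W z by move=> /Kr zr; apply: rW; exact: le_trans rrr.
have cw : continuous ws := @slow_coord_continuous _ _ w.
(* Truncating the slow and the fast part separately makes the field globally
   Lipschitz while keeping the line of [v] singular. *)
pose rho z := clamp a (ws z) *: v + P *m clampv a (P *m z).
have slow_rr s : `|s| <= a -> `|s *: v| <= rr.
  move=> sa; rewrite normrZ -avb; apply: le_trans (_ : a * `|v| <= _).
    exact: ler_wpM2r.
  by rewrite lerDl mulr_ge0 // ltW.
have rho_rr z : `|rho z| <= rr.
  apply: le_trans (ler_normD _ _) _; rewrite -avb normrZ; apply: lerD.
    by apply: ler_wpM2r => //; exact: clamp_le (ltW a_gt0).
  apply: le_trans (hb _) _; apply: ler_wpM2l; first exact: ltW.
  exact: clampv_le (ltW a_gt0).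
have rho_id z : K z -> rho z = z.
  move=> [/= h1 h2]; rewrite /rho clamp_id // clampv_id // fast_projK fast_projE.
  by rewrite subrKC.
(* F vanishes at the slow part of rho z, and the rest of rho z is controlled by |J z|. *)
have F_rho z : `|F (rho z)| <= e * `|J *m z|.
  set s := clamp a (ws z).
  have sa : `|s| <= a := clamp_le _ (ltW a_gt0).
  have Fs : F (s *: v) = 0.
    apply: F_slow; last by rewrite -scalemxAr fast_proj_v scaler0.
    by apply: rW; apply: le_trans (slow_rr _ sa) rrr.
  have [h _] := hL rr _ _ rrr (rho_rr z) (slow_rr s sa).
  rewrite Fs subr0 {2}/rho -/s addrC addKr in h; apply: le_trans h _.
  apply: le_trans (_ : L * rr * (b * (c * `|J *m z|)) <= _); last first.
    by rewrite mulrA mulrA ler_wpM2r.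
  rewrite ler_pM2l ?mulr_gt0 //; apply: le_trans (hb _) _; rewrite ler_pM2l //.
  apply: le_trans (PJ z); rewrite -[P *m z in leRHS]subr0.
  have c00 : clampv a (0 : 'cV[R]_n) = 0 by apply: clampv_id; rewrite normr0 ltW.
  by rewrite -[clampv a _]subr0 -[X in _ - X]c00; exact: clampv_lip.
pose lam := `|v| * Cw + b * b.
have lam0 : 0 < lam by rewrite ltr_wpDl ?mulr_gt0 // mulr_ge0 // ltW.
have rho_lip z y : `|rho z - rho y| <= lam * `|z - y|.
  rewrite /rho opprD addrACA -scalerBl -mulmxBr mulrDl.
  apply: le_trans (ler_normD _ _) _; apply: lerD.
    rewrite normrZ mulrC -mulrA ler_wpM2l //; apply: le_trans (clamp_lip _ _ _) _.
    by rewrite -slow_coordB.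
  apply: le_trans (hb _) _; rewrite -mulrA ler_pM2l //.
  by apply: le_trans (clampv_lip _ _ _) _; rewrite -mulmxBr.
pose Lg := a0 + L * rr * lam + 1.
have Lg1 : 1 <= Lg by rewrite lerDr addr_ge0 ?(ltW a00) // !mulr_ge0 // ltW.
pose Xr z := A *m z + F (rho z).
have Xr_lip z y : `|Xr z - Xr y| <= Lg * `|z - y|.
  rewrite /Xr opprD addrACA -mulmxBr; apply: le_trans (ler_normD _ _) _.
  have [h _] := hL rr _ _ rrr (rho_rr z) (rho_rr y).
  apply: le_trans (lerD (ha0 _) (le_trans h (ler_wpM2l _ (rho_lip z y)))) _.
    by rewrite mulr_ge0 // ltW.
  by rewrite mulrA -mulrDl ler_wpM2r // lerDl.
have Xr_cont : continuous Xr.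
  move=> x; apply: (@lipschitz_at _ _ _ setT _ Lg) => //; first exact: openT.
  exact: lt_le_trans Lg1.
pose E := e * ((l%:R + 1) * j).
have E0 : 0 < E by rewrite !mulr_gt0 // ltr_wpDl.
(* For all times S |z0| dominates the fast part, through the first summand, and the slow coordinate,
   through its initial value and twice the bound on its distance to its limit. *)
pose S := c * ((l%:R + 1) * j) + (Cw + 2 * (2 * (Cw * E) / (delta / 2))).
have S0 : 0 < S.
  by rewrite addr_gt0 ?addr_gt0 // !mulr_gt0 ?invr_gt0 ?mulr_gt0 ?invr_gt0 // ltr_wpDl.
have hS1 : c * ((l%:R + 1) * j) <= S.
  by rewrite lerDl ltW // addr_gt0 // !mulr_gt0 ?invr_gt0 ?mulr_gt0 ?invr_gt0.
have hS2 : Cw + 2 * (2 * (Cw * E) / (delta / 2)) <= S.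
  by rewrite lerDr ltW // !mulr_gt0 // ltr_wpDl.
pose Om := [set z : 'cV[R]_n | `|z| < a / S].
have traj_small z0 : Om z0 -> exists z, traj X K z0 z.
  move=> Oz; have Sz : S * `|z0| <= a by rewrite -ler_pdivlMl // mulrC ltW.
  have [||||z [ez hz]] := @picard_global R n (fun _ => Xr) Lg `|Xr z0| z0.
  - by move=> y cy t; apply: continuous_comp (cy t) (Xr_cont _).
  - by [].
  - by move=> t x y _; exact: Xr_lip.
  - by [].
  have Jdec t : 0 <= t -> `|J *m z t| <= (l%:R + 1) * j * `|z0| * expR (- (delta / 2) * t).
    move=> t0; apply: le_trans (@inner_decay R l (fun s => J *m z s)
      (fun s => J *m Xr (z s)) (delta / 2) _ _ t t0) _.
    - by move=> s s0; exact: (is_derive_mulmx J (hz s s0)).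
    - move=> s s0; rewrite /Xr mulmxDr innerDr.
      apply: le_trans (lerD (lin_diss hlin (z s)) (small _ _ (F_rho (z s)))) _.
      by rewrite -mulrDl; apply: ler_wpM2r; [exact: inner_ge0|lra].
    apply: ler_wpM2r; first exact: expR_ge0.
    by rewrite ez -mulrA; apply: ler_wpM2l; [exact: addr_ge0|exact: hj].
  have ele t : 0 <= t -> expR (- (delta / 2) * t) <= 1.
    move=> t0; rewrite -expR0 ler_expR mulNr oppr_le0 mulr_ge0 // divr_ge0 //.
    exact: ltW.
  have lj0 : 0 <= (l%:R + 1) * j by rewrite mulr_ge0 ?addr_ge0 // ltW.
  have d20 : 0 < delta / 2 by rewrite divr_gt0.
  have wn (x : 'cV[R]_n) : `|w *m x| <= Cw * `|x|.
    apply: cV_norm_le => [|i]; first by rewrite mulr_ge0 // ltW.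
    by rewrite ord1; exact: hCw.
  have wdz s : 0 <= s -> `|w *m Xr (z s)| <= Cw * E * `|z0| * expR (- (delta / 2) * s).
    move=> s0; rewrite mulmxDr mulmxA (lin_wA hlin) mul0mx add0r.
    apply: le_trans (wn _) _; rewrite [leRHS](_ : _ =
      Cw * (e * ((l%:R + 1) * j * `|z0| * expR (- (delta / 2) * s)))); last first.
      by rewrite /E; ring.
    rewrite ler_pM2l //; apply: le_trans (F_rho _) _; rewrite ler_pM2l //.
    exact: Jdec.
  have CE0 : 0 <= Cw * E * `|z0| by rewrite mulr_ge0 // mulr_ge0 // ltW.
  (* Since w A = 0, the slow coordinate moves through F alone, at an exponentially small speed. *)
  have [p hp] := exp_deriv_lim d20 CE0 (fun s s0 => is_derive_mulmx w (hz s s0)) wdz.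
  have wz t : 0 <= t -> `|ws (z t)| <= a.
    move=> t0; apply: le_trans Sz.
    have pt s : 0 <= s -> `|w *m z s - p| <= 2 * (Cw * E * `|z0|) / (delta / 2).
      move=> s0; apply: le_trans (hp s s0) _; rewrite -[leRHS]mulr1.
      apply: ler_wpM2l; last exact: ele.
      by apply: divr_ge0; [exact: mulr_ge0|exact: ltW].
    apply: le_trans (mx_coord_le (w *m z t) ord0 ord0) _.
    have -> : w *m z t = (w *m z t - p) + (w *m z0 - (w *m z 0 - p)).
      rewrite ez; move: (w *m z t) (w *m z0) => x y.
      by apply/matrixP => i i'; rewrite !mxE; ring.
    apply: le_trans (ler_normD _ _) _.
    apply: le_trans (lerD (pt t t0) (le_trans (ler_normB _ _) (lerD (wn z0) (pt 0 _)))) _.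
      by [].
    apply: le_trans (ler_wpM2r (normr_ge0 z0) hS2).
    by rewrite le_eqVlt; apply/orP; left; apply/eqP; ring.
  have Kz t : 0 <= t -> K (z t).
    move=> t0; split; first exact: wz.
    apply: le_trans (PJ _) _; apply: le_trans Sz.
    apply: le_trans (ler_wpM2r (normr_ge0 z0) hS1); rewrite -mulrA ler_pM2l //.
    apply: le_trans (Jdec t t0) _; rewrite -[leRHS]mulr1.
    by apply: ler_wpM2l; [exact: mulr_ge0|exact: ele].
  exists z; split => // t t0.
  by rewrite -[X in X (z t)]/X /X -{2}(rho_id _ (Kz t t0)); exact: hz.
exists K, Om; split; last by rewrite /Om /= normr0 divr_gt0.
split => //.
- apply: (closed_bounded_compact_cV Kr); apply: closedI.
    exact: closed_norm_le.
  by apply: closed_norm_le; exact: mulmx_continuous.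
- move=> x y t [/= x1 x2] [/= y1 y2] t0 t1.
  split => /=.
    rewrite slow_coordD slow_coordZ slow_coordB; exact: (@norm_convex R R).
  rewrite mulmxDr -scalemxAr mulmxBr; exact: norm_convex.
- by split; rewrite /= ?mulmx0 ?slow_coord0 normr0 ltW.
- move=> x y [/= x1 x2] [/= y1 y2]; split => /=.
    by rewrite slow_coordD slow_coordB !slow_coord_proj subr0 addr0.
  by rewrite mulmxDr mulmxBr !fast_projK subrr add0r.
- exact: perturbed_smooth.
- by rewrite mulmxBr mulmx1 mulmxA fast_proj_v mul0mx subr0.
- by rewrite mulmxBr mulmx1 mulmxA (lin_Jv hlin) mul0mx subr0.
- by exists c.
- move=> z Wz Pz; rewrite /X (F_slow Wz Pz) addr0.
  have -> : z = ws z *: v by rewrite -[LHS]subr0 -Pz fast_projE subKr.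
  by rewrite -scalemxAr (lin_Av hlin) scaler0.
- by rewrite divr_gt0.
- move=> z u Kz; rewrite (perturbed_jac (KW _ Kz)) mulmxDl mulmxDr innerDr.
  have -> : A *m (P *m u) = A *m u.
    by rewrite fast_projE mulmxBr -scalemxAr (lin_Av hlin) scaler0 subr0.
  have hs : `|jac F z *m (P *m u)| <= e * `|J *m u|.
    have [_ h] := hL rr z z rrr (Kr _ Kz) (Kr _ Kz).
    apply: le_trans (h _) _; apply: le_trans (ler_wpM2r _ Lrr); last by [].
    apply: le_trans (_ : L * rr * (c * `|J *m u|) <= _).
      by apply: ler_wpM2l; [rewrite mulr_ge0 // ltW|exact: PJ].
    rewrite mulrA ler_wpM2r // ler_wpM2r ?(ltW c0) // ler_peMr //.
    by rewrite mulr_ge0 // ltW.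
  apply: le_trans (lerD (lin_diss hlin u) (small _ _ hs)) _.
  by rewrite -mulrDl; apply: ler_wpM2r; [exact: inner_ge0|lra].
- by apply: (@open_norm_lt _ _ _ id) => x; exact: cvg_id.
- by move=> z /traj_small [y [<- _ h]]; exact: h.
Qed.

End PerturbedLinear.

(** * A curve of singular points produces a non-flat first integral *)

Section SufficientCondition.
Context {R : realType}.
Variables (l n : nat) (A : 'M[R]_n) (J : 'M[R]_(l, n)) (v : 'cV[R]_n)
  (w : 'rV[R]_n) (delta c : R).
Hypothesis hlin : linear_data A J v w delta c.
Variables (V : set 'cV[R]_n) (f : 'cV[R]_n -> 'cV[R]_n).
Hypotheses (V_open : open V) (V_0 : V 0) (f_smooth : forall k, Ckv k V f)
  (f0 : f 0 = 0) (df0 : jac f 0 = 0).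

Local Notation ws := (slow_coord w).
Local Notation P := (1%:M - v *m w).

(** The straightening x = z + G z has the explicit inverse z = x - G x, because G depends on the
    slow coordinate only and has slow coordinate 0; no inverse function theorem is called for. The
    integral is ws(h(x - G x)), with h the limit map of the straightened system. *)
Lemma singular_curve_integral :
  (exists C : set 'cV[R]_n,
     curve_through_origin C /\ (forall p, C p -> V p /\ A *m p + f p = 0)) ->
  exists (U : set 'cV[R]_n) (H : 'cV[R]_n -> R),
  [/\ [/\ open U, U 0, U `<=` V, Cinf U H & H 0 = 0],
   forall x, U x -> \sum_i partial i H x * (A *m x + f x) i ord0 = 0 &
   exists i, partial i H 0 != 0].
Proof.
move=> curve; have [k [d [Y [q [[k0 d0] hY sYq jY wq]]]]] :=
  singular_graph_smooth hlin V_open V_0 f_smooth f0 df0 curve.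
have [Cw Cw0 hCw] := slow_coord_bound w.
have wsv := slow_coord_v hlin.
have cw : continuous ws := @slow_coord_continuous _ _ w.
pose Wd := [set z | `|ws z| < d].
have oWd : open Wd by exact: open_norm_lt.
pose G z := Y (ws z) - (v *m w) *m z.
have GE z : G z = Y (ws z) - ws z *: v by rewrite /G -mulmxA slow_coordE.
have wG z : Wd z -> ws (G z) = 0.
  move=> Wz; have [_ _ h _] := hY _ Wz.
  by rewrite GE slow_coordB slow_coordZ h wsv mulr1 subrr.
have sG j : Ckv j Wd G.
  move=> i; apply: (@eq_Ck _ _ _ _ (fun z => Y (ws z) i ord0 - ((v *m w) *m z) i ord0)) => //.
    by move=> x _; rewrite [RHS]mxE [X in _ = _ + X]mxE.
  apply: Ck_sub => //; first exact: (sYq j).1.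
  by apply: (@Ck_mulmx _ _ _ _ _ (v *m w) (fun x => x)) => // a; exact: Ck_coord.
have [e1 e10 he1] : exists2 e : R, 0 < e & forall z, `|z| <= e ->
    [/\ Wd z, `|G z| <= `|z| & `|G z| <= k * Cw ^+ 2 * `|z| ^+ 2].
  exists (Num.min (d / (2 * Cw)) (k * Cw ^+ 2)^-1).
    by rewrite lt_min divr_gt0 ?invr_gt0 ?mulr_gt0 // exprn_gt0.
  move=> z; rewrite le_min => /andP[z1 z2].
  have Wz : Wd z.
    apply: le_lt_trans (hCw z) _; rewrite -ltr_pdivlMl //.
    apply: le_lt_trans z1 _; rewrite invfM mulrCA mulrA mulrC ltr_pM2l ?invr_gt0 //.
    by rewrite mulrC ltr_pdivrMr // ltr_pMr // ltr1n.
  have Gq : `|G z| <= k * Cw ^+ 2 * `|z| ^+ 2.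
    have [_ _ _ h] := hY _ Wz; rewrite GE; apply: le_trans h _.
    by rewrite -mulrA ler_pM2l // -exprMn ler_pXn2r ?nnegrE ?mulr_ge0 ?(ltW Cw0).
  split => //; apply: le_trans Gq _; rewrite [`|z| ^+ 2]expr2 mulrA -[leRHS]mul1r.
  apply: ler_wpM2r => //; rewrite -ler_pdivlMl ?mulr1 //.
  by rewrite mulr_gt0 // exprn_gt0.
have [L [rf [L0 rf0 rfV hL]]] := quad_lipschitz V_open V_0 (f_smooth 2) df0.
have fq y : `|y| <= rf -> `|f y| <= L * `|y| ^+ 2.
  move=> hy; have zy : `|0 : 'cV[R]_n| <= `|y| by rewrite normr0.
  have [h _] := hL _ y 0 hy (lexx `|y|) zy.
  by rewrite f0 !subr0 -mulrA -expr2 in h.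
have W00 : Wd 0 by rewrite /Wd /= slow_coord0 normr0.
have [e2 e20 [Q Q0 hQ]] : exists2 e : R, 0 < e & exists2 Q : R, 0 < Q &
    forall z, `|z| <= e -> Wd z -> `|q z - v| <= Q.
  have cq : {for 0, continuous q}.
    by apply: continuous_at_cV => i; exact: Ck_cont ((sYq 0%N).2 i) W00.
  have /cvgrPdist_le /(_ _ ltr01) /nbhs_ballP [b /= b0 hb] := cq.
  exists (b / 2); first by rewrite divr_gt0.
  exists (1 + `|q 0 - v|); first by rewrite ltr_wpDr.
  move=> z zb _; rewrite -(subrKA (q 0)); apply: le_trans (ler_normD _ _) _.
  apply: lerD => //; rewrite distrC; apply: hb; rewrite -ball_normE /= sub0r normrN.
  by apply: le_lt_trans zb _; rewrite ltr_pdivrMr // ltr_pMr // ltr1n.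
pose e := Num.min (Num.min e1 e2) (rf / 2).
have e0 : 0 < e by rewrite !lt_min e10 e20 divr_gt0.
have he z : `|z| <= e -> [/\ `|z| <= e1, `|z| <= e2 & `|z + G z| <= rf].
  rewrite !le_min => /andP[/andP[z1 z2] z3]; split => //.
  apply: le_trans (ler_normD _ _) _; have [_ h _] := he1 z z1.
  by move: h z3; lra.
have erf : e <= rf.
  apply: le_trans (_ : rf / 2 <= _); first by rewrite ge_min lexx orbT.
  by rewrite ler_pdivrMr // ler_pMr // ler1n.
clearbody e.
pose W := [set z : 'cV[R]_n | `|z| < e].
have oW : open W by apply: (@open_norm_lt _ _ _ id) => x; exact: cvg_id.
have W0 : W 0 by rewrite /W /= normr0.
have WWd z : W z -> Wd z by move=> /ltW /he [/he1 [h _ _] _ _].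
have uV z : W z -> V (z + G z) by move=> /ltW /he [_ _ h]; exact: rfV.
(* In the coordinate [z] with [x = u z] the singular curve is the line of [v],
   and the vector field becomes [A z + F z]. *)
pose u z := z + G z.
pose F z := f (u z) + A *m G z - ws (f (u z)) *: (q z - v).
have su j : Ckv j W u.
  move=> i; apply: (@eq_Ck _ _ _ _ (fun z => z i ord0 + G z i ord0)) => //.
    by move=> x _; rewrite [RHS]mxE.
  by apply: Ck_add => //; [exact: Ck_coord|exact: sub_Ck (sG j i)].
have sfu j : Ckv j W (fun z => f (u z)) by exact: Ckv_comp oW V_open uV (f_smooth j) (su j).
have sF j : Ckv j W F.
  move=> i; apply: (@eq_Ck _ _ _ _ (fun z => f (u z) i ord0 + (A *m G z) i ord0 -
     (w *m f (u z)) ord0 ord0 * (q z i ord0 - v i ord0))) => //.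
    by move=> x _; rewrite /F /slow_coord !mxE.
  apply: Ck_sub => //; first apply: Ck_add => //.
  - exact: sfu.
  - by apply: Ck_mulmx => // a; exact: sub_Ck (sG j a).
  - apply: Ck_mul => //; first by apply: Ck_mulmx => // a; exact: sfu.
    by apply: Ck_sub => //; [exact: sub_Ck ((sYq j).2 i)|exact: Ck_cst].
have [a a0 ha] := mulmx_bound A.
(* Every term of F is O(|z|^2): f(u z) and G z are quadratic, and q z - v stays bounded. *)
have dF0 : jac F 0 = 0.
  apply: (@jac_quad0 _ _ _ 0 W F (4 * L + a * (k * Cw ^+ 2) + Cw * (4 * L) * Q) (e / 2)) => //.
  - by rewrite !addr_gt0 // !mulr_gt0 // exprn_gt0.
  - by rewrite divr_gt0.
  move=> z ze; have {}ze : `|z| <= e by move: ze e0; lra.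
  have [z1 z2 z3] := he z ze; have [Wz G1 G2] := he1 z z1.
  have uz : `|u z| <= 2 * `|z|.
    by apply: le_trans (ler_normD _ _) _; move: G1; lra.
  have fu : `|f (u z)| <= 4 * L * `|z| ^+ 2.
    apply: le_trans (fq _ z3) _; rewrite [4 * L]mulrC -mulrA ler_pM2l //.
    have -> : 4 * `|z| ^+ 2 = (2 * `|z|) ^+ 2 by ring.
    by rewrite ler_pXn2r ?nnegrE // mulr_ge0.
  apply: le_trans (ler_normB _ _) _; rewrite mulrDl; apply: lerD.
    apply: le_trans (ler_normD _ _) _; rewrite mulrDl; apply: lerD => //.
    by apply: le_trans (ha _) _; rewrite -mulrA ler_pM2l.
  rewrite normrZ [leRHS]mulrAC; apply: ler_pM => //; last exact: hQ.
  by apply: le_trans (hCw _) _; rewrite -mulrA ler_pM2l.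
have F_slow z : W z -> P *m z = 0 -> F z = 0.
  move=> /WWd Wz Pz; have [_ eY _ _] := hY _ Wz.
  have zE : z = ws z *: v by rewrite -[LHS]subr0 -Pz fast_projE subKr.
  have uE : u z = Y (ws z) by rewrite /u GE [X in X + _]zE subrKC.
  have wf : ws (f (u z)) = 0.
    have := congr1 ws eY; rewrite slow_coordD (slow_coord_A hlin) add0r slow_coord0.
    by rewrite uE.
  rewrite /F wf scale0r subr0 uE GE mulmxBr -scalemxAr (lin_Av hlin) scaler0 subr0.
  by rewrite addrC.
have [K [Om [hA Om0]]] := perturbed_attracting hlin oW W0 sF dF0 F_slow.
set X := fun z => A *m z + F z in hA.
pose h := flow_lim X K.
have h_unique z0 z p : traj X K z0 z -> z @ +oo --> p -> h z0 = p.
  by move=> /(flow_limP hA); apply: (cvg_unique (@norm_hausdorff _ _)).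
(* A trajectory translated in time is a trajectory with the same limit. *)
have h_const z0 z t : traj X K z0 z -> 0 <= t -> h (z t) = h z0.
  move=> tz t0; have [ez hz Kz] := tz.
  apply: (@h_unique _ (fun s => z (t + s *: (1 : R)))).
    split.
    - by rewrite scale0r addr0.
    - by move=> s s0; apply: is_derive_line; apply: hz; rewrite addr_ge0 // mulr_ge0.
    - by move=> s s0; apply: Kz; rewrite addr_ge0 // mulr_ge0.
  move=> N /(flow_limP hA tz) [M [Mr hM]]; exists (M - t); split; first exact: num_real.
  move=> s hs; apply: hM; rewrite [s *: 1]mulr1; move: hs; lra.
have h_slow s : Om (s *: v) -> h (s *: v) = s *: v.
  move=> Os; have Ks := att_OmK hA Os.
  have Xs : X (s *: v) = 0.
    by apply: (att_eq hA (att_KW hA Ks)); rewrite -scalemxAr (fast_proj_v hlin) scaler0.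
  apply: (@h_unique _ (fun=> s *: v)); last exact: cvg_cst.
  by split => // t _; rewrite Xs; exact: is_derive_cst.
pose b x := x - G x.
have [et et0 het] := ball_cV_sub (att_openOm hA) Om0.
pose eta := Num.min e (et / 2).
have eta0 : 0 < eta by rewrite lt_min e0 divr_gt0.
pose U := [set x : 'cV[R]_n | `|x| < eta].
have oU : open U by apply: (@open_norm_lt _ _ _ id) => x; exact: cvg_id.
have UW x : U x -> W x by rewrite /U /W /= lt_min => /andP[].
have bOm x : U x -> Om (b x).
  move=> Ux; have /ltW /he [/he1 [_ h1 _] _ _] := UW _ Ux.
  rewrite -[b x]add0r; apply: het; apply: le_trans (ler_normB _ _) _.
  have h2 : `|x| < et / 2 by move: Ux; rewrite /U /= lt_min => /andP[].
  by move: h1 h2; lra.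
pose H x := ws (h (b x)).
have sb j : Ckv j U b.
  move=> i; apply: (@eq_Ck _ _ _ _ (fun z => z i ord0 - G z i ord0)) => //.
    by move=> x _; rewrite [RHS]mxE [(- G x) i ord0]mxE.
  apply: Ck_sub => //; first exact: Ck_coord.
  by apply: sub_Ck (sG j i) => x /UW /WWd.
have sH : Cinf U H.
  move=> j; apply: (@Ck_mulmx _ _ _ j U w (fun x => h (b x)) ord0 oU).
  exact: Ckv_comp oU (att_openOm hA) bOm (flow_lim_smooth j hA) (sb j).
have bu z : Wd z -> b (u z) = z.
  move=> Wz; have e3 : ws (u z) = ws z by rewrite /u slow_coordD wG // addr0.
  by rewrite /b GE e3 -GE /u addrK.
have ub x : Wd x -> u (b x) = x.
  move=> Wx; have e3 : ws (b x) = ws x by rewrite /b slow_coordB wG // subr0.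
  by rewrite /u GE e3 -GE /b subrK.
have G0 : G 0 = 0.
  have z1 : `|0 : 'cV[R]_n| <= e1 by rewrite normr0 ltW.
  by have [_ + _] := he1 0 z1; rewrite normr0 normr_le0 => /eqP.
have H0 : H 0 = 0.
  by rewrite /H /b G0 subr0 -(scale0r v) h_slow scale0r // slow_coord0.
exists U, H; split.
- split => //; first by rewrite /U /= normr0.
  by move=> x /UW xe; apply: rfV; exact: le_trans (ltW xe) erf.
- move=> x Ux; have Wx := WWd _ (UW _ Ux).
  have [z tz] := att_traj hA (bOm x Ux); have [ez hz Kz] := tz.
  have Wz t : 0 <= t -> Wd (z t) by move=> t0; apply: WWd; exact: (att_KW hA (Kz t t0)).
  (* The derivative of G along the motion is ws(z') (q z - v), and ws(z') = ws(f x) because ws(q z -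
     v) = 0; this is exactly the term subtracted in F, so the original field reappears. *)
  have du : is_derive (0 : R) (1 : R) (fun t => u (z t)) (A *m x + f x).
    have h1 := hz 0 (lexx 0).
    have h2 := is_derive_C1v_comp oWd (sYq 1%N).1 (Wz 0 (lexx 0)) h1.
    have h3 := is_deriveD h1 (is_deriveB h2 (is_derive_mulmx (v *m w) h1)).
    apply: is_derive_eq h3 _; rewrite jY ?Wz //.
    have wX : ws (X (z 0)) = ws (f x).
      rewrite /X slow_coordD (slow_coord_A hlin) add0r /F slow_coordB slow_coordD.
      rewrite (slow_coord_A hlin) slow_coordZ slow_coordB wsv wq ?Wz //.
      by rewrite subrr mulr0 subr0 addr0 ez ub.
    rewrite wX -mulmxA slow_coordE wX /X /F ez ub //.
    have -> : A *m x = A *m b x + A *m G (b x).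
      by rewrite -mulmxDr -[b x + _]/(u (b x)) ub.
    move: (A *m b x) (A *m G (b x)) (q _) (ws _) => y1 y2 y3 y4.
    by apply/matrixP => i i'; rewrite !mxE; ring.
  have Uz : U (u (z 0)) by rewrite ez ub.
  have dH := is_derive_C1_comp (z := fun t : R => u (z t)) oU (sH 1%N) Uz du.
  have := right_cst_derive0 dH; rewrite ez ub // => e3.
  rewrite -[RHS]e3; first by apply: eq_bigr => i _; rewrite mulrC.
  move=> t t0; rewrite /H !bu; [|exact: Wz..].
  by rewrite !(h_const _ _ _ tz).
(* With zero first derivatives H would be O(|x|^2), whereas H(Y s) = s along the singular curve,
   where |Y s| = O(s). *)
- apply: contrapT => hn.
  have flat : flat_below 2 H.
    case=> [|i [|//]] _; first exact: H0.
    by apply/eqP; apply/negPn/negP => hi; apply: hn; exists i.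
  have rU x : `|x| <= eta / 2 -> U x.
    by rewrite /U /=; move: eta0; lra.
  have [C C0 hC] := flat_bound oU (divr_ge0 (ltW eta0) (ler0n _ 2)) rU sH flat.
  (* The range of s for which Y s stays in the domain of H and s v in that of the limit map. *)
  pose m := Num.min (Num.min 1 (d / 2)) (Num.min (eta / 2 / (`|v| + k)) (et / (`|v| + 1))).
  have vk : 0 < `|v| + k by rewrite ltr_wpDl.
  have v1 : 0 < `|v| + 1 by rewrite ltr_wpDl.
  have m0 : 0 < m by rewrite !lt_min ltr01 !divr_gt0.
  suff : (1 : R) <= 0 by rewrite ler10.
  apply: (@le0_of_small _ _ (C * (`|v| + k) ^+ 2) m) => //.
    by rewrite mulr_ge0 // ?exprn_ge0 // ltW.
  move=> s s0; rewrite !le_min => /andP[/andP[s1 sd] /andP[s3 s4]].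
  have sn : `|s| = s := gtr0_norm s0.
  have Ws : `|s| < d by rewrite sn; move: sd d0; lra.
  have [_ _ wY qY] := hY s Ws.
  have Yle : `|Y s| <= (`|v| + k) * s.
    rewrite -(subrK (s *: v) (Y s)) mulrDl addrC; apply: le_trans (ler_normD _ _) _.
    rewrite normrZ sn mulrC lerD2l; apply: le_trans qY _; rewrite ler_pM2l // sn.
    by rewrite expr2 -[leRHS]mulr1 ler_pM2l.
  have Ye : `|Y s| <= eta / 2.
    by apply: le_trans Yle _; rewrite mulrC -ler_pdivlMr.
  have bY : b (Y s) = s *: v by rewrite /b GE wY subKr.
  have Os : Om (s *: v).
    rewrite -[s *: v]add0r; apply: het; rewrite normrZ sn.
    apply: le_trans (_ : s * (`|v| + 1) <= _); last by rewrite -ler_pdivlMr // ltr_wpDl.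
    by rewrite ler_pM2l // lerDl.
  have := hC _ Ye; rewrite /H bY h_slow // slow_coordZ wsv mulr1 sn => hs.
  have {hs} := le_trans hs (ler_wpM2l (ltW C0) _) => /(_ (((`|v| + k) * s) ^+ 2)).
  rewrite ler_pXn2r ?nnegrE ?mulr_ge0 ?(ltW vk) ?(ltW s0) // => /(_ Yle).
  by rewrite exprMn mulrA expr2 mulrA -[leLHS]mul1r ler_pM2r.
Qed.

End SufficientCondition.

(** * Taylor coefficients of order at most one, and conclusion *)

Section TaylorCoefficients.
Context {R : realType} {n : nat}.

Lemma multi_partial0 (W : normedModType R) (g : 'cV[R]_n -> W) :
  multi_partial (fun=> 0%N) g = g.
Proof.
by rewrite /multi_partial; elim: (enum 'I_n) => //= a s IH; exact: IH.
Qed.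

Lemma multi_partial1 (W : normedModType R) i (g : 'cV[R]_n -> W) :
  multi_partial (fun j => (j == i) : nat) g = partial i g.
Proof.
rewrite /multi_partial.
have -> s : flatten [seq nseq (j == i : nat) j | j <- s] = [seq j <- s | j == i].
  by elim: s => //= j s ->; case: (j == i).
by rewrite filter_pred1_uniq ?enum_uniq ?mem_enum.
Qed.

Lemma taylor_coef_eq0 (W : normedModType R) alpha (g : 'cV[R]_n -> W) a :
  (taylor_coef g a alpha == 0) = (multi_partial alpha g a == 0).
Proof.
rewrite scaler_eq0 invr_eq0 pnatr_eq0.
suff /negbTE -> : (\prod_i (alpha i)`!)%N != 0%N by [].
by rewrite -lt0n prodn_gt0 // => i; exact: fact_gt0.
Qed.

Lemma no_terms_value (f : 'cV[R]_n -> 'cV[R]_n) :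
  no_constant_nor_linear_terms f -> f 0 = 0.
Proof.
move=> h; have h0 : (\sum_(i < n) 0 <= 1)%N by rewrite big1.
by have /eqP := h _ h0; rewrite taylor_coef_eq0 multi_partial0 => /eqP.
Qed.

Lemma no_terms_jac V (f : 'cV[R]_n -> 'cV[R]_n) : V 0 -> smooth_on V f ->
  no_constant_nor_linear_terms f -> jac f 0 = 0.
Proof.
move=> V0 sf h; apply/matrixP => i j; rewrite !mxE.
have [_ /(_ j) d] := sf [::] 0 V0.
have hj : (\sum_a (a == j) <= 1)%N by rewrite -big_mkcond sum1_card card1.
have /eqP := h _ hj; rewrite taylor_coef_eq0 multi_partial1 => /eqP.
by rewrite /partial derive_mx // => /matrixP /(_ i ord0); rewrite !mxE.
Qed.

End TaylorCoefficients.

(** Scaling the field by a nonzero number changes neither its first integrals nor its singular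
    points, so the contracting case settles both signs. *)
Lemma first_integral_iff_singular_curve (R : realType) (l n : nat)
    (A : 'M[R]_n) (J : 'M[R]_(l, n)) v w delta c (eps : R)
    (V : set 'cV[R]_n) (f : 'cV[R]_n -> 'cV[R]_n) :
  eps != 0 -> linear_data (eps *: A) J v w delta c ->
  open V -> V 0 -> smooth_on V f -> no_constant_nor_linear_terms f ->
  (exists (U : set 'cV[R]_n) (H : 'cV[R]_n -> R),
     [/\ open U, U 0, U `<=` V, smooth_first_integral A f U H & non_flat H])
  <->
  (exists C : set 'cV[R]_n,
     curve_through_origin C /\ (forall p, C p -> singular_point A f V p)).
Proof.
move=> e0 hlin oV V0 sf ho; pose fe x := eps *: f x.
have f0 := no_terms_value ho; have df0 := no_terms_jac V0 sf ho.
have sfe k : Ckv k V fe.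
  move=> i; apply: (@eq_Ck _ _ _ _ (fun x => eps * f x i ord0)) => //.
    by move=> x _; rewrite [RHS]mxE.
  apply: Ck_mul => //; [exact: Ck_cst|exact: smooth_on_coord].
have fe0 : fe 0 = 0 by rewrite /fe f0 scaler0.
have dfe0 : jac fe 0 = 0.
  apply/matrixP => i j; rewrite !mxE.
  have d1 := is_derive_C1 (delta_mx j ord0) oV (smooth_on_coord i oV sf 1%N) V0.
  have -> : (fun x => fe x i ord0) = eps \*: (fun x => f x i ord0).
    by apply/funext => x; rewrite [LHS]mxE.
  rewrite /partial deriveZ; last exact: ex_derive.
  have /matrixP /(_ i j) := df0; rewrite !mxE /partial => ->; exact: scaler0.
have eX p : (eps *: A) *m p + fe p = eps *: (A *m p + f p).
  by rewrite scalerDr scalemxAl.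
have eX0 p : (eps *: A) *m p + fe p = 0 <-> A *m p + f p = 0.
  rewrite eX; split=> [/eqP|->]; last exact: scaler0.
  by rewrite scaler_eq0 (negbTE e0) /= => /eqP.
split=> [[U [H [oU U0 UV [sH H0 hH] [alpha ha]]]]|[C [hC hs]]].
  have [||C [hC hs]] := integral_singular_curve hlin oV V0 sfe fe0 dfe0 oU U0
    ((smooth_onP U H).1 sH) H0.
  - move=> x Ux; rewrite eX; have := hH x Ux => e.
    rewrite -[RHS](mulr0 eps) -[in RHS]e /inner mulr_sumr.
    by apply: eq_bigr => i _; rewrite [gradient H x i ord0]mxE [in LHS]mxE mulrCA.
  - by move: ha; rewrite taylor_coef_eq0; exists (flatten [seq nseq (alpha i) i | i <- enum 'I_n]).
  by exists C; split => // p /hs [Vp /eX0].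
have [|U [H [[oU U0 UV sH H0] hH [i hi]]]] := singular_curve_integral hlin oV V0 sfe fe0 dfe0.
  by exists C; split => // p /hs [Vp e]; split => //; exact/eX0.
exists U, H; split => //; last first.
  by exists (fun j => (j == i) : nat); rewrite taylor_coef_eq0 multi_partial1.
split => //; first exact/smooth_onP.
move=> x Ux; apply: (mulfI e0); rewrite mulr0 -(hH x Ux) eX /inner mulr_sumr.
by apply: eq_bigr => a _; rewrite [gradient H x a ord0]mxE [in RHS]mxE mulrCA.
Qed.

Theorem theorem2 (R : realType) (n : nat) (n_gt0 : (0 < n)%N)
    (A : 'M[R]_n) (V : set 'cV[R]_n) (f : 'cV[R]_n -> 'cV[R]_n)
    (V_open : open V) (V_0 : V 0)
    (f_smooth : smooth_on V f)
    (f_ho : no_constant_nor_linear_terms f)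
    (lambda : 'I_n -> R[i])
    (lambda_eig : eigenvalues_of A lambda)
    (lambda_1 : lambda (Ordinal n_gt0) = 0)
    (lambda_sign :
       (forall i, i != Ordinal n_gt0 -> 0 < complex.Re (lambda i)) \/
       (forall i, i != Ordinal n_gt0 -> complex.Re (lambda i) < 0)) :
  (exists (U : set 'cV[R]_n) (H : 'cV[R]_n -> R),
     [/\ open U, U 0, U `<=` V, smooth_first_integral A f U H & non_flat H])
  <->
  (exists C : set 'cV[R]_n,
     curve_through_origin C /\ (forall p, C p -> singular_point A f V p)).
Proof.
have [e [e0 he]] : exists e : R, e != 0 /\
    forall i, i != Ordinal n_gt0 -> e * complex.Re (lambda i) < 0.
  case: lambda_sign => h; [exists (-1)|exists 1].
    by rewrite oppr_eq0 oner_neq0; split => // i /h; rewrite mulN1r oppr_lt0.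
  by rewrite oner_neq0; split => // i /h; rewrite mul1r.
have [l [J [v [w [delta [c [[Av wA wv Jv] d0 c0 hPJ hdiss]]]]]]] :=
  linear_structure lambda_eig lambda_1 he.
apply: (@first_integral_iff_singular_curve _ l n A J v w delta c e) => //.
split => //.
- by rewrite -scalemxAl Av scaler0.
- by rewrite -scalemxAr wA scaler0.
- by move=> x; rewrite -scalemxAl.
Qed.
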